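(* Let $\mathfrak S$ be a locally convex algebra and $\mathfrak A=\mathcal K_{\mathbb Z}(\mathfrak S)$. Then the unit group of the pointed Toeplitz algebra over $\mathfrak A$, i.e. $\mathtt U(\mathcal T_{\mathbb N}(\mathfrak A)^{\mathrm{po}})$, is contractible.
   Context: A locally convex algebra is a (not necessarily unital) associative algebra on a sequentially complete Hausdorff locally convex vector space with (jointly) continuous bilinear multiplication. $\mathbb N=\{0,1,2,\ldots\}$. For $\Theta=\mathbb N$ or $\mathbb Z$, $\mathcal K_\Theta(\mathfrak S)$ is the locally convex algebra of matrices $(s_{n,m})_{n,m\in\Theta}$ over $\mathfrak S$ with $\sum_{n,m}(1+|n|)^kp(s_{n,m})(1+|m|)^l<\infty$ for all $k,l\in\mathbb N$ and all continuous seminorms $p$. $\mathfrak A[\mathsf z^{-1},\mathsf z]$ is the algebra of Laurent series $\sum_{n\in\mathbb Z}a_n\mathsf z^n$ with $\sum_n(1+|n|)^kp(a_n)<\infty$ for all $k,p$. For $a=\sum a_i\mathsf z^i\in\mathfrak A[\mathsf z^{-1},\mathsf z]$, $\mathsf W(a)=\sum_{n,m\in\mathbb N}a_{n-m}\mathbf e_{n,m}$ is the Toeplitz matrix; $\mathcal W_{\mathbb N}(\mathfrak A)=\{\mathsf W(a)\}$ carries the topology of $\mathfrak A[\mathsf z^{-1},\mathsf z]$. The Toeplitz algebra is $\mathcal T_{\mathbb N}(\mathfrak A)=\mathcal W_{\mathbb N}(\mathfrak A)+\mathcal K_{\mathbb N}(\mathfrak A)$ (a direct sum, topologized as such) with matrix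 multiplication; it is a locally convex algebra. The symbol map is the homomorphism $\sigma:\mathcal T_{\mathbb N}(\mathfrak A)\to\mathfrak A[\mathsf z^{-1},\mathsf z]$, $\sigma(\mathsf W(a)+p)=a$. The pointed Toeplitz algebra $\mathcal T_{\mathbb N}(\mathfrak A)^{\mathrm{po}}$ is the closed subalgebra of elements whose symbol $a(\mathsf z)$ satisfies $a(1)=0$. For a not necessarily unital topological algebra $\mathfrak B$, $\mathtt U(\mathfrak B)$ is the group of invertible elements $1+b$ of the semigroup $1+\mathfrak B$ (formal adjoined unit; the identity matrix for matrix algebras), with topology induced from $(1+b)\mapsto(1+b,(1+b)^{-1})\in(1+\mathfrak B)\times(1+\mathfrak B)$. *)

(* Defs.v *)
From HB Require Import structures.
From mathcomp Require Import all_boot all_order all_algebra finmap.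
From mathcomp Require Import all_classical all_reals all_analysis.
From mathcomp.analysis.showcase Require summability.

Set Implicit Arguments.
Unset Strict Implicit.
Unset Printing Implicit Defensive.

Import Order.TTheory GRing.Theory Num.Theory.
Import numFieldNormedType.Exports.

Local Open Scope classical_set_scope.
Local Open Scope ring_scope.

Definition is_seminorm (R : realType) (V : lmodType R) (p : V -> R) : Prop :=
  (forall x y, p (x + y) <= p x + p y) /\ (forall c x, p (c *: x) = `|c| * p x).

Section SeminormTheory.
Context (R : realType) (V : lmodType R).

Lemma seminorm0 (p : V -> R) : is_seminorm p -> p 0 = 0.
Proof. by move=> [_ pZ]; rewrite -(scale0r (0 : V)) pZ normr0 mul0r. Qed.

Lemma seminormN (p : V -> R) (x : V) : is_seminorm p -> p (- x) = p x.
Proof. by move=> [_ pZ]; rewrite -scaleN1r pZ normrN1 mul1r. Qed.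

Lemma seminorm_ge0 (p : V -> R) (x : V) : is_seminorm p -> 0 <= p x.
Proof.
move=> sp; have := sp.1 x (- x).
by rewrite subrr seminorm0// seminormN// -mulr2n pmulrn_lge0.
Qed.

Lemma seminorm_sum (I : Type) (s : seq I) (p : I -> V -> R) :
  (forall i, is_seminorm (p i)) -> is_seminorm (fun x => \sum_(i <- s) p i x).
Proof.
move=> sp; split=> [x y|c x].
  by rewrite -big_split; apply: ler_sum => i _; exact: (sp i).1.
by rewrite mulr_sumr; apply: eq_bigr => i _; exact: (sp i).2.
Qed.

End SeminormTheory.

HB.factory Record Lmodule_hasSeminorms (R : realType) E of GRing.Lmodule R E := {
  seminorm_index : Type;
  seminorm_of : seminorm_index -> E -> R;
  seminorm_ofP : forall i, is_seminorm (seminorm_of i)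
}.

HB.builders Context (R : realType) E of Lmodule_hasSeminorms R E.

Local Notation q s x := (\sum_(i <- s) seminorm_of i x).

Let sn_q s : is_seminorm (fun x : E => q s x).
Proof. exact/seminorm_sum/seminorm_ofP. Qed.

Let q_cat s t x : q (s ++ t) x = q s x + q t x.
Proof. by rewrite big_cat. Qed.

Let q_ge0 s x : 0 <= q s x.
Proof. exact: (seminorm_ge0 _ (sn_q s)). Qed.

Definition seminorm_ball (x : E) (s : seq seminorm_index) (e : R) : set E :=
  [set y | q s (y - x) < e].

Definition seminorm_nbhs (x : E) : set_system E :=
  [set U | exists s e, 0 < e /\ seminorm_ball x s e `<=` U].

HB.instance Definition _ := hasNbhs.Build E seminorm_nbhs.

Let nbhs_ball (x : E) s e : 0 < e -> nbhs x (seminorm_ball x s e).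
Proof. by move=> e0; exists s, e; split=> // y. Qed.

Let ball_nbhs (x y : E) s e : seminorm_ball x s e y ->
  nbhs y (seminorm_ball x s e).
Proof.
rewrite /seminorm_ball/= => yx; exists s, (e - q s (y - x)); rewrite subr_gt0.
split=> // z; rewrite /seminorm_ball/= ltrBrDr; apply: le_lt_trans.
by have := (sn_q s).1 (z - y) (y - x); rewrite addrA subrK.
Qed.

Let nbhs_pf (x : E) : ProperFilter (nbhs x).
Proof.
split.
  move=> [s [e [e0 /(_ x)]]]; apply.
  by rewrite /seminorm_ball/= subrr (seminorm0 (sn_q s)).
split.
- by exists [::], 1; split.
- move=> A B [s [e [e0 sA]]] [t [d [d0 tB]]].
  exists (s ++ t), (Num.min e d); split; first by rewrite lt_min e0 d0.
  move=> y; rewrite /seminorm_ball/= q_cat lt_min => /andP[h1 h2]; split.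
    by apply: sA; apply: le_lt_trans h1; rewrite lerDl.
  by apply: tB; apply: le_lt_trans h2; rewrite lerDr.
- by move=> A B AB [s [e [e0 sA]]]; exists s, e; split=> //; exact: subset_trans AB.
Qed.

Let nbhs_self (x : E) (A : set E) : nbhs x A -> A x.
Proof.
move=> [s [e [e0]]]; apply.
by rewrite /seminorm_ball/= subrr (seminorm0 (sn_q s)).
Qed.

Let nbhs_nbhs_sub (x : E) (A : set E) : nbhs x A -> nbhs x (nbhs^~ A).
Proof.
move=> [s [e [e0 sA]]]; exists s, e; split=> // y /ball_nbhs.
by move=> [t [d [d0 td]]]; exists t, d; split=> //; exact: subset_trans sA.
Qed.

HB.instance Definition _ :=
  Nbhs_isNbhsTopological.Build E nbhs_pf nbhs_self nbhs_nbhs_sub.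

Let addC : continuous (fun x : E * E => x.1 + x.2).
Proof.
move=> [x y] U /= [s [e [e0 sU]]].
exists (seminorm_ball x s (e / 2), seminorm_ball y s (e / 2)).
  by split; apply: nbhs_ball; rewrite divr_gt0.
move=> [a b] [/= ax yb]; apply: sU; rewrite /seminorm_ball/=.
rewrite opprD addrACA (le_lt_trans ((sn_q s).1 _ _))//.
by rewrite [ltRHS]splitr ltrD.
Qed.

Let scaleC : continuous (fun z : R^o * E => z.1 *: z.2).
Proof.
move=> [k x] U /= [s [e [e0 sU]]].
have q0 := q_ge0 s x.
pose M := q s x + 1; have M0 : 0 < M by rewrite ltr_pwDr.
pose N := `|k| + 1; have N0 : 0 < N by rewrite ltr_pwDr.
pose d := Num.min 1 (e / 2 / M); have d0 : 0 < d.
  by rewrite lt_min ltr01/= !divr_gt0.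
exists (ball (k : R^o) d, seminorm_ball x s (e / 2 / N)).
  by split; [exact: nbhsx_ballx|apply: nbhs_ball; rewrite !divr_gt0].
move=> [l y] [/= kl xy]; apply: sU; rewrite /seminorm_ball/=.
have -> : l *: y - k *: x = l *: (y - x) + (l - k) *: x.
  by rewrite scalerBr scalerBl addrA subrK.
rewrite (le_lt_trans ((sn_q s).1 _ _))// !(sn_q s).2 [ltRHS]splitr.
have lkd : `|l - k| < d by rewrite distrC; exact: kl.
have lN : `|l| <= N.
  rewrite -(subrK k l) (le_trans (ler_normD _ _))// addrC lerD2l.
  by apply/ltW/(lt_le_trans lkd); rewrite ge_min lexx.
rewrite ltr_leD//.
  rewrite (le_lt_trans (ler_wpM2r (q_ge0 _ _) lN))//.
  by rewrite mulrC -ltr_pdivlMr.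
apply: (@le_trans _ _ (e / 2 / M * M)); last by rewrite divfK// gt_eqF.
rewrite ler_pM//; last by rewrite lerDl.
by apply/ltW/(lt_le_trans lkd); rewrite ge_min lexx orbT.
Qed.

Let convex_basis : exists2 B : set_system E,
  (forall b, b \in B -> convex_set b) & basis B.
Proof.
exists [set U | exists x s e, U = seminorm_ball x s e].
  move=> _ /[!inE]/= -[x [s [e ->]]]; apply/convex_setW => y z.
  rewrite !inE/= /seminorm_ball/= => yx zx l l0 l1; rewrite inE/=.
  have l1' : 0 < (1 - l%:num) by rewrite subr_gt0.
  rewrite [X in q s X](_ : _ =
      l%:num *: (y - x) + (1 - l%:num) *: (z - x)); last first.
    rewrite !scalerBr addrACA -opprD -scalerDl.
    by rewrite (addrC l%:num) subrK scale1r.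
  rewrite (le_lt_trans ((sn_q s).1 _ _))// !(sn_q s).2 !gtr0_norm//.
  rewrite [ltRHS](_ : e = l%:num * e + (1 - l%:num) * e).
    by rewrite ltrD// ltr_pM2l.
  by rewrite mulrBl mul1r addrC subrK.
split; first by move=> _ [x [s [e ->]]]; rewrite openE => y; exact: ball_nbhs.
move=> x U [s [e [e0 sU]]]; exists (seminorm_ball x s e) => //; split.
  by exists x, s, e.
by apply: nbhs_self; exact: nbhs_ball.
Qed.

HB.instance Definition _ :=
  PreTopologicalLmod_isTvs.Build R E addC scaleC convex_basis.
HB.instance Definition _ :=
  PreTopologicalNmodule_isTopologicalNmodule.Build E addC.
HB.instance Definition _ :=
  TopologicalNmodule_isTopologicalLmodule.Build R E scaleC.
HB.instance Definition _ := Uniform_isTvs.Build R E convex_basis.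

HB.end.

Record continuous_seminorm (R : realType) (V : tvsType R) := ContinuousSeminorm {
  csn_fun :> V -> R;
  csn_seminorm : is_seminorm csn_fun;
  csn_continuous : continuous csn_fun
}.

(** Families [f : I -> V] such that, for all [j] and all continuous seminorms
    [p] of [V], the sum of the [w j i * p (f i)] is finite.  These sums are the
    seminorms that define the topology. *)

Section Rapid.
Context (R : realType) (V : tvsType R) (I : choiceType) (J : Type).
Variable w : J -> I -> nat.

Definition weighted_sum (jp : J * continuous_seminorm V) (f : I -> V) : \bar R :=
  \esum_(i in [set: I]) ((w jp.1 i)%:R * jp.2 (f i))%:E.

Definition rapidly_decreasing : {pred I -> V} :=
  fun f => `[< forall jp, (weighted_sum jp f < +oo)%E >].

Lemma weighted_term_ge0 (jp : J * continuous_seminorm V) (f : I -> V) i :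
  (0 <= ((w jp.1 i)%:R * jp.2 (f i))%:E)%E.
Proof.
by rewrite lee_fin mulr_ge0//; exact/seminorm_ge0/(csn_seminorm jp.2).
Qed.

Lemma weighted_sum_ge0 jp f : (0 <= weighted_sum jp f)%E.
Proof. by apply: esum_ge0 => i _; exact: weighted_term_ge0. Qed.

Lemma weighted_sumD jp f g :
  (weighted_sum jp (f + g)%R <= weighted_sum jp f + weighted_sum jp g)%E.
Proof.
rewrite /weighted_sum -esumD; try by move=> i _; exact: weighted_term_ge0.
apply: le_esum => i _; rewrite -EFinD lee_fin -mulrDr ler_wpM2l//.
exact: (csn_seminorm jp.2).1.
Qed.

Lemma weighted_sumZ jp (c : R) f :
  weighted_sum jp (c *: f) = (`|c|%:E * weighted_sum jp f)%E.
Proof.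
have leZ d h : (weighted_sum jp (d *: h) <= `|d|%:E * weighted_sum jp h)%E.
  apply: ge_ereal_sup => _ [A [finA _] <-].
  rewrite (eq_fsbigr (fun i => `|d|%:E * ((w jp.1 i)%:R * jp.2 (h i))%:E)%E).
    rewrite -ge0_mule_fsumr; last by move=> i; exact: weighted_term_ge0.
    rewrite lee_wpmul2l ?lee_fin//; apply: ereal_sup_ubound; exists A => //.
  by move=> i _; rewrite (csn_seminorm jp.2).2 -EFinM mulrCA.
apply/eqP; rewrite eq_le leZ/=; have [->|c0] := eqVneq c 0.
  by rewrite normr0 mul0e weighted_sum_ge0.
have := leZ c^-1 (c *: f); rewrite scalerA mulVf// scale1r => /(lee_wpmul2l _).
by move=> /(_ `|c|%:E); rewrite lee_fin muleA -EFinM -normrM divff// normr1 mul1e; apply.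
Qed.

Lemma rapidly_decreasing_submod_closed : submod_closed rapidly_decreasing.
Proof.
split.
  by apply/asboolP => jp; rewrite -(scale0r (0 : I -> V)) weighted_sumZ normr0 mul0e.
move=> c f g /asboolP fr /asboolP gr; apply/asboolP => jp.
apply: (le_lt_trans (weighted_sumD _ _ _)); rewrite lte_add_pinfty// weighted_sumZ.
by rewrite lte_mul_pinfty.
Qed.

HB.instance Definition _ :=
  GRing.isSubmodClosed.Build R (I -> V) rapidly_decreasing
    rapidly_decreasing_submod_closed.

Record rapid := Rapid {
  rapid_fun :> I -> V;
  rapid_funP : rapid_fun \in rapidly_decreasing
}.

HB.instance Definition _ := [isSub for rapid_fun].
HB.instance Definition _ := [Choice of rapid by <:].
HB.instance Definition _ := [SubChoice_isSubLmodule of rapid by <:].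

Definition rapid_norm (jp : J * continuous_seminorm V) (f : rapid) : R :=
  fine (weighted_sum jp f).

Lemma rapid_norm_seminorm jp : is_seminorm (rapid_norm jp).
Proof.
have fin (f : rapid) : weighted_sum jp f \is a fin_num.
  by rewrite ge0_fin_numE ?weighted_sum_ge0//; move/asboolP: (rapid_funP f).
split=> [f g|c f]; rewrite /rapid_norm.
  by rewrite -fineD// fine_le// ?fin_numD ?fin// weighted_sumD.
by rewrite weighted_sumZ fineM.
Qed.

HB.instance Definition _ :=
  Lmodule_hasSeminorms.Build R rapid rapid_norm_seminorm.

Lemma rapid_nbhsE (f : rapid) (U : set rapid) :
  nbhs f U <-> exists s e, 0 < e /\
    [set g | \sum_(jp <- s) rapid_norm jp (g - f) < e] `<=` U.
Proof. by []. Qed.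

End Rapid.

(** Scalars are real: a complex algebra is one by restriction of scalars, and
    this changes none of the spaces below, since every continuous real seminorm
    is dominated by a continuous complex one. *)

Record tvsAlgebra (R : realType) := TvsAlgebra {
  tva_space :> tvsType R;
  tva_mul : tva_space -> tva_space -> tva_space
}.

(** Cauchy sequences are those of the additive group: [tvsType] does not
    relate its uniform structure to the linear one. *)
Definition sequentially_complete (R : realType) (V : tvsType R) : Prop :=
  forall u : nat -> V,
    (forall U, nbhs (0 : V) U ->
      exists N, forall m n, (N <= m)%N -> (N <= n)%N -> U (u m - u n)) ->
    exists l : V, u @ \oo --> l.

Record is_lcalgebra (R : realType) (A : tvsAlgebra R) : Prop := {
  lca_hausdorff : hausdorff_space A;
  lca_complete : sequentially_complete A;
  lca_mulA : associative (@tva_mul R A);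
  lca_mulDl : forall x y z : A, tva_mul (x + y) z = tva_mul x z + tva_mul y z;
  lca_mulDr : forall x y z : A, tva_mul x (y + z) = tva_mul x y + tva_mul x z;
  lca_mulZl : forall c (x y : A), tva_mul (c *: x) y = c *: tva_mul x y;
  lca_mulZr : forall c (x y : A), tva_mul x (c *: y) = c *: tva_mul x y;
  lca_mul_continuous : continuous (fun xy : A * A => tva_mul xy.1 xy.2)
}.

(** Limit of the net of finite partial sums (0 if it diverges) *)
Definition tsum (R : realType) (V : tvsType R) (I : choiceType) (f : I -> V) : V :=
  xget 0 [set l | summability.partial_sum f @ summability.totally --> l].

Definition matrix_mul (R : realType) (A : tvsAlgebra R) (T : choiceType)
    (s t : T * T -> A) : T * T -> A :=
  fun nm => tsum (fun k => tva_mul (s (nm.1, k)) (t (k, nm.2))).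

(** Rapidly decreasing matrices.  The index set [T] comes with the absolute
    value [a].  In a locally convex algebra the product of two such matrices is
    again one, so the default value of [xget] is not used. *)

Definition rapid_matrix (R : realType) (T : choiceType) (a : T -> nat)
    (V : tvsType R) : tvsType R :=
  rapid V (fun (kl : nat * nat) (nm : T * T) =>
    (1 + a nm.1) ^ kl.1 * (1 + a nm.2) ^ kl.2)%N.

Definition rapid_matrix_algebra (R : realType) (T : choiceType) (a : T -> nat)
    (S : tvsAlgebra R) : tvsAlgebra R :=
  @TvsAlgebra R (rapid_matrix a S) (fun x y =>
    xget 0 [set z : rapid_matrix a S | z = matrix_mul x y :> (T * T -> S)]).

(** Laurent series, given by their families of coefficients *)

Definition laurent (R : realType) (A : tvsType R) : tvsType R :=
  rapid A (fun (k : nat) (n : int) => (1 + absz n) ^ k)%N.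

Definition toeplitz_matrix (R : realType) (A : tvsType R) (a : int -> A) :
    nat * nat -> A :=
  fun nm => a (nm.1%:Z - nm.2%:Z).

(** The pair [(a, p)] stands for the matrix [W(a) + p], so that the symbol map
    is the first projection.  The matrix determines the pair when [A] is a
    locally convex algebra, and then the product of two matrices of this form
    has this form again. *)

Definition toeplitz (R : realType) (A : tvsType R) : tvsType R :=
  (laurent A * rapid_matrix (id : nat -> nat) A)%type.

Definition matrix_of_toeplitz (R : realType) (A : tvsType R) (x : toeplitz A) :
    nat * nat -> A :=
  toeplitz_matrix x.1 + x.2.

Definition toeplitz_algebra (R : realType) (A : tvsAlgebra R) : tvsAlgebra R :=
  @TvsAlgebra R (toeplitz A) (fun x y =>
    xget 0 [set z : toeplitz A |
      matrix_of_toeplitz z =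
        matrix_mul (matrix_of_toeplitz x) (matrix_of_toeplitz y)]).

Definition laurent_at1 (R : realType) (A : tvsType R) (a : laurent A) : A :=
  tsum a.

Definition pointed_toeplitz (R : realType) (A : tvsAlgebra R) :
    set (toeplitz_algebra A) :=
  [set x | laurent_at1 x.1 = 0].
Arguments pointed_toeplitz {R} A _.

(** [(1 + b) (1 + c) = 1 + circ b c] *)
Definition circ (R : realType) (B : tvsAlgebra R) (b c : B) : B :=
  b + c + tva_mul b c.

(** The unit group of the subalgebra [D] of [B].  Its point [1 + b] is given by
    the pair [(b, c)] such that [1 + c] is the inverse of [1 + b], which makes
    the required topology that of a subspace of [B * B]. *)
Definition unit_group (R : realType) (B : tvsAlgebra R) (D : set B) :
    topologicalType :=
  [set bc : B * B |
    [/\ D bc.1, D bc.2, circ bc.1 bc.2 = 0 & circ bc.2 bc.1 = 0]].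

Definition contractible (R : realType) (X : topologicalType) : Prop :=
  exists (x0 : X) (H : R * X -> X),
    [/\ {within `[0, 1] `*` [set: X], continuous H},
        forall x, H (0, x) = x & forall x, H (1, x) = x0].

(* Main.v *)
(* In the basis v^n v*^m of the bicyclic monoid the Toeplitz algebra T(K_Z(S)) consists of
   the rapidly decreasing combinations of v^n v*^m (x) E_ij, and an element is pointed iff
   it dies under v |-> 1. Because K_Z(S) is stable, two homotopies suffice.
   (1) The identity is homotopic to the endomorphism E_ij |-> E_{2i,2j}: rotate e_i into
   e_{2i}, for large |i| first; rapid decrease gives continuity at the start.
   (2) Let psi(v) act on levels 0, 1, 2, ... as the identity on level 0 and as the shift on
   the others, and let V_t be the isometry whose column from level 0 is ((c^2 + s^2 v), c
   s (1 - v)) with c^2 + s^2 = 1, and which shifts levels >= 1. Then v |-> V_t defines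
   homomorphisms Phi_t with Phi_0 = psi and Phi_t - psi valued in rapidly decreasing
   matrices over pointed elements: the powers of c^2 + s^2 v have coefficients of sum 1,
   so no norm grows faster than a polynomial. For a pointed unit g, Phi_t(g) psi(g)^-1 is
   a path of pointed units from 1 to the corner embedding of g, which is E_ij |->
   E_{2i,2j} for a suitable embedding of N x Z in Z. *)

From HB Require Import structures.
From mathcomp Require Import all_boot all_order all_algebra finmap.
From mathcomp Require Import all_classical all_reals all_analysis.
From mathcomp Require Import zify lra ring.
From mathcomp.analysis.showcase Require summability.
Require Import Defs.

Set Implicit Arguments.
Unset Strict Implicit.
Unset Printing Implicit Defensive.

Import Order.TTheory GRing.Theory Num.Theory.
Import numFieldNormedType.Exports.

Local Open Scope classical_set_scope.
Local Open Scope ring_scope.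

(** * Continuous seminorms *)

(** The column of V_t has a source. Let U_t be the diagonal matrix with entries 1 and v on levels 0
    and 1, conjugated by the reflection with rows (c, s) and (s, -c), and the identity on higher
    levels; then V_t = U_t v0 with v0 = psi(v). Conjugation keeps U_t an isometry, and v |-> 1 turns
    U_t into the identity, so pointedness survives along the whole path. The obstacle is that psi(g)
    is an infinite matrix that is not rapidly decreasing. Hence [levels] adjoins formal symbols for
    the values of psi, next to the ideal of rapidly decreasing matrices, and only Phi_t(g)
    psi(g)^-1, which is trivial modulo that ideal, is brought back to one algebra. This requires the
    inverse of g, so paths are written on pairs (x, z) for which 1 + x and 1 + z are mutually
    inverse. Pointedness also decides the end of (2): on level 0, psi(g) acts through the value of g
    at v = 1, which is then 1, so the corner contains g itself. Every map is the continuous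
    extension of its values on basis elements, where all identities are checked; joint continuity in
    angle and element rests on bounds uniform in the angle. *)

Notation csn := continuous_seminorm.

Section Csn.
Context (R : realType) (V : tvsType R).
Implicit Types (P : csn V) (x y : V).

Lemma csn_ge0 P x : 0 <= P x. Proof. exact/seminorm_ge0/csn_seminorm. Qed.
Lemma csn0 P : P 0 = 0. Proof. exact/seminorm0/csn_seminorm. Qed.
Lemma csnN P x : P (- x) = P x. Proof. exact/seminormN/csn_seminorm. Qed.
Lemma csnD P x y : P (x + y) <= P x + P y. Proof. exact: (csn_seminorm P).1. Qed.
Lemma csnZ P c x : P (c *: x) = `|c| * P x. Proof. exact: (csn_seminorm P).2. Qed.
Lemma csnC P x y : P (x - y) = P (y - x). Proof. by rewrite -csnN opprB. Qed.
Lemma csn_tri P x y z : P (x - z) <= P (x - y) + P (y - z).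
Proof. by rewrite -[x - z](subrKA y) csnD. Qed.

Lemma csn_sum P I (s : seq I) (f : I -> V) :
  P (\sum_(i <- s) f i) <= \sum_(i <- s) P (f i).
Proof.
elim/big_ind2: _ => //; first by rewrite csn0.
by move=> ? ? ? ? h1 h2; rewrite (le_trans (csnD _ _ _))// lerD.
Qed.

Lemma seminorm_continuous (p : V -> R) : is_seminorm p ->
  (forall e, 0 < e -> nbhs (0 : V) [set x | p x < e]) -> continuous p.
Proof.
move=> sp p0 x; apply/cvgrPdist_lt => e e0.
have := @nbhsT_subproof R V _ (@add_continuous V) x (p0 e e0).
apply: filterS => _ [z /= ze <-].
rewrite ltr_norml; have h1 := sp.1 x z; have h2 := sp.1 (x + z) (- z).
rewrite addrK seminormN// in h2; lra.
Qed.

Lemma csn_nbhs0 P e : 0 < e -> nbhs (0 : V) [set x | P x < e].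
Proof.
move=> e0; have := @csn_continuous _ _ P 0; rewrite /continuous_at csn0.
move=> /cvgrPdist_lt /(_ e e0); apply: filterS => x /=.
by rewrite sub0r normrN ger0_norm ?csn_ge0.
Qed.

Lemma csn_nbhs P x e : 0 < e -> nbhs x [set y | P (y - x) < e].
Proof.
move=> e0; have := @nbhsT_subproof R V _ (@add_continuous V) x (csn_nbhs0 P e0).
by apply: filterS => _ [z /= ze <-]; rewrite addrC addKr.
Qed.

Lemma csn_addP (P Q : csn V) : exists P' : csn V, forall x, P' x = P x + Q x.
Proof.
have h : is_seminorm (fun x => P x + Q x).
  split=> [x y|c x]; last by rewrite !csnZ mulrDr.
  by rewrite addrACA lerD// csnD.
suff c : continuous (fun x => P x + Q x) by exists (ContinuousSeminorm h c).
by move=> x; apply: cvgD; exact: csn_continuous.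
Qed.

Lemma csn_scaleP (c : R) (P : csn V) : 0 <= c ->
  exists P' : csn V, forall x, P' x = c * P x.
Proof.
move=> c0; have h : is_seminorm (fun x => c * P x).
  split=> [x y|d x]; last by rewrite csnZ mulrCA.
  by rewrite -mulrDr ler_wpM2l// csnD.
suff k : continuous (fun x => c * P x) by exists (ContinuousSeminorm h k).
by move=> x; apply: cvgMl_tmp; exact: csn_continuous.
Qed.

Lemma csn0P : exists P : csn V, forall x, P x = 0.
Proof.
have h : is_seminorm (fun _ : V => 0 : R).
  by split=> [x y|d x]; rewrite ?addr0 ?mulr0.
suff k : continuous (fun _ : V => 0 : R) by exists (ContinuousSeminorm h k).
by move=> x; exact: cvg_cst.
Qed.

Lemma scale_nbhs0 (c : R) (U : set V) : c != 0 -> nbhs (0 : V) U ->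
  nbhs (0 : V) [set x | U (c *: x)].
Proof.
move=> c0 U0; have := @scale_continuous R V (c, 0); rewrite /continuous_at/= scaler0.
move=> /(_ U U0)[[A B] /= [Ac B0] h]; apply: filterS B0 => x Bx /=.
by apply: (h (c, x)); split=> //=; exact: (nbhs_singleton Ac).
Qed.

Lemma absorbing (U : set V) x : nbhs (0 : V) U ->
  exists2 r, 0 < r & forall t, `|t| <= r -> U (t *: x).
Proof.
move=> U0; have := @scale_continuous R V (0, x); rewrite /continuous_at/= scale0r.
move=> /(_ U U0)[[A B] /= [/nbhs_ballP[r r0 rA] Bx] h].
have r0' : 0 < (r : R) by [].
exists (r / 2); first by rewrite divr_gt0.
move=> t tr; apply: (h (t, x)); split; last exact: (nbhs_singleton Bx).
apply: rA; rewrite /ball /= sub0r normrN (le_lt_trans tr)//.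
by rewrite ltr_pdivrMr// mulr2n mulrDr mulr1 ltrDl.
Qed.

Lemma convex_setP (b : set V) : convex_set b ->
  forall x y (t : R), 0 <= t -> t <= 1 -> b x -> b y ->
    b (t *: x + (1 - t) *: y).
Proof.
move=> cb x y t t0 t1 bx byy.
have [->|tn0] := eqVneq t 0; first by rewrite scale0r add0r subr0 scale1r.
have [->|tn1] := eqVneq t 1; first by rewrite subrr scale0r addr0 scale1r.
have t0' : 0 < t by rewrite lt_neqAle eq_sym tn0.
have t01 : Itv.spec (@Itv.num_sem R) (Itv.Real `[0%Z, 1%Z]) t.
  by rewrite /= /Itv.num_sem/= ger0_real//= in_itv/= t0 t1.
have := cb x y (Itv.mk t01) (mem_set bx) (mem_set byy).
by move=> /set_mem.
Qed.

(* Minkowski gauge of a symmetric convex neighbourhood. *)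
Lemma csn_basis0 (U : set V) : nbhs (0 : V) U ->
  exists P : csn V, forall x, P x < 1 -> U x.
Proof.
have [B cB [Bo Bb]] := @locally_convex R V.
move=> /(Bb 0)[b [Bb' b0] bU].
have bN : nbhs (0 : V) b by apply: open_nbhs_nbhs; split=> //; exact: Bo.
have {}cB := convex_setP (cB _ (mem_set Bb')).
pose W : set V := b `&` [set x | b (- x)].
have WN : nbhs (0 : V) W.
  apply: filterI => //; have := @opp_continuous V 0; rewrite /continuous_at oppr0.
  by move=> /(_ _ bN).
have W0 : W 0 by exact: nbhs_singleton.
have cW x y (t : R) : 0 <= t -> t <= 1 -> W x -> W y -> W (t *: x + (1 - t) *: y).
  move=> t0 t1 [bx bx'] [b1 b1']; split; first exact: cB.
  by rewrite /= opprD -!scalerN; exact: cB.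
have WNx x : W x -> W (- x) by move=> [? ?]; split=> //=; rewrite opprK.
have Ws x (t : R) : `|t| <= 1 -> W x -> W (t *: x).
  wlog t0 : x t / 0 <= t.
    move=> h; have [t0|t0] := leP 0 t; first exact: h.
    move=> t1 Wx; rewrite -[t]opprK scaleNr -scalerN; apply: h; last exact: WNx.
      by rewrite oppr_ge0 ltW.
    by rewrite normrN.
  rewrite ger0_norm// => t1 Wx; have := cW x 0 t t0 t1 Wx W0.
  by rewrite scaler0 addr0.
pose A x : set R := [set r | 0 < r /\ W (r^-1 *: x)].
have A0 x : A x !=set0.
  have [r r0 h] := absorbing x WN; exists r^-1; split; first by rewrite invr_gt0.
  by rewrite invrK; apply: h; rewrite ger0_norm// ltW.
have Alb x : lbound (A x) 0 by move=> r [/ltW].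
have Ainf x : has_inf (A x) by split; [exact: A0|exists 0; exact: Alb].
pose p x := inf (A x).
have p0 x : 0 <= p x by apply: lb_le_inf.
have pA x r : p x < r -> A x r.
  move=> /(inf_lt (A0 x))[s [s0 sW] sr]; have r0 : 0 < r by exact: lt_trans sr.
  split=> //; rewrite -[_ *: _](_ : (r^-1 * s) *: (s^-1 *: x) = _).
    apply: Ws => //; rewrite ger0_norm ?mulr_ge0 ?invr_ge0 ?(ltW s0) ?(ltW r0)//.
    by rewrite mulrC ler_pdivrMr// mul1r ltW.
  by rewrite scalerA mulfK ?gt_eqF.
have Ap x r : A x r -> p x <= r by move=> Ar; apply: ge_inf => //; exists 0; exact: Alb.
have pZle c x : c != 0 -> p (c *: x) <= `|c| * p x.
  move=> c0; have c0' : 0 < `|c| by rewrite normr_gt0.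
  rewrite -ler_pdivrMl// ; apply: lb_le_inf => // r [r0 rW].
  rewrite ler_pdivrMl//; apply: Ap; split; first by rewrite mulr_gt0.
  rewrite scalerA invfM mulrAC -scalerA.
  apply: Ws => //; rewrite normrM normrV ?unitfE ?normr_eq0// normr_id.
  by rewrite mulVf ?normr_eq0.
have sp : is_seminorm p.
  split=> [x y|c x].
    apply/ler_addgt0Pr => e e0.
    have [|s0 sW] := @pA x (p x + e / 2); first by rewrite ltrDl divr_gt0.
    have [|t0 tW] := @pA y (p y + e / 2); first by rewrite ltrDl divr_gt0.
    set s := p x + e / 2 in s0 sW; set t := p y + e / 2 in t0 tW.
    rewrite -[leRHS](_ : s + t = _); last by rewrite /s /t; lra.
    have st0 : 0 < s + t by rewrite addr_gt0.
    apply: Ap; split=> //.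
    rewrite -[_ *: _](_ : (s / (s + t)) *: (s^-1 *: x) +
      (1 - s / (s + t)) *: (t^-1 *: y) = _).
      apply: cW => //; first by rewrite divr_ge0 ?ltW.
      by rewrite ler_pdivrMr// mul1r lerDl ltW.
    rewrite !scalerA mulrAC divff ?gt_eqF// mul1r scalerDr; congr (_ + _ *: _).
    by rewrite -[X in X - _](divff (lt0r_neq0 st0)) -mulrBl addrC addKr mulrAC divff ?gt_eqF ?mul1r.
  have [->|c0] := eqVneq c 0.
    rewrite scale0r normr0 mul0r; apply/eqP; rewrite eq_le p0 andbT.
    apply/ler_addgt0Pr => e e0; rewrite add0r; apply: Ap; split=> //.
    by rewrite scaler0.
  apply/eqP; rewrite eq_le pZle//=.
  have := pZle c^-1 (c *: x); rewrite invr_eq0 => /(_ c0).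
  rewrite scalerA mulVf// scale1r normrV ?unitfE// ler_pdivlMl ?normr_gt0//.
have pc : continuous p.
  apply: seminorm_continuous => // e e0.
  have e20 : (e / 2)^-1 != 0 by rewrite invr_eq0 gt_eqF// divr_gt0.
  apply: filterS (scale_nbhs0 e20 WN) => x /= Wx.
  apply: (@le_lt_trans _ _ (e / 2)); last by lra.
  by apply: Ap; split=> //; rewrite divr_gt0.
exists (ContinuousSeminorm sp pc) => x /= /pA[_]; rewrite invr1 scale1r => -[bx _].
exact: bU.
Qed.

Lemma csn_basis x (U : set V) : nbhs x U ->
  exists P : csn V, forall y, P (y - x) < 1 -> U y.
Proof.
move=> Ux; have h : nbhs (0 : V) [set z | U (x + z)].
  have := @add_continuous V (x, 0); rewrite /continuous_at/= addr0 => /(_ U Ux).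
  move=> [[A B] /= [Ax B0] h]; apply: filterS B0 => z Bz.
  by apply: (h (x, z)); split=> //=; exact: (nbhs_singleton Ax).
have [P PU] := csn_basis0 h; exists P => y /PU /=.
by rewrite addrC subrK.
Qed.

Lemma csn_cvgP (T : Type) (F : set_system T) {FF : Filter F} (f : T -> V) l :
  (f @ F --> l) <-> forall (P : csn V) (e : R), 0 < e -> \forall t \near F, P (f t - l) < e.
Proof.
split=> [fl P e e0|h U /csn_basis[P PU]].
  by have := fl _ (csn_nbhs P l e0).
by apply: filterS (h P 1 ltr01) => t /PU.
Qed.

Lemma csn_continuousP (X : topologicalType) (f : X -> V) :
  continuous f <-> forall t (P : csn V) (e : R), 0 < e -> \forall u \near t, P (f u - f t) < e.
Proof. by split=> h t; apply/csn_cvgP; exact: h. Qed.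

Lemma csn_hausdorff : (forall x, (forall P : csn V, P x = 0) -> x = 0) ->
  hausdorff_space V.
Proof.
move=> h x y xy; apply/eqP; rewrite -subr_eq0; apply/eqP/h => P.
apply/eqP; rewrite eq_le csn_ge0 andbT; apply/ler_addgt0Pr => e e0; rewrite add0r.
have e2 : 0 < e / 2 by rewrite divr_gt0.
have [z [/= zx zy]] := xy _ _ (csn_nbhs P x e2) (csn_nbhs P y e2).
have := csn_tri P x z y; rewrite csnC in zx; lra.
Qed.

Lemma hausdorff_csn x : hausdorff_space V -> (forall P : csn V, P x = 0) -> x = 0.
Proof.
move=> hV h; apply: hV => A B /csn_basis[P PA] /nbhs_singleton B0.
by exists 0; split=> //; apply: PA; rewrite sub0r csnN h.
Qed.

End Csn.

(** * Continuous linear and bilinear maps *)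

Definition lincont (R : realType) (V W : tvsType R) (f : V -> W) : Prop :=
  [/\ forall x y, f (x + y) = f x + f y, forall c x, f (c *: x) = c *: f x &
      continuous f].

Section Lincont.
Context (R : realType).
Implicit Types (U V W : tvsType R).

Section Basic.
Context V W (f : V -> W) (hf : lincont f).
Lemma lincontD x y : f (x + y) = f x + f y. Proof. by case: hf. Qed.
Lemma lincontZ c x : f (c *: x) = c *: f x. Proof. by case: hf. Qed.
Lemma lincont0 : f 0 = 0. Proof. by rewrite -(scale0r 0) lincontZ scale0r. Qed.
Lemma lincontN x : f (- x) = - f x. Proof. by rewrite -scaleN1r lincontZ scaleN1r. Qed.
Lemma lincontB x y : f (x - y) = f x - f y. Proof. by rewrite lincontD lincontN. Qed.
Lemma lincont_continuous : continuous f. Proof. by case: hf. Qed.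
Lemma lincont_sum I (s : seq I) (g : I -> V) :
  f (\sum_(i <- s) g i) = \sum_(i <- s) f (g i).
Proof. exact: (big_morph f lincontD lincont0). Qed.

Lemma lincont_csn (P : csn W) : exists Q : csn V, forall x, Q x = P (f x).
Proof.
have h : is_seminorm (fun x => P (f x)).
  by split=> [x y|c x]; rewrite ?lincontD ?csnD// lincontZ csnZ.
suff k : continuous (fun x => P (f x)) by exists (ContinuousSeminorm h k).
by move=> x; apply: continuous_comp; [exact: lincont_continuous|exact: csn_continuous].
Qed.
End Basic.

Lemma lincontI V W (f : V -> W) :
  (forall x y, f (x + y) = f x + f y) -> (forall c x, f (c *: x) = c *: f x) ->
  (forall P : csn W, exists Q : csn V, forall x, P (f x) <= Q x) -> lincont f.
Proof.
move=> fD fZ h; split=> //; apply/csn_continuousP => x P e e0.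
have [Q PQ] := h P; apply: filterS (csn_nbhs Q x e0) => y /=.
by apply: le_lt_trans; rewrite -scaleN1r -fZ -fD scaleN1r PQ.
Qed.

Lemma lincont_id V : lincont (@id V).
Proof. by split=> // x; exact: cvg_id. Qed.

Lemma lincont_zero V W : lincont (fun _ : V => 0 : W).
Proof. by split=> [x y|c x|x]; rewrite ?addr0 ?scaler0//; exact: cvg_cst. Qed.

Lemma lincont_comp U V W (f : V -> W) (g : U -> V) :
  lincont f -> lincont g -> lincont (fun x => f (g x)).
Proof.
move=> hf hg; split=> [x y|c x|x]; first by rewrite (lincontD hg) (lincontD hf).
  by rewrite (lincontZ hg) (lincontZ hf).
by apply: continuous_comp; exact: lincont_continuous.
Qed.

Lemma continuousD_tvs (X : topologicalType) V (f g : X -> V) :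
  continuous f -> continuous g -> continuous (fun x => f x + g x).
Proof.
move=> cf cg x.
apply: (@continuous_comp _ _ _ (fun x => (f x, g x)) (fun xy : V * V => xy.1 + xy.2)).
  by apply: cvg_pair => /=; [exact: cf|exact: cg].
exact: add_continuous.
Qed.

Lemma continuousN_tvs (X : topologicalType) V (f : X -> V) :
  continuous f -> continuous (fun x => - f x).
Proof.
by move=> cf x; apply: (@continuous_comp _ _ _ f -%R); [exact: cf|exact: opp_continuous].
Qed.

Lemma continuousZ_tvs (X : topologicalType) V (f : X -> R) (g : X -> V) :
  continuous f -> continuous g -> continuous (fun x => f x *: g x).
Proof.
move=> cf cg x.
apply: (@continuous_comp _ _ _ (fun x => (f x : R^o, g x)) (fun xy : R^o * V => xy.1 *: xy.2)).
  by apply: (@cvg_pair _ _ _ _ (nbhs (f x : R^o)) (nbhs (g x))) => /=; [exact: cf|exact: cg].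
exact: scale_continuous.
Qed.

Lemma continuous_sum_tvs (X : topologicalType) V I (s : seq I) (f : I -> X -> V) :
  (forall i, continuous (f i)) -> continuous (fun x => \sum_(i <- s) f i x).
Proof.
move=> cf; elim: s => [|i s IH].
  under [fun _ => _]eq_fun do rewrite big_nil.
  by move=> x; exact: cvg_cst.
under [fun _ => _]eq_fun do rewrite big_cons.
exact: continuousD_tvs.
Qed.

Lemma lincont_add V W (f g : V -> W) : lincont f -> lincont g ->
  lincont (fun x => f x + g x).
Proof.
move=> hf hg; split=> [x y|c x|]; first by rewrite (lincontD hf) (lincontD hg) addrACA.
  by rewrite (lincontZ hf) (lincontZ hg) scalerDr.
by apply: continuousD_tvs; exact: lincont_continuous.
Qed.

Lemma lincont_opp V W (f : V -> W) : lincont f -> lincont (fun x => - f x).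
Proof.
move=> hf; split=> [x y|c x|]; first by rewrite (lincontD hf) opprD.
  by rewrite (lincontZ hf) scalerN.
by apply: continuousN_tvs; exact: lincont_continuous.
Qed.

Lemma lincont_scale V W (f : V -> W) a : lincont f -> lincont (fun x => a *: f x).
Proof.
move=> hf; split=> [x y|c x|]; first by rewrite (lincontD hf) scalerDr.
  by rewrite (lincontZ hf) !scalerA mulrC.
by apply: continuousZ_tvs; [move=> x; exact: cvg_cst|exact: lincont_continuous].
Qed.

(** Continuity is stated through products of seminorms because that form can be summed over basis
    elements; for the multiplication of a locally convex algebra it is derived in
    [lcalgebra_bilincont]. *)
Record bilincont V W U (f : V -> W -> U) : Prop := Bilincont {
  bilincontDl : forall x x' y, f (x + x') y = f x y + f x' y;
  bilincontDr : forall x y y', f x (y + y') = f x y + f x y';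
  bilincontZl : forall c x y, f (c *: x) y = c *: f x y;
  bilincontZr : forall c x y, f x (c *: y) = c *: f x y;
  bilincont_bound : forall P : csn U, exists (Q : csn V) (Q' : csn W),
    forall x y, P (f x y) <= Q x * Q' y }.

Section Bilincont.
Context V W U (f : V -> W -> U) (hf : bilincont f).

Lemma bilincont_l y : lincont (fun x => f x y).
Proof.
apply: lincontI => [x x'|c x|P]; [exact: bilincontDl|exact: bilincontZl|].
have [Q [Q' h]] := bilincont_bound hf P.
have [Q1 h1] := csn_scaleP Q (csn_ge0 Q' y).
by exists Q1 => x; rewrite h1 mulrC h.
Qed.

Lemma bilincont_r x : lincont (f x).
Proof.
apply: lincontI => [y y'|c y|P]; [exact: bilincontDr|exact: bilincontZr|].
have [Q [Q' h]] := bilincont_bound hf P.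
have [Q1 h1] := csn_scaleP Q' (csn_ge0 Q x).
by exists Q1 => y; rewrite h1 h.
Qed.

Lemma bilincont_continuous (X : topologicalType) (g : X -> V) (h : X -> W) :
  continuous g -> continuous h -> continuous (fun t => f (g t) (h t)).
Proof.
move=> cg ch; apply/csn_continuousP => x P e e0.
have [Q [Q' hb]] := bilincont_bound hf P.
pose M := Q (g x) + Q' (h x) + 1.
have M0 : 0 < M by rewrite ltr_pwDr// addr_ge0// csn_ge0.
pose d := Num.min 1 (e / M / 2).
have d0 : 0 < d by rewrite lt_min ltr01/= !divr_gt0.
have [/csn_continuousP/(_ x Q d d0) ng /csn_continuousP/(_ x Q' d d0) nh] := (cg, ch).
apply: filterS2 ng nh => y yg yh.
have -> : f (g y) (h y) - f (g x) (h x) = f (g y - g x) (h y) + f (g x) (h y - h x).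
  rewrite (lincontB (bilincont_l _)) (lincontB (bilincont_r _)).
  by rewrite addrA subrK.
apply: (le_lt_trans (csnD _ _ _)).
apply: (@le_lt_trans _ _ (Q (g y - g x) * Q' (h y) + Q (g x) * Q' (h y - h x))).
  by rewrite lerD.
have hy : Q' (h y) <= Q' (h x) + 1.
  rewrite -[h y](subrK (h x)) (le_trans (csnD _ _ _))// addrC lerD2l ltW//.
  by apply: (lt_le_trans yh); rewrite ge_min lexx.
have de : d <= e / M / 2 by rewrite ge_min lexx orbT.
apply: (@le_lt_trans _ _ (d * (Q' (h x) + 1) + Q (g x) * d)).
  apply: lerD; first by apply: ler_pM; rewrite ?csn_ge0// ltW.
  by apply: ler_wpM2l; rewrite ?csn_ge0// ltW.
rewrite mulrC -mulrDl addrC addrA -/M.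
apply: (@le_lt_trans _ _ (M * (e / M / 2))); first by rewrite ler_pM2l.
by rewrite mulrA mulrCA divff ?gt_eqF// mulr1 ltr_pdivrMr//; lra.
Qed.
End Bilincont.

End Lincont.

(** * Unconditional sums over countable index sets *)

Section FsetSums.
Context (R : realType) (T : choiceType).
Implicit Types (g : T -> R) (F G : {fset T}).

Lemma big_fsetD_sum (V : zmodType) (f : T -> V) F G : (G `<=` F)%fset ->
  \sum_(i <- F) f i = \sum_(i <- G) f i + \sum_(i <- (F `\` G)%fset) f i.
Proof.
move=> GF; rewrite -big_cat/=; apply: perm_big; apply: uniq_perm.
- exact: fset_uniq.
- rewrite cat_uniq !fset_uniq/= andbT; apply/hasPn => x /=.
  by rewrite inE => /andP[].
- move=> x; rewrite mem_cat inE; have [xG|] := boolP (x \in G) => //=.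
  exact: (fsubsetP GF).
Qed.

Lemma ler_sum_fsub g F G : (forall t, 0 <= g t) -> (G `<=` F)%fset ->
  \sum_(i <- G) g i <= \sum_(i <- F) g i.
Proof.
by move=> g0 GF; rewrite (big_fsetD_sum _ GF) lerDl; apply: sumr_ge0.
Qed.

Lemma fset_sum_tail g M : (forall t, 0 <= g t) ->
  (forall F, \sum_(i <- F) g i <= M) -> forall e, 0 < e ->
  exists F0, forall F, (F0 `<=` F)%fset -> \sum_(i <- (F `\` F0)%fset) g i < e.
Proof.
move=> g0 gM e e0; pose E := [set \sum_(i <- F) g i | F in [set: {fset T}]].
have supE : has_sup E.
  by split; [exists (\sum_(i <- fset0) g i); exists fset0|exists M => _ [F _ <-]].
have [_ [F0 _ <-] hF0] := sup_adherent e0 supE.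
exists F0 => F F0F.
have : \sum_(i <- F) g i <= sup E by apply: sup_upper_bound => //; exists F.
rewrite (big_fsetD_sum _ F0F); lra.
Qed.

End FsetSums.

Section Summation.
Context (R : realType).
Implicit Types (V W : tvsType R).

Definition complete_hausdorff V : Prop :=
  hausdorff_space V /\ sequentially_complete V.

Definition abs_summable V (T : choiceType) (f : T -> V) : Prop :=
  forall P : csn V, exists M : R, forall F : {fset T}, \sum_(i <- F) P (f i) <= M.

Lemma partial_sumE V (T : choiceType) (f : T -> V) (F : {fset T}) :
  summability.partial_sum f F = \sum_(i <- F) f i.
Proof. by rewrite /summability.partial_sum big_seq_fsetE. Qed.

Definition sums_to V (T : choiceType) (f : T -> V) (l : V) : Prop :=
  forall (P : csn V) e, 0 < e -> exists F0 : {fset T}, forall F : {fset T},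
    (F0 `<=` F)%fset -> P (\sum_(i <- F) f i - l) < e.

Lemma sums_toP V (T : choiceType) (f : T -> V) l :
  summability.partial_sum f @ summability.totally --> l <-> sums_to f l.
Proof.
have ff := @summability.totally_filter T.
split=> [/csn_cvgP h P e e0|h].
  have [F0 _ hF] := h P e e0.
  by exists F0 => F F0F; rewrite -partial_sumE; exact: hF.
apply/csn_cvgP => P e e0; have [F0 hF] := h P e e0.
by exists F0 => // F F0F; rewrite /= partial_sumE hF.
Qed.

Section Tsum.
Context V (T : choiceType) (hV : hausdorff_space V).
Implicit Types (f : T -> V).

Lemma sums_to_tsum f l : sums_to f l -> tsum f = l.
Proof.
have ff := @summability.totally_filter T.
move=> /sums_toP fl; rewrite /tsum; apply: xget_unique => // l' fl'.
exact: (cvg_unique hV fl' fl).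
Qed.

Lemma sums_to_csn f l (P : csn V) M : sums_to f l ->
  (forall F : {fset T}, \sum_(i <- F) P (f i) <= M) -> P l <= M.
Proof.
move=> fl PM; apply/ler_addgt0Pr => e e0.
have [F /(_ F (fsubset_refl _)) hF] := fl P e e0.
have h1 := csnD P (\sum_(i <- F) f i) (l - \sum_(i <- F) f i).
have h2 := csn_sum P F f; have h3 := PM F.
rewrite [_ + (l - _)]addrC subrK in h1; rewrite csnC in hF; lra.
Qed.

Lemma sums_toD f g l m : sums_to f l -> sums_to g m ->
  sums_to (fun t => f t + g t) (l + m).
Proof.
move=> fl gm P e e0; have e2 : 0 < e / 2 by rewrite divr_gt0.
have [F1 h1] := fl P _ e2; have [F2 h2] := gm P _ e2.
exists (F1 `|` F2)%fset => F; rewrite fsubUset => /andP[/h1 ? /h2 ?].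
rewrite big_split/= opprD addrACA; apply: (le_lt_trans (csnD _ _ _)); lra.
Qed.

Lemma sums_to_lincont W f l (h : V -> W) : lincont h -> sums_to f l ->
  sums_to (fun t => h (f t)) (h l).
Proof.
move=> hh fl P e e0; have [Q QP] := lincont_csn hh P.
have [F0 hF] := fl Q _ e0; exists F0 => F /hF.
by rewrite QP (lincontB hh) (lincont_sum hh).
Qed.

Lemma sums_to_fin f (s : {fset T}) : (forall t, t \notin s -> f t = 0) ->
  sums_to f (\sum_(t <- s) f t).
Proof.
move=> h P e e0; exists s => F sF.
rewrite (big_fsetD_sum _ sF) addrC addKr big1_seq ?csn0// => i /=.
by rewrite inE => /andP[/h].
Qed.

Lemma sums_to_single f t0 : (forall t, t != t0 -> f t = 0) -> sums_to f (f t0).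
Proof.
move=> h; have := @sums_to_fin f [fset t0]%fset; rewrite big_seq_fset1; apply.
by move=> t; rewrite inE; exact: h.
Qed.

End Tsum.

(** Completeness is only sequential, so the net of finite sums cannot be used directly. Countability
    gives an increasing sequence of finite sets [E N] that absorbs every finite set; the sums over
    it form a Cauchy sequence, and the uniform tail estimate carries its limit over to the net. *)
Lemma summable_sums_to V (T : choiceType) (f : T -> V) :
  complete_hausdorff V -> countable [set: T] -> abs_summable f ->
  sums_to f (tsum f).
Proof.
move=> [hV cV] /countable_injP[c cinj] af.
pose E N : {fset T} := fset_set [set t | (c t < N)%N].
have EE N t : (t \in E N) = (c t < N)%N.
  have fin : finite_set [set t | (c t < N)%N].
    rewrite -[X in finite_set X]/(c @^-1` `I_N); apply: finite_preimage => //.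
    by move=> x y _ _; apply: cinj; rewrite in_setT.
  by rewrite in_fset_set//; apply/idP/idP; rewrite inE.
have bigE (F : {fset T}) : exists N, forall n, (N <= n)%N -> (F `<=` E n)%fset.
  exists (\sum_(t <- F) (c t).+1)%N => n Nn; apply/fsubsetP => t tF.
  rewrite EE; apply: leq_trans Nn; rewrite (big_rem t)//=; exact: leq_addr.
pose u N := \sum_(t <- E N) f t.
have tail (P : csn V) e : 0 < e -> exists N, forall n (F : {fset T}), (N <= n)%N ->
    (E n `<=` F)%fset -> P (\sum_(t <- F) f t - u n) < e.
  move=> e0; have [M PM] := af P.
  have [F0 hF0] := fset_sum_tail (fun t => csn_ge0 P (f t)) PM e0.
  have [N hN] := bigE F0; exists N => n F Nn EF.
  rewrite (big_fsetD_sum _ EF) addrC addKr.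
  apply: le_lt_trans (csn_sum _ _ _) _.
  apply: le_lt_trans (hF0 F (fsubset_trans (hN n Nn) EF)).
  apply: ler_sum_fsub => [t|]; first exact: csn_ge0.
  by apply: fsetDS; exact: hN.
have Emono m n : (m <= n)%N -> (E m `<=` E n)%fset.
  by move=> mn; apply/fsubsetP => t; rewrite !EE => /leq_trans; exact.
have [U /csn_basis0[P PU]|l ul] := cV u.
  have [N hN] := tail P (1 / 2) ltac:(lra).
  exists N => m n Nm Nn; apply: PU.
  have h1 := hN N (E m) (leqnn _) (Emono _ _ Nm).
  have h2 := hN N (E n) (leqnn _) (Emono _ _ Nn).
  apply: (le_lt_trans (csn_tri P _ (u N) _)); rewrite [X in _ + X]csnC; rewrite /u in h1 h2 *; lra.
have fl : sums_to f l.
  move=> P e e0; have e2 : 0 < e / 2 by rewrite divr_gt0.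
  have [N hN] := tail P _ e2.
  have := (csn_cvgP u l).1 ul P _ e2; move=> [N' _ hN'].
  pose n := maxn N N'; exists (E n) => F EF.
  have h1 := hN n F (leq_maxl _ _) EF.
  have h2 := hN' n (leq_maxr _ _).
  by have := csn_tri P (\sum_(t <- F) f t) (u n) l; rewrite /= in h2; lra.
by rewrite (sums_to_tsum hV fl).
Qed.

End Summation.

(** * Rapidly decreasing families *)

(** Positivity makes evaluations continuous, directedness lets one weight dominate any continuous
    seminorm, and countability makes sums over [T] accessible to sequential completeness. *)
Record good_weight (T : choiceType) (J : Type) (w : J -> T -> nat) : Prop := {
  gw_pos : forall j t, (0 < w j t)%N;
  gw_dir : forall j j', exists k, forall t, (w j t <= w k t)%N /\ (w j' t <= w k t)%N;
  gw_inh : inhabited J;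
  gw_countable : countable [set: T] }.

Section RapidNorm.
Context (R : realType) (V : tvsType R) (T : choiceType) (J : Type) (w : J -> T -> nat).
Local Notation rp := (rapid V w).
Implicit Types (jp : J * csn V) (x y : rp) (F : {fset T}).

Definition rterm jp (f : T -> V) t : R := (w jp.1 t)%:R * jp.2 (f t).

Lemma rterm_ge0 jp f t : 0 <= rterm jp f t.
Proof. by rewrite mulr_ge0// csn_ge0. Qed.

Lemma weighted_sum_leP jp (f : T -> V) (M : R) :
  (weighted_sum w jp f <= M%:E)%E <-> forall F, \sum_(t <- F) rterm jp f t <= M.
Proof.
split=> [h F|h].
  rewrite -lee_fin; apply: le_trans h; apply: ereal_sup_ubound.
  exists [set` F]; first by split=> //; exact: finite_fset.
  by rewrite fsbig_finite// set_fsetK sumEFin.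
apply: ge_ereal_sup => _ [A [finA _] <-].
by rewrite fsbig_finite//= sumEFin lee_fin.
Qed.

Lemma rapid_inP (f : T -> V) :
  (forall jp, exists M, forall F, \sum_(t <- F) rterm jp f t <= M) ->
  f \in rapidly_decreasing w.
Proof.
move=> h; apply/asboolP => jp; have [M /weighted_sum_leP hM] := h jp.
exact: le_lt_trans (ltry M).
Qed.

Lemma weighted_sum_fin x jp :
  weighted_sum w jp x = (rapid_norm jp x)%:E.
Proof.
rewrite /rapid_norm fineK// ge0_fin_numE ?weighted_sum_ge0//.
by have /asboolP := rapid_funP x; exact.
Qed.

Lemma rapid_norm_leP jp x M :
  rapid_norm jp x <= M <-> forall F, \sum_(t <- F) rterm jp x t <= M.
Proof. by rewrite -lee_fin -weighted_sum_fin; exact: weighted_sum_leP. Qed.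

Lemma rapid_norm_sum jp x F : \sum_(t <- F) rterm jp x t <= rapid_norm jp x.
Proof. by move: F; apply/rapid_norm_leP. Qed.

Lemma rapid_norm_term jp x t : rterm jp x t <= rapid_norm jp x.
Proof. by have := rapid_norm_sum jp x [fset t]%fset; rewrite big_seq_fset1. Qed.

Lemma rapid_norm_ge0 jp x : 0 <= rapid_norm jp x.
Proof. exact/seminorm_ge0/rapid_norm_seminorm. Qed.

Lemma rapid_norm_continuous jp : continuous (rapid_norm jp : rp -> R).
Proof.
apply: seminorm_continuous; first exact: rapid_norm_seminorm.
move=> e e0; apply/rapid_nbhsE; exists [:: jp], e; split=> // y /=.
by rewrite big_seq1 subr0.
Qed.

Definition rapid_csn jp : csn rp :=
  ContinuousSeminorm (@rapid_norm_seminorm R V T J w jp) (@rapid_norm_continuous jp).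

Lemma rapidP x y : (forall t, x t = y t) -> x = y.
Proof. by move=> h; apply: val_inj; apply/funext. Qed.

Lemma rapidDE x y t : (x + y) t = x t + y t. Proof. by []. Qed.
Lemma rapidNE x t : (- x) t = - x t. Proof. by []. Qed.
Lemma rapidZE c x t : (c *: x) t = c *: x t. Proof. by []. Qed.
Lemma rapid_sumE I (s : seq I) (f : I -> rp) t :
  (\sum_(i <- s) f i) t = \sum_(i <- s) f i t.
Proof. exact: (big_morph (fun x : rp => x t)). Qed.

Context (gw : good_weight w).

Lemma eval_bound jp t (x : rp) : jp.2 (x t) <= rapid_norm jp x.
Proof.
apply: le_trans (rapid_norm_term jp x t); rewrite /rterm ler_peMl ?csn_ge0//.
by rewrite ler1n gw_pos.
Qed.

Lemma lincont_eval t : lincont (fun x : rp => x t).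
Proof.
have [j] := gw_inh gw; apply: lincontI => // P; exists (rapid_csn (j, P)) => x.
exact: (eval_bound (j, P)).
Qed.

(** Near 0 a continuous seminorm is controlled by finitely many defining ones, hence everywhere by a
    multiple of their sum. The sum collapses to one index: constants and sums of seminorms are
    absorbed into a seminorm of [V], and weights are merged by directedness. *)
Lemma rapid_csn_dom (P : csn rp) : exists jp, forall x, P x <= rapid_norm jp x.
Proof.
have [s [e [e0 h]]] := (rapid_nbhsE 0 _).1 (csn_nbhs0 P ltr01).
have {}h x : P x <= e^-1 * \sum_(jp <- s) rapid_norm jp x.
  set q := (X in _ * X); have q0 : 0 <= q by apply: sumr_ge0 => *; exact: rapid_norm_ge0.
  (* The summand [d] covers the case [q = 0]: the multiple of [x] by [e / (q + d)] has norm strictly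
     below [e]. *)
  have Pe (d : R) : 0 < d -> P x <= e^-1 * (q + d).
    move=> d0; have qd : 0 < q + d by rewrite ltr_wpDl.
    have qn y c : \sum_(jp <- s) rapid_norm jp (c *: y : rp) = `|c| * \sum_(jp <- s) rapid_norm jp y.
      rewrite mulr_sumr; apply: eq_bigr => jp _.
      exact: (rapid_norm_seminorm _ jp).2.
    have := h (e / (q + d) *: x); rewrite /= subr0 qn csnZ -/q.
    have e1 : 0 < e / (q + d) by rewrite divr_gt0.
    rewrite gtr0_norm// mulrAC ltr_pdivrMr// ltr_pM2l// ltrDl => /(_ d0).
    rewrite -ltr_pdivlMl// mulr1 invf_div mulrC => /ltW//.
  apply/ler_addgt0Pr => d d0; have := Pe (e * d) (mulr_gt0 e0 d0).
  by rewrite mulrDr mulrA mulVf ?gt_eqF// mul1r.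
suff [jp hjp] : exists jp, forall x, e^-1 * \sum_(jp <- s) rapid_norm jp x <= rapid_norm jp x.
  by exists jp => x; exact: le_trans (h x) (hjp x).
have ei0 : 0 <= e^-1 by rewrite invr_ge0 ltW.
elim: s {h} => [|jp s [[j p] IH]].
  have [j] := gw_inh gw; have [P0 _] := csn0P V; exists (j, P0) => x.
  by rewrite big_nil mulr0 rapid_norm_ge0.
have [k hk] := gw_dir gw jp.1 j.
have [p1 h1] := csn_scaleP jp.2 ei0.
have [p2 h2] := csn_addP p1 p.
exists (k, p2) => x; rewrite big_cons mulrDr.
have h3 : e^-1 * rapid_norm jp x <= rapid_norm (k, p1) x.
  rewrite ler_pdivrMl//; apply/rapid_norm_leP => F.
  rewrite -ler_pdivrMl//; apply: le_trans (rapid_norm_sum _ _ F).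
  rewrite mulr_sumr; apply: ler_sum => t _; rewrite /rterm/= h1 mulrCA.
  by rewrite ler_wpM2r ?mulr_ge0 ?csn_ge0// ler_nat; case: (hk t).
have h4 : rapid_norm (j, p) x <= rapid_norm (k, p) x.
  apply/rapid_norm_leP => F; apply: le_trans (rapid_norm_sum _ _ F).
  apply: ler_sum => t _; rewrite /rterm/= ler_wpM2r ?csn_ge0// ler_nat.
  by case: (hk t).
have h5 : rapid_norm (k, p1) x + rapid_norm (k, p) x <= rapid_norm (k, p2) x.
  rewrite -lerBrDr; apply/rapid_norm_leP => F; rewrite lerBrDr addrC -lerBrDr.
  apply/rapid_norm_leP => G; rewrite lerBrDr.
  apply: le_trans (rapid_norm_sum _ _ (F `|` G)%fset).
  rewrite /rterm/=; under [leRHS]eq_bigr do rewrite h2 mulrDr.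
  rewrite big_split/= [leRHS]addrC; apply: lerD; apply: ler_sum_fsub => //.
  - by move=> t; exact: (rterm_ge0 (k, p)).
  - exact: fsubsetUr.
  - by move=> t; exact: (rterm_ge0 (k, p1)).
  - exact: fsubsetUl.
have := IH x; lra.
Qed.

Lemma rapid_hausdorff : hausdorff_space V -> hausdorff_space rp.
Proof.
move=> hV; apply: csn_hausdorff => x hx; apply: rapidP => t.
apply: (hausdorff_csn hV) => P; have [j] := gw_inh gw.
apply/eqP; rewrite eq_le csn_ge0 andbT.
by apply: le_trans (eval_bound (j, P) t x) _; rewrite le_eqVlt; apply/orP; left; apply/eqP/(hx (rapid_csn (j, P))).
Qed.

(** The limit is taken coordinatewise. Each finite partial sum of a norm inherits the Cauchy bound
    in the limit ([key]), and a norm is bounded as soon as its finite partial sums are; this yields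
    both rapid decrease of the limit and convergence to it, with no exchange of a limit and an
    infinite sum. *)
Lemma rapid_complete : complete_hausdorff V -> complete_hausdorff rp.
Proof.
move=> [hV cV]; split; first exact: rapid_hausdorff.
move=> u cu.
have cs (Q : csn rp) e : 0 < e -> exists N, forall m n, (N <= m)%N -> (N <= n)%N ->
    Q (u m - u n) < e by move=> e0; exact: cu (csn_nbhs0 Q e0).
have ct t : exists l : V, (fun n => u n t) @ \oo --> l.
  apply: cV => U /csn_basis0[P PU]; have [j] := gw_inh gw.
  have [N hN] := cs (rapid_csn (j, P)) 1 ltr01; exists N => m n Nm Nn.
  by apply: PU; apply: le_lt_trans (hN m n Nm Nn); exact: (eval_bound (j, P) t (u m - u n)).
have [l hl] := choice ct.
have key jp (F : {fset T}) e N : 0 < e -> (forall m n, (N <= m)%N -> (N <= n)%N ->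
    rapid_norm jp (u m - u n) < e) -> forall n, (N <= n)%N ->
    \sum_(t <- F) rterm jp (fun t => u n t - l t) t <= e.
  move=> e0 hN n Nn.
  have lt (d : R) : 0 < d -> \forall m \near \oo,
     \sum_(t <- F) (w jp.1 t)%:R * jp.2 (u m t - l t) <= d.
    move=> d0; elim: (enum_fset F) d d0 => [|t s IH] d d0.
      by exists 0%N => // m _ /=; rewrite big_nil ltW.
    have d2 : 0 < d / 2 by rewrite divr_gt0.
    have wt : 0 < (w jp.1 t)%:R :> R by rewrite ltr0n gw_pos.
    have := (csn_cvgP (fun n => u n t) (l t)).1 (hl t) jp.2 _ (divr_gt0 d2 wt).
    move=> [N1 _ k1]; have [N2 _ k2] := IH _ d2.
    exists (maxn N1 N2) => // m /=; rewrite geq_max => /andP[/k1 /= m1 /k2 /= m2].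
    by rewrite ltr_pdivlMr// mulrC in m1; rewrite big_cons; lra.
  apply/ler_addgt0Pr => d d0; have [N' _ hN'] := lt d d0.
  pose m := maxn N N'; have h1 := hN' m (leq_maxr _ _).
  have h2 := hN n m Nn (leq_maxl _ _).
  have h3 := rapid_norm_sum jp (u n - u m) F.
  apply: (@le_trans _ _ (\sum_(t <- F) rterm jp (u n - u m) t +
    \sum_(t <- F) (w jp.1 t)%:R * jp.2 (u m t - l t))); last by rewrite /= in h1; lra.
  rewrite -big_split; apply: ler_sum => t _; rewrite /rterm/= -mulrDr.
  by rewrite ler_wpM2l// csn_tri.
have rl : l \in rapidly_decreasing w.
  apply: rapid_inP => jp; have [N hN] := cs (rapid_csn jp) 1 ltr01.
  exists (1 + rapid_norm jp (u N)) => F.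
  have h1 := key jp F 1 N ltr01 hN N (leqnn _).
  have h2 := rapid_norm_sum jp (u N) F.
  apply: le_trans (lerD h1 h2); rewrite -big_split; apply: ler_sum => t _.
  rewrite /rterm/= -mulrDr ler_wpM2l// [jp.2 (u N t - l t)]csnC.
  by have := csnD jp.2 (l t - u N t) (u N t); rewrite subrK.
exists (Rapid rl); apply/csn_cvgP => P e e0.
have [jp hP] := rapid_csn_dom P.
have e2 : 0 < e / 2 by rewrite divr_gt0.
have [N hN] := cs (rapid_csn jp) _ e2.
exists N => // n Nn; apply: le_lt_trans (hP _) _.
apply: (@le_lt_trans _ _ (e / 2)); last by lra.
by apply/rapid_norm_leP => F; exact: (key jp F _ N).
Qed.

End RapidNorm.

(** * Basis elements and extension of maps from them *)

Section Single.
Context (R : realType) (V : tvsType R) (T : choiceType) (J : Type) (w : J -> T -> nat).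
Local Notation rp := (rapid V w).

Definition single_fun (t : T) (s : V) : T -> V := fun u => if u == t then s else 0.

Lemma rterm_single jp t s (F : {fset T}) :
  \sum_(u <- F) rterm w jp (single_fun t s) u <= (w jp.1 t)%:R * jp.2 s.
Proof.
pose G := (F `|` [fset t])%fset.
apply: (@le_trans _ _ (\sum_(u <- G) rterm w jp (single_fun t s) u)).
  by apply: ler_sum_fsub => [u|]; [exact: rterm_ge0|exact: fsubsetUl].
rewrite (big_fsetD_sum _ (fsubsetUr F [fset t]%fset)) big_seq_fset1 big1_seq.
  by rewrite addr0 /rterm /single_fun eqxx.
move=> u /=; rewrite !inE => /andP[/negbTE ut _].
by rewrite /rterm /single_fun ut csn0 mulr0.
Qed.

Lemma single_in t s : single_fun t s \in rapidly_decreasing w.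
Proof. by apply: rapid_inP => jp; eexists => F; exact: rterm_single. Qed.

Definition single t s : rp := Rapid (single_in t s).

Lemma singleE t s u : single t s u = if u == t then s else 0. Proof. by []. Qed.

Lemma rapid_norm_single jp t s : rapid_norm jp (single t s) <= (w jp.1 t)%:R * jp.2 s.
Proof. by apply/rapid_norm_leP => F; exact: rterm_single. Qed.

Lemma singleD t s s' : single t (s + s') = single t s + single t s'.
Proof. by apply: rapidP => u; rewrite rapidDE !singleE; case: ifP; rewrite ?addr0. Qed.

Lemma singleZ t c s : single t (c *: s) = c *: single t s.
Proof. by apply: rapidP => u; rewrite rapidZE !singleE; case: ifP; rewrite ?scaler0. Qed.

Context (gw : good_weight w).

Lemma lincont_single t : lincont (single t).
Proof.
apply: lincontI => [s s'|c s|P]; [exact: singleD|exact: singleZ|].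
have [[j p] hP] := rapid_csn_dom gw P.
have [p' hp'] := csn_scaleP p (ler0n R (w j t)).
by exists p' => s; rewrite hp'; apply: le_trans (hP _) (rapid_norm_single _ _ _).
Qed.

Lemma rapid_restr (x : rp) (F : {fset T}) u :
  (\sum_(t <- F) single t (x t)) u = if u \in F then x u else 0.
Proof.
have -> : (\sum_(t <- F) single t (x t)) u = \sum_(t <- F) if u == t then x t else 0.
  by rewrite rapid_sumE.
have [uF|uF] := boolP (u \in F).
  rewrite (big_fsetD_sum _ (_ : [fset u] `<=` F)%fset) ?fsub1set//.
  rewrite big_seq_fset1 eqxx big1_seq ?addr0// => t /=.
  by rewrite !inE eq_sym => /andP[/negbTE->].
rewrite big1_seq// => t /= tF; case: eqP => // ut.
by move: uF; rewrite ut tF.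
Qed.

Lemma rapid_sums (x : rp) : sums_to (fun t => single t (x t)) x.
Proof.
move=> P e e0; have [jp hP] := rapid_csn_dom gw P.
have e2 : 0 < e / 2 by rewrite divr_gt0.
have [F0 hF0] := fset_sum_tail (rterm_ge0 _ jp x) (rapid_norm_sum jp x) e2.
exists F0 => F F0F; apply: le_lt_trans (hP _) _.
apply: (@le_lt_trans _ _ (e / 2)); last by lra.
apply/rapid_norm_leP => G.
apply: (@le_trans _ _ (\sum_(t <- ((F `|` G) `\` F0)%fset) rterm w jp x t)); last first.
  by apply/ltW/hF0; apply: fsubset_trans F0F (fsubsetUl _ _).
have -> : \sum_(t <- G) rterm w jp (\sum_(t <- F) single t (x t) - x) t =
    \sum_(t <- (G `\` F)%fset) rterm w jp x t.
  rewrite [LHS](_ : _ = \sum_(t <- G) if t \notin F then rterm w jp x t else 0); last first.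
    apply: eq_bigr => t _; rewrite /rterm rapidDE rapidNE rapid_restr.
    by case: ifP => /=; rewrite ?subrr ?csn0 ?mulr0// sub0r csnN.
  rewrite -big_mkcond -big_filter; apply: perm_big; apply: uniq_perm.
  - by rewrite filter_uniq.
  - exact: fset_uniq.
  - by move=> t; rewrite mem_filter !inE.
apply: ler_sum_fsub; first exact: rterm_ge0.
apply/fsubsetP => t; rewrite !inE => /andP[tF tG]; rewrite tG orbT andbT.
by apply: contra tF; exact: (fsubsetP F0F).
Qed.

(** By [rapid_sums] the finite sums of values of [single] are dense. Nearly every identity below is
    reduced to basis elements in this way. *)
Lemma rapid_ext (W : tvsType R) (f g : rp -> W) : hausdorff_space W ->
  lincont f -> lincont g -> (forall t s, f (single t s) = g (single t s)) ->
  forall x, f x = g x.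
Proof.
move=> hW hf hg fg x.
have := sums_to_lincont hf (rapid_sums x); have := sums_to_lincont hg (rapid_sums x).
under [X in sums_to X _ -> _]eq_fun do rewrite -fg.
by move=> /(sums_to_tsum hW) <- /(sums_to_tsum hW) <-.
Qed.

Lemma rapid_csn_le (P : csn rp) (jp : J * csn V) c : 0 <= c ->
  (forall t s, P (single t s) <= c * ((w jp.1 t)%:R * jp.2 s)) ->
  forall x, P x <= c * rapid_norm jp x.
Proof.
move=> c0 h x; apply: (sums_to_csn (rapid_sums x)) => F.
apply: le_trans (ler_wpM2l c0 (rapid_norm_sum jp x F)).
by rewrite mulr_sumr; apply: ler_sum => t _; exact: h.
Qed.

(* Universal property of [rapid V w]: maps [e t : V -> W] into a complete space with growth
   bounded by the weights extend uniquely to a continuous linear map sending [single t s]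
   to [e t s]. *)
Record pushable (W : tvsType R) (e : T -> V -> W) : Prop := Pushable {
  pushableD : forall t s s', e t (s + s') = e t s + e t s';
  pushableZ : forall t c s, e t (c *: s) = c *: e t s;
  pushable_bound : forall P : csn W, exists jp : J * csn V, forall t s,
    P (e t s) <= (w jp.1 t)%:R * jp.2 s }.

Definition push (W : tvsType R) (e : T -> V -> W) (x : rp) : W :=
  tsum (fun t => e t (x t)).

Section Push.
Context (W : tvsType R) (cW : complete_hausdorff W).
Implicit Types (e : T -> V -> W).

Section One.
Context (e : T -> V -> W) (he : pushable e).

Lemma push_sums (x : rp) : sums_to (fun t => e t (x t)) (push e x).
Proof.
apply: summable_sums_to => //; first exact: gw_countable gw.
move=> P; have [jp h] := pushable_bound he P; exists (rapid_norm jp x) => F.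
by apply: le_trans (rapid_norm_sum jp x F); apply: ler_sum => t _; exact: h.
Qed.

Lemma push_bound (P : csn W) (jp : J * csn V) c x : 0 <= c ->
  (forall t s, P (e t s) <= c * ((w jp.1 t)%:R * jp.2 s)) ->
  P (push e x) <= c * rapid_norm jp x.
Proof.
move=> c0 h; apply: (sums_to_csn (push_sums x)) => F.
apply: le_trans (ler_wpM2l c0 (rapid_norm_sum jp x F)).
by rewrite mulr_sumr; apply: ler_sum => t _; exact: h.
Qed.

Lemma push_lincont : lincont (push e).
Proof.
apply: lincontI => [x y|c x|P].
- apply: sums_to_tsum; first exact: cW.1.
  have := sums_toD (push_sums x) (push_sums y).
  by under [X in sums_to X _ -> _]eq_fun do rewrite -(pushableD he) -rapidDE.
- apply: sums_to_tsum; first exact: cW.1.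
  have := sums_to_lincont (lincont_scale c (lincont_id W)) (push_sums x).
  by under [X in sums_to X _ -> _]eq_fun do rewrite -(pushableZ he) -rapidZE.
- have [jp h] := pushable_bound he P; exists (rapid_csn w jp) => x.
  have := @push_bound P jp 1 x ler01; rewrite mul1r; apply => t s.
  by rewrite mul1r h.
Qed.

Lemma push_single t s : push e (single t s) = e t s.
Proof.
apply: sums_to_tsum; first exact: cW.1.
have := @sums_to_single R W T (fun u => e u (single t s u)) t.
rewrite singleE eqxx; apply => u /negbTE ut; rewrite singleE ut.
by rewrite -(scale0r 0) (pushableZ he) scale0r.
Qed.

End One.

(** Seminorm bounds uniform in [y] make the maps [push (e y)] equicontinuous, so [x y0] may be
    replaced by a finite truncation, on which continuity in the parameter is needed for single basis
    elements only. The homotopies are not continuous uniformly over the basis; this is where rapid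
    decrease compensates. *)
Lemma push_continuous (Y : topologicalType) (e : Y -> T -> V -> W) (x : Y -> rp) :
  (forall y t s s', e y t (s + s') = e y t s + e y t s') ->
  (forall y t c s, e y t (c *: s) = c *: e y t s) ->
  (forall P : csn W, exists jp : J * csn V, forall y t s, P (e y t s) <= (w jp.1 t)%:R * jp.2 s) ->
  (forall t s, continuous (fun y => e y t s)) -> continuous x ->
  continuous (fun y => push (e y) (x y)).
Proof.
move=> eD eZ eb ec xc; have pe y : pushable (e y).
  by split=> // P; have [jp h] := eb P; exists jp.
apply/csn_continuousP => y0 P d d0; have [jp hP] := eb P.
have d4 : 0 < d / 4 by rewrite divr_gt0.
have bd y z : P (push (e y) z) <= rapid_norm jp z.
  have := @push_bound _ (pe y) P jp 1 z ler01; rewrite mul1r; apply => t s.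
  by rewrite mul1r.
have [F0 /(_ _ (fsubset_refl _))] := rapid_sums (x y0) (rapid_csn w jp) d4.
set xF := \sum_(t <- F0) _ => /= hF.
have lc y := push_lincont (pe y).
have cF : continuous (fun y => push (e y) xF).
  under [fun _ => _]eq_fun => y.
    rewrite /xF (lincont_sum (lc y)); under eq_bigr do rewrite (push_single (pe y)).
    over.
  by apply: continuous_sum_tvs.
have := (csn_continuousP _).1 cF y0 P _ d4.
have := (csn_continuousP _).1 xc y0 (rapid_csn w jp) _ d4.
apply: filterS2 => y /= h1 h2.
(* Four errors, each below [d / 4]: moving the argument, moving the parameter on the truncation, and
   truncating at [y] and at [y0]. *)
have -> : push (e y) (x y) - push (e y0) (x y0) =
    push (e y) (x y - x y0) + (push (e y) xF - push (e y0) xF) -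
    push (e y) (xF - x y0) + push (e y0) (xF - x y0).
  by rewrite !(lincontB (lc _)) opprB (addrAC (_ - _)) !subrKA.
apply: le_lt_trans (csnD _ _ _) _.
apply: le_lt_trans (lerD (csnD _ _ _) (lexx _)) _.
apply: le_lt_trans (lerD (lerD (csnD _ _ _) (lexx _)) (lexx _)) _.
rewrite csnN; have := bd y (x y - x y0); have := bd y (xF - x y0).
have := bd y0 (xF - x y0); lra.
Qed.

End Push.
End Single.

Section Bipush.
Context (R : realType) (V V' W : tvsType R) (cW : complete_hausdorff W).
Context (T T' : choiceType) (J J' : Type) (w : J -> T -> nat) (w' : J' -> T' -> nat).
Context (gw : good_weight w) (gw' : good_weight w').

Lemma biext (U : tvsType R) (f g : rapid V w -> rapid V' w' -> U) : hausdorff_space U ->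
  bilincont f -> bilincont g ->
  (forall t t' s s', f (single w t s) (single w' t' s') = g (single w t s) (single w' t' s')) ->
  forall x y, f x y = g x y.
Proof.
move=> hU hf hg fg x y.
apply: (@rapid_ext R V T J w gw U (fun x => f x y) (fun x => g x y)) => //.
- exact: bilincont_l.
- exact: bilincont_l.
- move=> t s; apply: (rapid_ext gw' hU) => //; exact: bilincont_r.
Qed.

Record bipushable (e : T -> T' -> V -> V' -> W) : Prop := Bipushable {
  bipushableDl : forall t t' s s1 s', e t t' (s + s1) s' = e t t' s s' + e t t' s1 s';
  bipushableDr : forall t t' s s' s1, e t t' s (s' + s1) = e t t' s s' + e t t' s s1;
  bipushableZl : forall t t' c s s', e t t' (c *: s) s' = c *: e t t' s s';
  bipushableZr : forall t t' c s s', e t t' s (c *: s') = c *: e t t' s s';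
  bipushable_bound : forall P : csn W, exists (jp : J * csn V) (jp' : J' * csn V'), forall t t' s s',
    P (e t t' s s') <= (w jp.1 t)%:R * jp.2 s * ((w' jp'.1 t')%:R * jp'.2 s') }.

Definition bipush (e : T -> T' -> V -> V' -> W) (x : rapid V w) (y : rapid V' w') : W :=
  push (fun t s => push (fun t' s' => e t t' s s') y) x.

Context (e : T -> T' -> V -> V' -> W) (he : bipushable e).

Let inner t s : pushable w' (fun t' s' => e t t' s s').
Proof.
split=> [*|*|P]; [exact: bipushableDr|exact: bipushableZr|].
have [jp [[j' p'] h]] := bipushable_bound he P.
have c0 : 0 <= (w jp.1 t)%:R * jp.2 s by rewrite mulr_ge0// csn_ge0.
have [q hq] := csn_scaleP p' c0; exists (j', q) => t' s' /=.
by rewrite hq mulrCA h.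
Qed.

Let bound (P : csn W) : exists (jp : J * csn V) (jp' : J' * csn V'), forall y t s,
  P (push (fun t' s' => e t t' s s') y) <= (w jp.1 t)%:R * jp.2 s * rapid_norm (w:=w') jp' y.
Proof.
have [jp [jp' h]] := bipushable_bound he P; exists jp, jp' => y t s.
apply: (push_bound gw' cW (inner t s)) => [|t' s']; last exact: h.
by rewrite mulr_ge0// csn_ge0.
Qed.

Let outer (y : rapid V' w') : pushable w (fun t s => push (fun t' s' => e t t' s s') y).
Proof.
have hW := cW.1.
split=> [t s s'|t c s|P].
- move: y; apply: (rapid_ext gw' hW).
  + exact: push_lincont.
  + by apply: lincont_add; exact: push_lincont.
  + by move=> t' s1; rewrite !push_single//; exact: bipushableDl.
- move: y; apply: (rapid_ext gw' hW).
  + exact: push_lincont.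
  + by apply: lincont_scale; exact: push_lincont.
  + by move=> t' s1; rewrite !push_single//; exact: bipushableZl.
- have [[j p] [jp' h]] := bound P.
  have [q hq] := csn_scaleP p (rapid_norm_ge0 jp' y).
  by exists (j, q) => t s; apply: le_trans (h _ _ _) _; rewrite /= hq mulrA mulrAC.
Qed.

Lemma bipush_bilincont : bilincont (bipush e).
Proof.
have hW := cW.1; split.
- by move=> x x' y; exact: lincontD (push_lincont gw cW (outer y)) _ _.
- move=> x y y'.
  move: x; apply: (rapid_ext gw hW).
  + exact: push_lincont.
  + by apply: lincont_add; exact: push_lincont.
  + by move=> t s; rewrite /bipush !push_single//; exact: lincontD (push_lincont gw' cW (inner t s)) _ _.
- by move=> c x y; exact: lincontZ (push_lincont gw cW (outer y)) _ _.
- move=> c x y.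
  move: x; apply: (rapid_ext gw hW).
  + exact: push_lincont.
  + by apply: lincont_scale; exact: push_lincont.
  + by move=> t s; rewrite /bipush !push_single//; exact: lincontZ (push_lincont gw' cW (inner t s)) _ _.
- move=> P; have [jp [jp' h]] := bound P.
  exists (rapid_csn w jp), (rapid_csn w' jp') => x y /=; rewrite mulrC.
  apply: (push_bound gw cW (outer y)); first exact: rapid_norm_ge0.
  by move=> t s; rewrite mulrC h.
Qed.

Lemma bipush_single t t' s s' : bipush e (single w t s) (single w' t' s') = e t t' s s'.
Proof. by rewrite /bipush push_single// push_single. Qed.

End Bipush.

Section BilincontClosure.
Context (R : realType).
Implicit Types (U V W : tvsType R).

Lemma bilincont_post V W U U' (f : V -> W -> U) (h : U -> U') :
  bilincont f -> lincont h -> bilincont (fun x y => h (f x y)).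
Proof.
move=> hf hh; split=> [x x' y|x y y'|c x y|c x y|P].
- by rewrite (bilincontDl hf) (lincontD hh).
- by rewrite (bilincontDr hf) (lincontD hh).
- by rewrite (bilincontZl hf) (lincontZ hh).
- by rewrite (bilincontZr hf) (lincontZ hh).
- have [Q hQ] := lincont_csn hh P; have [Q1 [Q2 hb]] := bilincont_bound hf Q.
  by exists Q1, Q2 => x y; rewrite -hQ.
Qed.

Lemma bilincont_pre V V' W W' U (f : V -> W -> U) (g : V' -> V) (h : W' -> W) :
  bilincont f -> lincont g -> lincont h -> bilincont (fun x y => f (g x) (h y)).
Proof.
move=> hf hg hh; split=> [x x' y|x y y'|c x y|c x y|P].
- by rewrite (lincontD hg) (bilincontDl hf).
- by rewrite (lincontD hh) (bilincontDr hf).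
- by rewrite (lincontZ hg) (bilincontZl hf).
- by rewrite (lincontZ hh) (bilincontZr hf).
- have [Q1 [Q2 hQ]] := bilincont_bound hf P.
  have [P1 h1] := lincont_csn hg Q1; have [P2 h2] := lincont_csn hh Q2.
  by exists P1, P2 => x y; rewrite h1 h2.
Qed.

(** Continuity at the origin bounds [P] of a product on the set where [Q] and [Q'] are below 1;
    homogeneity in each factor spreads this to all pairs. *)
Lemma lcalgebra_bilincont (A : tvsAlgebra R) : is_lcalgebra A ->
  bilincont (@tva_mul R A).
Proof.
move=> hA; split; [exact: (lca_mulDl hA)|exact: (lca_mulDr hA)|exact: (lca_mulZl hA)|
  exact: (lca_mulZr hA)|].
have m0 x : tva_mul (0 : A) x = 0.
  by rewrite -[X in tva_mul X x](scale0r (0 : A)) (lca_mulZl hA) scale0r.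
move=> P; have /(_ (0, 0)) := lca_mul_continuous hA; rewrite /continuous_at/= m0.
move=> /(_ _ (csn_nbhs0 P ltr01))[[U U'] /= [/csn_basis0[Q QU] /csn_basis0[Q' QU']] h].
exists Q, Q' => x y; apply/ler_addgt0Pr => e e0.
set a := Q x; set b := Q' y.
have a0 : 0 <= a := csn_ge0 _ _; have b0 : 0 <= b := csn_ge0 _ _.
(* Adding [d] avoids dividing by a vanishing seminorm; [d <= 1] and the second bound keep
   [(a + d) * (b + d)] within [e] of [a * b]. *)
pose d := Num.min 1 (e / (a + b + 1)).
have ab : 0 < a + b + 1 by lra.
have d0 : 0 < d by rewrite lt_min ltr01/= divr_gt0.
have ad : 0 < a + d by lra. have bd : 0 < b + d by lra.
have := h ((a + d)^-1 *: x, (b + d)^-1 *: y).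
rewrite /= lca_mulZl// lca_mulZr// scalerA csnZ normrM !gtr0_norm ?invr_gt0//.
rewrite -invfM mulrC ltr_pdivrMr ?mulr_gt0// mul1r => h'.
apply: (@le_trans _ _ ((a + d) * (b + d))).
  apply/ltW/h'; split=> /=; [apply: QU|apply: QU'].
    by rewrite csnZ gtr0_norm ?invr_gt0// mulrC ltr_pdivrMr// mul1r ltrDl.
  by rewrite csnZ gtr0_norm ?invr_gt0// mulrC ltr_pdivrMr// mul1r ltrDl.
have -> : (a + d) * (b + d) = a * b + d * (a + b + d) by ring.
rewrite lerD2l; apply: (@le_trans _ _ (e / (a + b + 1) * (a + b + 1))).
  apply: ler_pM; [lra|lra|by rewrite ge_min lexx orbT|].
  by rewrite lerD2l ge_min lexx.
by rewrite divfK// gt_eqF.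
Qed.

Lemma lcalgebra_complete (A : tvsAlgebra R) : is_lcalgebra A -> complete_hausdorff A.
Proof. by move=> hA; split; [exact: lca_hausdorff|exact: lca_complete]. Qed.

End BilincontClosure.

(** * Formal linear combinations *)

Section Lsum.
Context (R : realType).

(** A list of pairs stands for a formal linear combination in which repetitions and zero
    coefficients are allowed, so lists are compared through their sums in a module; by [lsum_ext]
    the coefficients [lcoef] decide. *)
Definition lsum (U : Type) (M : lmodType R) (L : seq (R * U)) (g : U -> M) : M :=
  \sum_(cu <- L) cu.1 *: g cu.2.

Definition lbind (U U' : Type) (L : seq (R * U)) (f : U -> seq (R * U')) : seq (R * U') :=
  flatten [seq [seq (cu.1 * dv.1, dv.2) | dv <- f cu.2] | cu <- L].

Lemma lsum_nil U (M : lmodType R) (g : U -> M) : lsum [::] g = 0.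
Proof. by rewrite /lsum big_nil. Qed.
Lemma lsum_cons U (M : lmodType R) c u L (g : U -> M) :
  lsum ((c, u) :: L) g = c *: g u + lsum L g.
Proof. by rewrite /lsum big_cons. Qed.
Lemma lsum_seq1 U (M : lmodType R) c u (g : U -> M) : lsum [:: (c, u)] g = c *: g u.
Proof. by rewrite /lsum big_seq1. Qed.
Lemma lsum_cat U (M : lmodType R) L L' (g : U -> M) :
  lsum (L ++ L') g = lsum L g + lsum L' g.
Proof. by rewrite /lsum big_cat. Qed.
Lemma eq_lsum U (M : lmodType R) L (g g' : U -> M) : (forall u, g u = g' u) ->
  lsum L g = lsum L g'.
Proof. by move=> h; apply: eq_bigr => i _; rewrite h. Qed.

Lemma lsum_bind U U' (M : lmodType R) L (f : U -> seq (R * U')) (g : U' -> M) :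
  lsum (lbind L f) g = lsum L (fun u => lsum (f u) g).
Proof.
elim: L => [|[c u] L IH]; first by rewrite /lbind/= !lsum_nil.
rewrite lsum_cons -IH /lbind/= lsum_cat; congr (_ + _).
by rewrite /lsum big_map scaler_sumr; apply: eq_bigr => i _; rewrite /= scalerA.
Qed.

Lemma lsumD U (M : lmodType R) L (g g' : U -> M) :
  lsum L (fun u => g u + g' u) = lsum L g + lsum L g'.
Proof. by rewrite /lsum -big_split; apply: eq_bigr => i _; rewrite scalerDr. Qed.

Lemma lsumZ U (M : lmodType R) L c (g : U -> M) :
  lsum L (fun u => c *: g u) = c *: lsum L g.
Proof. by rewrite /lsum scaler_sumr; apply: eq_bigr => i _; rewrite !scalerA mulrC. Qed.

Lemma lsumN U (M : lmodType R) L (g : U -> M) :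
  lsum L (fun u => - g u) = - lsum L g.
Proof.
by rewrite -scaleN1r -lsumZ; apply: eq_lsum => u; rewrite scaleN1r.
Qed.

Lemma lincont_lsum U (V W : tvsType R) (f : V -> W) L (g : U -> V) : lincont f ->
  f (lsum L g) = lsum L (fun u => f (g u)).
Proof.
by move=> hf; rewrite /lsum (lincont_sum hf); apply: eq_bigr => i _; rewrite (lincontZ hf).
Qed.

Definition lcoef (U : eqType) (L : seq (R * U)) (v : U) : R :=
  lsum L (fun u => (u == v)%:R : R^o).

Lemma lsum_coef (U : eqType) (M : lmodType R) L (s : seq U) (g : U -> M) : uniq s ->
  (forall cu, cu \in L -> cu.2 \in s) ->
  lsum L g = \sum_(v <- s) lcoef L v *: g v.
Proof.
move=> us; elim: L => [|[c u] L IH] Ls.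
  by rewrite lsum_nil big1// => v _; rewrite /lcoef lsum_nil scale0r.
rewrite lsum_cons IH; last by move=> cu cuL; apply: Ls; rewrite inE cuL orbT.
under [RHS]eq_bigr do rewrite /lcoef lsum_cons scalerDl.
rewrite big_split/=; congr (_ + _).
rewrite (bigD1_seq u)//=; last by apply: (Ls (c, u)); rewrite inE eqxx.
rewrite eqxx big1 ?addr0; first by rewrite [_ *: 1]mulr1.
by move=> v /negbTE vu; rewrite eq_sym vu [_ *: 0]mulr0 scale0r.
Qed.

Lemma lsum_ext (U : eqType) (M : lmodType R) L L' (g : U -> M) :
  (forall v, lcoef L v = lcoef L' v) -> lsum L g = lsum L' g.
Proof.
move=> h; pose s := undup [seq cu.2 | cu <- L ++ L'].
rewrite (@lsum_coef U M L s) ?undup_uniq//; last first.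
  by move=> cu cuL; rewrite mem_undup; apply: map_f; rewrite mem_cat cuL.
rewrite (@lsum_coef U M L' s) ?undup_uniq//; last first.
  by move=> cu cuL; rewrite mem_undup; apply: map_f; rewrite mem_cat cuL orbT.
by apply: eq_bigr => v _; rewrite h.
Qed.

Lemma csn_lsum U (V : tvsType R) (P : csn V) L (g : U -> V) :
  P (lsum L g) <= \sum_(cu <- L) `|cu.1| * P (g cu.2).
Proof.
apply: le_trans (csn_sum _ _ _) _; apply: ler_sum => i _; by rewrite csnZ.
Qed.

End Lsum.

(** * Operators given by kernels of polynomial growth *)

Lemma leq_exp_base (m n k : nat) : (m <= n)%N -> (m ^ k <= n ^ k)%N.
Proof. by move=> mn; elim: k => // k IH; rewrite !expnS leq_mul. Qed.

Definition wabs (T : Type) (a : T -> nat) (k : nat) (t : T) : nat := ((1 + a t) ^ k)%N.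

Lemma good_wabs (T : choiceType) (a : T -> nat) : countable [set: T] ->
  good_weight (wabs a).
Proof.
move=> cT; split=> //; [by move=> k t; rewrite expn_gt0| |exact: inhabits 0%N].
move=> k l; exists (maxn k l) => t.
by split; apply: leq_pexp2l; rewrite ?leq_maxl ?leq_maxr.
Qed.

Section Kernel.
Context (R : realType) (S : tvsType R) (cS : complete_hausdorff S).
Context (T U : choiceType) (J J' : Type) (w : J -> T -> nat) (w' : J' -> U -> nat).
Context (gw : good_weight w) (gw' : good_weight w').

(** [K t] is a column of a scalar matrix with finitely supported columns. The estimate compares its
    weighted l^1 norm with a weight of [t], which is what lets the matrix act continuously on
    [S]-valued families. *)
Definition kernel_bound (K : T -> seq (R * U)) : Prop :=
  forall j', exists (C : R) j, 0 <= C /\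
    forall t, \sum_(cu <- K t) `|cu.1| * (w' j' cu.2)%:R <= C * (w j t)%:R.

Definition kernel_term (K : T -> seq (R * U)) (t : T) (s : S) : rapid S w' :=
  lsum (K t) (fun u => single w' u s).

Lemma ker_csn (P : csn (rapid S w')) : exists (j' : J') (p : csn S), forall K t s,
  P (kernel_term K t s) <= (\sum_(cu <- K t) `|cu.1| * (w' j' cu.2)%:R) * p s.
Proof.
have [[j' p] hP] := rapid_csn_dom gw' P; exists j', p => K t s.
apply: le_trans (csn_lsum _ _ _) _; rewrite mulr_suml; apply: ler_sum => cu _.
rewrite -mulrA ler_wpM2l//; apply: le_trans (hP _) _.
exact: (rapid_norm_single w' (j', p)).
Qed.

Lemma ker_addr K t s s' : kernel_term K t (s + s') = kernel_term K t s + kernel_term K t s'.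
Proof. by rewrite /kernel_term -lsumD; apply: eq_lsum => u; rewrite singleD. Qed.

Lemma ker_scale K t c s : kernel_term K t (c *: s) = c *: kernel_term K t s.
Proof. by rewrite /kernel_term -lsumZ; apply: eq_lsum => u; rewrite singleZ. Qed.

Lemma ker_pushable K : kernel_bound K -> pushable w (kernel_term K).
Proof.
move=> hK; split=> [t s s'|t c s|P]; [exact: ker_addr|exact: ker_scale|].
have [j' [p h]] := ker_csn P; have [C [j [C0 hC]]] := hK j'.
have [q hq] := csn_scaleP p C0; exists (j, q) => t s; apply: le_trans (h _ _ _) _.
by rewrite /= hq mulrA [_ * C]mulrC ler_wpM2r// csn_ge0.
Qed.

Definition kpush (K : T -> seq (R * U)) : rapid S w -> rapid S w' := push (kernel_term K).

Lemma kpush_lincont K : kernel_bound K -> lincont (kpush K).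
Proof. by move=> hK; apply: push_lincont => //; [exact: rapid_complete|exact: ker_pushable]. Qed.

Lemma kpush_single K t s : kernel_bound K ->
  kpush K (single w t s) = lsum (K t) (fun u => single w' u s).
Proof. by move=> hK; rewrite /kpush push_single//; [exact: rapid_complete|exact: ker_pushable]. Qed.

Lemma kpush_continuous (Y : topologicalType) (K : Y -> T -> seq (R * U))
    (x : Y -> rapid S w) :
  (forall j', exists (C : R) j, 0 <= C /\ forall y t,
     \sum_(cu <- K y t) `|cu.1| * (w' j' cu.2)%:R <= C * (w j t)%:R) ->
  (forall t (s : S), continuous (fun y => lsum (K y t) (fun u => single w' u s))) ->
  continuous x -> continuous (fun y => kpush (K y) (x y)).
Proof.
move=> hK hc hx; apply: push_continuous => //; first exact: rapid_complete.
- by move=> *; exact: ker_addr.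
- by move=> *; exact: ker_scale.
move=> P; have [j' [p h]] := ker_csn P; have [C [j [C0 hC]]] := hK j'.
have [q hq] := csn_scaleP p C0; exists (j, q) => y t s; apply: le_trans (h _ _ _) _.
by rewrite /= hq mulrA [_ * C]mulrC ler_wpM2r// csn_ge0.
Qed.

End Kernel.

(** If both the l^1 norm of a column and the size of its support grow polynomially, the weight of
    index [j'] on the support is at most a power of [1 + a t] with exponent [d * j'], and the norm
    contributes the exponent [c]. The constants do not depend on [y], as joint continuity
    requires. *)
Lemma kernel_poly (R : realType) (Y : Type) (T U : choiceType) (a : T -> nat) (b : U -> nat)
    (K : Y -> T -> seq (R * U)) (C : R) (c D d : nat) : 0 <= C ->
  (forall y t, \sum_(cu <- K y t) `|cu.1| <= C * ((1 + a t) ^ c)%:R) ->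
  (forall y t cu, cu \in K y t -> (b cu.2 <= D * (1 + a t) ^ d)%N) ->
  forall j', exists (C : R) j, 0 <= C /\ forall y t,
     \sum_(cu <- K y t) `|cu.1| * (wabs b j' cu.2)%:R <= C * (wabs a j t)%:R.
Proof.
move=> C0 hC hD j; exists (C * ((1 + D) ^ j)%:R), (c + d * j)%N.
split=> [|y t]; first by rewrite mulr_ge0.
apply: (@le_trans _ _ (\sum_(cu <- K y t) `|cu.1| * ((1 + D) ^ j * (1 + a t) ^ (d * j))%N%:R)).
  rewrite !big_seq; apply: ler_sum => cu cuK; rewrite ler_wpM2l// ler_nat /wabs.
  rewrite expnM -expnMn; apply: leq_exp_base; apply: leq_trans (_ : 1 + D * (1 + a t) ^ d <= _)%N.
    by rewrite leq_add2l; exact: hD cuK.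
  by rewrite mulnDl mul1n leq_add2r expn_gt0.
rewrite -mulr_suml /wabs expnD !natrM.
have := hC y t; set E := ((1 + a t) ^ c)%:R; set A := _%:R; set B := _%:R => h.
have -> : C * A * (E * B) = (C * E) * (A * B) by ring.
by rewrite ler_wpM2r// mulr_ge0.
Qed.

(** * The bicyclic monoid and the rotated isometry *)

(* [(n, m)] stands for v^n v*^m, where v is the unilateral shift and v* v = 1. *)
Definition bmul (x y : nat * nat) : nat * nat :=
  (x.1 + (y.1 - x.2), y.2 + (x.2 - y.1))%N.

Lemma bmulA : associative bmul.
Proof. by move=> [a b] [c d] [e f]; rewrite /bmul/=; congr pair; lia. Qed.

(* Matrices over the Toeplitz algebra, indexed by levels k = 0, 1, 2, ...: [inl ((p, q), (k,
   l))] is v^p v*^q placed in entry (k, l), and [inr (n, m)] is psi(v^n v*^m) = v0^n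
   v0*^m, where v0 fixes level 0 and shifts levels 1, 2, ... identically in the inner
   variable. Products of such elements are again of this form or zero. *)
Notation levels := ((nat * nat) * (nat * nat) + nat * nat)%type.

Definition levels_mul (x y : levels) : option levels :=
  match x, y with
  | inl (b, (k, l)), inl (b', (k', l')) =>
      if l == k' then Some (inl (bmul b b', (k, l'))) else None
  | inl (b, (k, l)), inr (n, m) =>
      if l == 0%N then Some (inl (b, (k, 0%N)))
      else if (n < l)%N then Some (inl (b, (k, l - n + m)%N)) else None
  | inr (n, m), inl (b, (k, l)) =>
      if k == 0%N then Some (inl (b, (0%N, l)))
      else if (m < k)%N then Some (inl (b, (k - m + n, l)%N)) else None
  | inr b, inr b' => Some (inr (bmul b b'))
  end.

Definition olift (A B C : Type) (f : A -> B -> option C) (x : option A) (y : option B) :=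
  if x is Some a then if y is Some b then f a b else None else None.

Lemma levels_mulA x y z :
  olift levels_mul (levels_mul x y) (Some z) = olift levels_mul (Some x) (levels_mul y z).
Proof.
case: x => [[b [k l]]|[n m]]; case: y => [[b' [k' l']]|[n' m']];
  case: z => [[b'' [k'' l'']]|[n'' m'']] /=.
- do 2 (case: eqP => //= ?); subst; rewrite ?eqxx ?bmulA//.
  by case: eqP.
all: rewrite /bmul ?[in LHS]/= ?[in RHS]/=.
all: repeat (case: eqP => /= ?).
all: repeat (case: ltnP => /= ?); repeat (case: eqP => /= ?).
all: repeat (case: ltnP => /= ?); repeat (case: eqP => /= ?).
all: try (subst; lia).
all: try by [].
all: try by (do ?congr Some; do ?congr inl; do ?congr inr; do ?congr pair; lia).
Qed.

Section RotatedIsometry.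
Context (R : realType) (c s : R).

(* The isometry V = [isoV] maps level 0 to levels 0 and 1 by c^2 + s^2 v and c s (1 - v), and
   level k >= 1 to level k + 1. [emit n] lists the only nonzero column of V^n E_00, a term
   [(a, (k, p))] meaning a v^p in level k. *)
Definition emit_step (u : nat * nat) : seq (R * (nat * nat)) :=
  if u.1 is k.+1 then [:: (1, (k.+2, u.2))] else
  [:: (c ^+ 2, (0%N, u.2)); (s ^+ 2, (0%N, u.2.+1));
      (c * s, (1%N, u.2)); (- (c * s), (1%N, u.2.+1))].

Fixpoint emit (n : nat) : seq (R * (nat * nat)) :=
  if n is n'.+1 then lbind (emit n') emit_step else [:: (1, (0%N, 0%N))].

(* V^n E_00 V*^m, so that [rot_hom] below is V^n V*^m: off level 0 this agrees with v0^n v0*^m. *)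
Definition quasi (x : nat * nat) : seq (R * levels) :=
  lbind (emit x.1) (fun u =>
    [seq (v.1, inl ((u.2, v.2.2), (u.1, v.2.1))) | v <- emit x.2]).

(** On level 0, [inr x] acts as the identity; the term with coefficient [-1] removes this, and what
    is left is V^n (1 - E_00) V*^m, to be added to [quasi x]. *)
Definition rot_hom (x : nat * nat) : seq (R * levels) :=
  quasi x ++ [:: (-1, inl ((0, 0), (0, 0))%N); (1, inr x)].

Lemma lsum_emitS (M : lmodType R) n (g : nat * nat -> M) :
  lsum (emit n.+1) g = lsum (emit n) (fun u => lsum (emit_step u) g).
Proof. exact: lsum_bind. Qed.

Lemma lsum_step (M : lmodType R) u (g : nat * nat -> M) : lsum (emit_step u) g =
  if u.1 is k.+1 then g (k.+2, u.2) else
  c ^+ 2 *: g (0, u.2)%N + s ^+ 2 *: g (0, u.2.+1)%N +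
  (c * s) *: (g (1, u.2)%N - g (1, u.2.+1)%N).
Proof.
case: u => [[|k] p]; rewrite /emit_step/= ?lsum_cons lsum_nil ?scale1r ?addr0//.
by rewrite scaleNr scalerBr !addrA.
Qed.

Lemma lsum_quasi (M : lmodType R) x (g : levels -> M) : lsum (quasi x) g =
  lsum (emit x.1) (fun u => lsum (emit x.2) (fun v => g (inl ((u.2, v.2), (u.1, v.1))))).
Proof.
by rewrite lsum_bind; apply: eq_lsum => u; rewrite /lsum big_map.
Qed.

Lemma lsum_rot_hom (M : lmodType R) x (g : levels -> M) : lsum (rot_hom x) g =
  lsum (emit x.1) (fun u => lsum (emit x.2) (fun v => g (inl ((u.2, v.2), (u.1, v.1)))))
  - g (inl ((0, 0), (0, 0))%N) + g (inr x).
Proof.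
rewrite /rot_hom lsum_cat lsum_quasi !lsum_cons lsum_nil scaleN1r scale1r addr0.
by rewrite addrA.
Qed.

Local Notation F := (nat -> nat -> R^o).

(** The shift representation of v^n v*^m on sequences, with (v f)(n) = f(n - 1) and f extended by
    zero. *)
Definition bop (x : nat * nat) (f : nat -> R^o) (n : nat) : R^o :=
  if (x.1 <= n)%N then f (n - x.1 + x.2)%N else 0.

Lemma bop_mul x y f n : bop x (bop y f) n = bop (bmul x y) f n.
Proof.
case: x y => [a b] [d e]; rewrite /bop /bmul /=.
case: (leqP a n) => an.
  case: (leqP d (n - a + b)) => h.
    by rewrite ifT; [congr f; lia|lia].
  by rewrite ifF//; lia.
by rewrite ifF//; lia.
Qed.

(** [levels] represented on all functions of a level and a position. No topology is involved: the
    representation only serves to turn multiplicativity of [rot_hom] into the relation V* V = 1. *)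
Definition opr (x : levels) (f : F) : F := fun j n =>
  match x with
  | inl (b, (k, l)) => if j == k then bop b (f l) n else 0
  | inr (p, q) => if j == 0%N then f 0%N n else
                  if (p < j)%N then f (j - p + q)%N n else 0
  end.

Lemma opr_mul x y f j n :
  opr x (opr y f) j n = if levels_mul x y is Some z then opr z f j n else 0.
Proof.
case: x => [[b [k l]]|[p q]]; case: y => [[b' [k' l']]|[p' q']] /=.
- case: (eqVneq l k') => [<-|lk] /=; case: ifP => //= _.
    by rewrite -bop_mul; congr (bop _ _ _); apply/funext => i; rewrite /opr eqxx.
  by rewrite /bop /= (negbTE lk) if_same.
- case: (eqVneq l 0%N) => [->|l0]; first by [].
  case: ltnP => ql /=; case: ifP => //= _; rewrite /bop /= (negbTE l0).
    by rewrite ql.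
  by rewrite ltnNge ql if_same.
- case: (eqVneq j 0%N) => [->|j0].
    case: (eqVneq k' 0%N) => k0 /=; first by [].
    case: ltnP => //= h; rewrite ifF//; apply/eqP; lia.
  have [pj|pj] := ltnP p j; last first.
    case: (eqVneq k' 0%N) => _; first by rewrite /= (negbTE j0).
    case: ltnP => //= h; rewrite ifF//; apply/eqP; lia.
  case: (eqVneq k' 0%N) => [->|k0]; first by rewrite /= (negbTE j0) ifF//; apply/eqP; lia.
  case: ltnP => /= h; last by rewrite ifF//; apply/eqP; lia.
  by have -> : (j - p + q == k')%N = (j == k' - q + p)%N by apply/eqP/eqP; lia.
- case: (eqVneq j 0%N) => // j0.
  case: (ltnP p j) => pj; last by rewrite ifF//; lia.
  rewrite ifF; last by apply/eqP; lia.
  case: ltnP => h; last by rewrite ifF//; lia.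
  by rewrite ifT; [congr f; lia|lia].
Qed.

Lemma lsum_if0 U L (b : bool) (g : U -> R^o) :
  lsum L (fun u => if b then g u else 0) = if b then lsum L g else 0.
Proof. by case: b => //; rewrite /lsum big1// => i _; rewrite scaler0. Qed.

Lemma opr_lsum U (L : seq (R * U)) (h : U -> F) x j n :
  opr x (fun j n => lsum L (fun u => h u j n)) j n = lsum L (fun u => opr x (h u) j n).
Proof.
case: x => [[b [k l]]|[p q]] /=; rewrite /bop.
  by rewrite !lsum_if0.
by case: ifP => //; rewrite lsum_if0.
Qed.

Definition isoV (f : F) : F := fun k n =>
  match k with
  | 0 => c ^+ 2 *: f 0%N n + s ^+ 2 *: (if n is n'.+1 then f 0%N n' else 0)
  | 1 => (c * s) *: (f 0%N n - (if n is n'.+1 then f 0%N n' else 0))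
  | k'.+2 => f k'.+1 n
  end.

Definition coisoV (f : F) : F := fun k n =>
  if k is k'.+1 then f k'.+2 n else
  c ^+ 2 *: f 0%N n + s ^+ 2 *: f 0%N n.+1 + (c * s) *: (f 1%N n - f 1%N n.+1).

Lemma iter_coisoV m f k n : iter m coisoV f k n =
  if k is k'.+1 then f (k + m)%N n else lsum (emit m) (fun v => f v.1 (n + v.2)%N).
Proof.
elim: m f k n => [|m IH] f k n.
  by case: k => [|k]; rewrite ?addn0// lsum_seq1 scale1r addn0.
rewrite iterSr IH; case: k => [|k]; last by rewrite addSn addnS.
rewrite lsum_emitS; apply: eq_lsum => -[[|k] p]; rewrite lsum_step/=; last by [].
by rewrite addnS.
Qed.

(** Under V no level above 0 returns to level 0. So the m-th power of V splits into its column on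
    level 0, listed by [emit m], and a shift by [m] of the levels above 0. *)
Lemma iter_isoV m f k n : iter m isoV f k n =
  lsum (emit m) (fun u => if k == u.1 then bop (u.2, 0%N) (f 0%N) n else 0) +
  (if (m < k)%N then f (k - m)%N n else 0).
Proof.
have bopS p g r : bop (p.+1, 0%N) g r = if r is r'.+1 then bop (p, 0%N) g r' else 0.
  by case: r => [|r]//=; rewrite /bop/= ltnS subSS.
have lif L (g : nat * nat -> nat -> R^o) r :
   (if r is r'.+1 then lsum L (fun u => g u r') else 0) =
   lsum L (fun u => if r is r'.+1 then g u r' else 0).
  by case: r => [|r]//; rewrite /lsum big1// => i _; rewrite scaler0.
elim: m k n => [|m IH] k n.
  rewrite lsum_seq1 scale1r/= subn0; case: k => [|k] /=; last by rewrite add0r.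
  by rewrite /bop/= subn0 addn0 addr0.
rewrite iterS lsum_emitS.
case: k => [|[|k]].
- rewrite ltn0 addr0 /isoV IH ltn0 addr0.
  transitivity (c ^+ 2 *: lsum (emit m) (fun u => if 0%N == u.1 then bop (u.2, 0%N) (f 0%N) n else 0)
    + s ^+ 2 *: lsum (emit m) (fun u => if n is n'.+1 then if 0%N == u.1 then bop (u.2, 0%N) (f 0%N) n' else 0 else 0)).
    by rewrite -lif; case: n => //= n; rewrite IH ltn0 addr0.
  rewrite -!lsumZ -lsumD; apply: eq_lsum => -[[|k] p]; rewrite lsum_step/=.
    by rewrite subrr scaler0 addr0 bopS.
  by case: n => [|n]; rewrite !scaler0 addr0.
- rewrite /isoV IH ltn0 addr0.
  transitivity ((c * s) *: (lsum (emit m) (fun u => if 0%N == u.1 then bop (u.2, 0%N) (f 0%N) n else 0)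
    - lsum (emit m) (fun u => if n is n'.+1 then if 0%N == u.1 then bop (u.2, 0%N) (f 0%N) n' else 0 else 0))).
    by rewrite -lif; case: n => //= n; rewrite IH ltn0 addr0.
  rewrite ltnS ltn0 addr0 -lsumN -lsumD -lsumZ; apply: eq_lsum => -[[|k] p]; rewrite lsum_step/=.
    by rewrite !scaler0 !add0r bopS.
  by case: n => [|n]; rewrite subr0 scaler0.
- rewrite /isoV IH ltnS subSS; congr (_ + _); apply: eq_lsum => -[[|j] p]; rewrite lsum_step//=.
  by rewrite !scaler0 subrr scaler0 !addr0.
Qed.

Lemma rot_hom_opr x f k n :
  lsum (rot_hom x) (fun u => opr u f k n) = iter x.1 isoV (iter x.2 coisoV f) k n.
Proof.
rewrite lsum_rot_hom iter_isoV -addrA; congr (_ + _).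
  apply: eq_lsum => u; rewrite /= lsum_if0; case: eqP => // _.
  by rewrite /bop/= lsum_if0; case: ifP => // _; rewrite iter_coisoV addn0.
case: x => [p q] /=; rewrite /bop/= subn0 addn0.
case: k => [|k] /=; first by rewrite addNr.
rewrite oppr0 add0r iter_coisoV; case: ltnP => // pk.
by case E: (k.+1 - p)%N => [|d]//; lia.
Qed.

Context (cs1 : c ^+ 2 + s ^+ 2 = 1).

Lemma isoVK f k n : coisoV (isoV f) k n = f k n.
Proof.
case: k => [|k] //=; rewrite /GRing.scale/=.
(* On level 0 the multiples of v and v* coming from the two entries of the column cancel and leave
   c^4 + s^4 + 2 c^2 s^2; the coefficient 1 is therefore written as the square of
   [c ^+ 2 + s ^+ 2]. *)
rewrite -[RHS]mul1r -(expr1n _ 2) -cs1; case: n => [|n]; ring.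
Qed.

Lemma iter_isoVK m p f : iter m coisoV (iter p isoV f) = iter (p - m) isoV (iter (m - p) coisoV f).
Proof.
elim: m p f => [|m IH] p f; first by rewrite subn0 sub0n.
case: p => [|p]; first by rewrite sub0n subn0.
rewrite !subSS -IH iterSr iterS; congr (iter m coisoV _).
by apply/funext => k; apply/funext => n; exact: isoVK.
Qed.

Lemma rot_hom_mul_opr x y f k n :
  lsum (rot_hom x) (fun u => opr u (fun k n => lsum (rot_hom y) (fun v => opr v f k n)) k n) =
  lsum (rot_hom (bmul x y)) (fun u => opr u f k n).
Proof.
rewrite rot_hom_opr (_ : (fun _ _ => _) = iter y.1 isoV (iter y.2 coisoV f)).
  by rewrite rot_hom_opr iter_isoVK -!iterD /bmul/= [(y.2 + _)%N]addnC.
by apply/funext => i; apply/funext => p; exact: rot_hom_opr.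
Qed.

Definition levels_prod (L L' : seq (R * levels)) : seq (R * levels) :=
  lbind L (fun u => lbind L' (fun v => if levels_mul u v is Some z then [:: (1, z)] else [::])).

Lemma lsum_levels_prod (M : lmodType R) L L' (g : levels -> M) : lsum (levels_prod L L') g =
  lsum L (fun u => lsum L' (fun v => if levels_mul u v is Some z then g z else 0)).
Proof.
rewrite lsum_bind; apply: eq_lsum => u; rewrite lsum_bind; apply: eq_lsum => v.
by case: levels_mul => [z|]; rewrite ?lsum_nil// lsum_seq1 scale1r.
Qed.

Definition inr_part (h : nat * nat -> R^o) (u : levels) : R^o :=
  if u is inr x then h x else 0.

Lemma lsum_zero U L (g : U -> R^o) : (forall u, g u = 0) -> lsum L g = 0.
Proof. by move=> h; rewrite /lsum big1// => i _; rewrite h scaler0. Qed.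

Lemma rot_hom_inr x h : lsum (rot_hom x) (inr_part h) = h x.
Proof. by rewrite lsum_rot_hom/= subr0 lsum_zero ?add0r// => u; rewrite lsum_zero. Qed.

(** The [inl] elements span an ideal, and modulo it [rot_hom x] is [inr x], whose products are those
    of the bicyclic monoid. *)
Lemma levels_prod_inr x y h :
  lsum (levels_prod (rot_hom x) (rot_hom y)) (inr_part h) = h (bmul x y).
Proof.
rewrite lsum_levels_prod -[RHS](rot_hom_inr x (fun x => h (bmul x y))).
apply: eq_lsum => -[[b [k l]]|z] /=.
  apply: lsum_zero => -[[b' [k' l']]|[n m]] /=; first by case: ifP.
  by case: ifP => //; case: ifP.
rewrite -(rot_hom_inr y (fun y => h (bmul z y))); apply: eq_lsum.
move=> [[b' [k' l']]|[n m]] /=; case: z => [p q] //=.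
by case: ifP => //; case: ifP.
Qed.

Definition delta2 (k q : nat) : F := fun k' q' => ((k' == k) && (q' == q))%:R.

(* The matrix of b_{pq} is constant along a diagonal from entry (p, q) on and zero before, so
   differencing along the diagonal recovers coefficients. *)
Lemma coef_inl p q j k u : (u == inl ((p, q), (j, k)))%:R =
  opr u (delta2 k q) j p
  - (if p is p'.+1 then if q is q'.+1 then opr u (delta2 k q') j p' else 0 else 0)
  - inr_part (fun z => opr (inr z) (delta2 k q) j p
     - (if p is p'.+1 then if q is q'.+1 then opr (inr z) (delta2 k q') j p' else 0 else 0)) u :> R^o.
Proof.
case: u => [[[a b] [j' k']]|z]; last by rewrite /inr_part subrr.
rewrite [X in _ - X]/= subr0.
have -> : (inl ((a, b), (j', k')) == inl ((p, q), (j, k)) :> levels) =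
   [&& a == p, b == q, j' == j & k' == k].
  by apply/eqP/and4P => [[-> -> -> ->]|[/eqP-> /eqP-> /eqP-> /eqP->]]; rewrite ?eqxx.
rewrite /= /bop /delta2 /= [j == j']eq_sym.
case: (j' == j); last by rewrite !andbF; case: p => [|p]; case: q => [|q]; rewrite subr0.
case: (k' == k); last first.
  by rewrite /= !andbF !if_same; case: p => [|p]; case: q => [|q]; rewrite ?if_same subr0.
rewrite !andbT /=.
case: p => [|p]; case: q => [|q]; rewrite ?subr0.
- by rewrite leqn0; case: eqVneq => [->|].
- by rewrite leqn0; case: eqVneq => [->|].
- case: leqP => h; last by have -> : (a == p.+1) = false by lia.
  by congr (_%:R); congr nat_of_bool; lia.
have [h|h] := leqP a p.
  have -> : (a == p.+1) = false by lia.
  rewrite leqW//; have -> : (p.+1 - a + b == q.+1)%N = (p - a + b == q)%N by lia.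
  by rewrite subrr.
rewrite subr0; case: eqVneq => [->|ap]; first by rewrite leqnn subnn.
by rewrite ifF//; lia.
Qed.

(** Both sides act by the same operator, so the task is to recover coefficients. Those of [inr]
    elements are read off modulo the ideal; once they agree, [coef_inl] extracts the remaining ones
    from the operators. *)
Lemma rot_hom_mul (M : lmodType R) x y (g : levels -> M) :
  lsum (levels_prod (rot_hom x) (rot_hom y)) g = lsum (rot_hom (bmul x y)) g.
Proof.
have op f k n : lsum (levels_prod (rot_hom x) (rot_hom y)) (fun u => opr u f k n) =
    lsum (rot_hom (bmul x y)) (fun u => opr u f k n).
  rewrite lsum_levels_prod -rot_hom_mul_opr; apply: eq_lsum => u.
  by rewrite opr_lsum; apply: eq_lsum => v; rewrite opr_mul.
apply: lsum_ext => -[[[p q] [j k]]|z]; rewrite /lcoef.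
  under eq_lsum do rewrite coef_inl.
  under [RHS]eq_lsum do rewrite coef_inl.
  rewrite !lsumD !lsumN !op levels_prod_inr rot_hom_inr; congr (_ - _ - _).
  by case: p => [|p]; [rewrite !lsum_zero|case: q => [|q]; [rewrite !lsum_zero|rewrite op]].
have e : forall u : levels, (u == inr z)%:R = inr_part (fun x => (x == z)%:R) u :> R^o by case.
under eq_lsum do rewrite e; under [RHS]eq_lsum do rewrite e.
by rewrite levels_prod_inr rot_hom_inr.
Qed.

End RotatedIsometry.

(** * Polynomial bounds for the rotated isometry and continuity in the angle *)

Definition labs (R : realType) U (L : seq (R * U)) : seq (R * U) :=
  [seq (`|cu.1|, cu.2) | cu <- L].

Lemma labs_bind (R : realType) U U' (L : seq (R * U)) (f : U -> seq (R * U')) :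
  labs (lbind L f) = lbind (labs L) (fun u => labs (f u)).
Proof.
rewrite /labs /lbind map_flatten -!map_comp; congr flatten; apply: eq_map => cu /=.
by rewrite -!map_comp; apply: eq_map => dv /=; rewrite normrM.
Qed.

Lemma lsum_labs (R : realType) U (L : seq (R * U)) (g : U -> R^o) :
  lsum (labs L) g = \sum_(cu <- L) `|cu.1| * g cu.2.
Proof. by rewrite /lsum big_map. Qed.

Lemma sum_norm_labs (R : realType) U (L : seq (R * U)) :
  \sum_(cu <- L) `|cu.1| = lsum (labs L) (fun=> 1 : R^o).
Proof. by rewrite lsum_labs; apply: eq_bigr => i _; rewrite mulr1. Qed.

Lemma mem_lbind (R : realType) (U U' : eqType) (L : seq (R * U)) (f : U -> seq (R * U')) dv :
  dv \in lbind L f -> exists2 cu, cu \in L & exists2 dv', dv' \in f cu.2 & dv.2 = dv'.2.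
Proof.
by move=> /flatten_mapP[cu cuL /mapP[dv' dvf ->]]; exists cu => //; exists dv'.
Qed.

Definition levels_abs (u : levels) : nat :=
  match u with
  | inl ((p, q), (k, l)) => p + q + k + l
  | inr (n, m) => n + m
  end%N.

Lemma levels_mul_abs u v z : levels_mul u v = Some z ->
  (levels_abs z <= levels_abs u + levels_abs v)%N.
Proof.
case: u => [[[b1 b2] [k l]]|[n m]]; case: v => [[[b1' b2'] [k' l']]|[n' m']] /=.
- by case: ifP => // /eqP lk [<-]; rewrite /bmul/=; lia.
- by case: ifP => _; [case=> <- /=; lia|case: ifP => // h [<-] /=; lia].
- by case: ifP => _; [case=> <- /=; lia|case: ifP => // h [<-] /=; lia].
- by move=> [<-]; rewrite /bmul/=; lia.
Qed.

Section EmitBounds.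
Context (R : realType).
Implicit Types (c s : R).

Lemma emit_mem c s n cu : cu \in emit c s n -> (cu.2.1 <= n)%N /\ (cu.2.2 <= n)%N.
Proof.
elim: n cu => [|n IH] cu /=; first by rewrite inE => /eqP ->.
move=> /mem_lbind[[d [k p]] /IH[/= kn pn] [dv dvs ->]].
case: k kn dvs => [|k] kn; rewrite /emit_step/= !inE.
  by move=> /or4P[] /eqP ->; split=> /=; lia.
by move=> /eqP-> /=; lia.
Qed.

Lemma rot_hom_mem c s x cu : cu \in rot_hom c s x ->
  (levels_abs cu.2 <= 2 * (1 + (x.1 + x.2)) ^ 1)%N.
Proof.
case: x => n m; rewrite mem_cat expn1 => /orP[|].
  move=> /mem_lbind[[d [k p]] /emit_mem[/= h1 h2] [dv + ->]].
  by move=> /mapP[[d' [k' p']] /emit_mem[/= h3 h4] ->] /=; lia.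
by rewrite !inE => /orP[] /eqP -> /=; lia.
Qed.

Context c s (cs1 : c ^+ 2 + s ^+ 2 = 1).

Lemma norm_cos_le1 : `|c| <= 1 /\ `|s| <= 1.
Proof.
have c2 := sqr_ge0 c; have s2 := sqr_ge0 s; have h := cs1; rewrite !expr2 in c2 s2 h.
by split; rewrite ler_norml; apply/andP; split; nra.
Qed.

(** Level 0 is fed only from itself, with the nonnegative weights [c ^+ 2] and [s ^+ 2] of sum 1, so
    taking absolute values does not increase the mass there. *)
Lemma emit_mass0 n : lsum (labs (emit c s n)) (fun u => (u.1 == 0%N)%:R : R^o) = 1.
Proof.
elim: n => [|n IH]; first by rewrite /labs/= lsum_seq1 normr1 scale1r.
rewrite /= labs_bind lsum_bind -[RHS]IH; apply: eq_lsum => -[[|k] p]; rewrite /labs /emit_step/= !lsum_cons lsum_nil/=.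
  rewrite !scaler0 !addr0 !ger0_norm ?sqr_ge0// -[RHS]cs1.
  by rewrite /GRing.scale/= !mulr1.
by rewrite scaler0 addr0.
Qed.

(** Only terms on level 0 branch, and their mass stays 1. Each step thus adds at most 2|cs| to the
    norm instead of multiplying it, and the growth is linear. *)
Lemma emit_norm n : \sum_(cu <- emit c s n) `|cu.1| <= 1 + 2 * n%:R.
Proof.
have [c1 s1] := norm_cos_le1.
rewrite sum_norm_labs; elim: n => [|n IH].
  by rewrite /labs/= lsum_seq1 normr1 scale1r mulr0 addr0.
rewrite /= labs_bind lsum_bind.
apply: (@le_trans _ _ (lsum (labs (emit c s n)) (fun u => 1 + 2 * (u.1 == 0%N)%:R : R^o))).
  rewrite !lsum_labs; apply: ler_sum => -[d [[|k] p]] _; rewrite ler_wpM2l//= /emit_step/= /labs/= !lsum_cons lsum_nil.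
    rewrite /GRing.scale/= !mulr1 addr0 normrN (@ger0_norm _ (c ^+ 2)) ?sqr_ge0//.
    rewrite (@ger0_norm _ (s ^+ 2)) ?sqr_ge0// normrM; have h := cs1.
    have : `|c| * `|s| <= 1 by rewrite mulr_ile1.
    lra.
  by rewrite normr1 scale1r mulr0.
rewrite lsumD (lsumZ _ (2 : R)) emit_mass0 -natr1 /GRing.scale/=; lra.
Qed.

Lemma rot_hom_norm x : \sum_(cu <- rot_hom c s x) `|cu.1| <=
  6 * ((1 + (x.1 + x.2)) ^ 2)%N%:R.
Proof.
case: x => [n m]; rewrite big_cat !big_cons big_nil /= normrN !normr1 addr0.
have -> : \sum_(cu <- quasi c s (n, m)) `|cu.1| =
    (\sum_(cu <- emit c s n) `|cu.1|) * (\sum_(cu <- emit c s m) `|cu.1|).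
  rewrite sum_norm_labs /quasi labs_bind lsum_bind lsum_labs mulr_suml.
  apply: eq_bigr => cu _; congr (_ * _).
  rewrite /labs -map_comp /lsum big_map; apply: eq_bigr => i _.
  by rewrite /= [_ *: _]mulr1.
have h1 := emit_norm n; have h2 := emit_norm m.
have g0 k : 0 <= \sum_(cu <- emit c s k) `|cu.1| by apply: sumr_ge0.
apply: (@le_trans _ _ ((1 + 2 * n%:R) * (1 + 2 * m%:R) + (1 + 1))).
  by rewrite lerD2r ler_pM.
have : 0 <= n%:R :> R by []. have : 0 <= m%:R :> R by [].
rewrite natrX natrD natrD; nra.
Qed.

(** Forgetting the power of v means setting v = 1, where the column (c^2 + s^2 v, cs(1 - v)) becomes
    (1, 0) whatever the angle. This is what keeps the path pointed. *)
Lemma lsum_emit_level (M : lmodType R) n (g : nat -> M) :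
  lsum (emit c s n) (fun u => g u.1) = g 0%N.
Proof.
elim: n g => [|n IH] g; first by rewrite lsum_seq1 scale1r.
rewrite lsum_emitS -(IH (fun k => if k is k'.+1 then g k'.+2 else g 0%N)).
apply: eq_lsum => -[[|k] p]; rewrite lsum_step//=.
by rewrite subrr scaler0 addr0 -scalerDl cs1 scale1r.
Qed.

End EmitBounds.

Lemma lsum_emit10 (R : realType) (M : lmodType R) n (g : nat * nat -> M) :
  lsum (emit 1 0 n) g = g (0%N, 0%N).
Proof.
elim: n g => [|n IH] g; first by rewrite lsum_seq1 scale1r.
rewrite lsum_emitS IH lsum_step/= mul1r expr1n scale1r expr0n/= !scale0r.
by rewrite !addr0.
Qed.

Lemma lsum_emit01 (R : realType) (M : lmodType R) n (g : nat * nat -> M) :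
  lsum (emit 0 1 n) g = g (0%N, n).
Proof.
elim: n g => [|n IH] g; first by rewrite lsum_seq1 scale1r.
rewrite lsum_emitS IH lsum_step/= mul0r expr1n scale1r expr0n/= !scale0r.
by rewrite addr0 add0r.
Qed.

Section EmitContinuous.
Context (R : realType) (Y : topologicalType) (V : tvsType R) (c s : Y -> R).
Context (cc : continuous c) (cs : continuous s).

(** [g] may depend on [y], since the induction replaces it by its sum over one step, whose
    coefficients vary with the angle; this also allows one such sum to be nested in another. *)
Lemma continuous_lsum_emit n (g : Y -> nat * nat -> V) :
  (forall u, continuous (fun y => g y u)) ->
  continuous (fun y => lsum (emit (c y) (s y) n) (g y)).
Proof.
elim: n g => [|n IH] g cg.
  rewrite [X in continuous X](_ : _ = g ^~ (0%N, 0%N)); first exact: cg.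
  by apply/funext => y; rewrite lsum_seq1 scale1r.
rewrite [X in continuous X](_ : _ =
    fun y => lsum (emit (c y) (s y) n) (fun u => lsum (emit_step (c y) (s y) u) (g y))); last first.
  by apply/funext => y; rewrite lsum_emitS.
apply: IH => -[[|k] p]; under [X in continuous X]eq_fun do rewrite lsum_step/=; last exact: cg.
have cX (f : Y -> R) : continuous f -> continuous (fun y => f y ^+ 2).
  move=> cf; rewrite [X in continuous X](_ : _ = (fun y => f y * f y)).
    by move=> y; apply: cvgM; exact: cf.
  by apply/funext => y; rewrite expr2.
have cM : continuous (fun y => c y * s y) by move=> y; apply: cvgM; [exact: cc|exact: cs].
apply: continuousD_tvs; first by apply: continuousD_tvs; apply: continuousZ_tvs; do ?exact: cX.
by apply: continuousZ_tvs => //; apply: continuousD_tvs => //; exact: continuousN_tvs.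
Qed.

Lemma continuous_rot_hom x (g : levels -> V) :
  continuous (fun y => lsum (rot_hom (c y) (s y) x) g).
Proof.
under [X in continuous X]eq_fun do rewrite lsum_rot_hom.
apply: continuousD_tvs; last by move=> y; exact: cvg_cst.
apply: continuousD_tvs; last by move=> y; exact: cvg_cst.
by apply: continuous_lsum_emit => u; apply: continuous_lsum_emit => v y; exact: cvg_cst.
Qed.

End EmitContinuous.

Lemma bilincont_lsum (R : realType) (V W Z : tvsType R) (f : V -> W -> Z) U U'
    (L : seq (R * U)) (L' : seq (R * U')) (g : U -> V) (g' : U' -> W) : bilincont f ->
  f (lsum L g) (lsum L' g') = lsum L (fun u => lsum L' (fun v => f (g u) (g' v))).
Proof.
move=> hf; rewrite (lincont_lsum _ _ (bilincont_l hf _)); apply: eq_lsum => u.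
exact: (lincont_lsum _ _ (bilincont_r hf _)).
Qed.

Lemma lsum_if (R : realType) U (M : lmodType R) (L : seq (R * U)) (b : bool) (g : U -> M) :
  lsum L (fun u => if b then g u else 0) = if b then lsum L g else 0.
Proof. by case: b => //; rewrite /lsum big1// => i _; rewrite scaler0. Qed.

Lemma lsum_0 (R : realType) U (M : lmodType R) (L : seq (R * U)) (g : U -> M) :
  (forall u, g u = 0) -> lsum L g = 0.
Proof. by move=> h; rewrite /lsum big1// => i _; rewrite h scaler0. Qed.

Lemma kernel_bound_poly (R : realType) (T U : choiceType) (a : T -> nat) (b : U -> nat)
    (K : T -> seq (R * U)) (C : R) (c D d : nat) : 0 <= C ->
  (forall t, \sum_(cu <- K t) `|cu.1| <= C * ((1 + a t) ^ c)%:R) ->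
  (forall t cu, cu \in K t -> (b cu.2 <= D * (1 + a t) ^ d)%N) ->
  kernel_bound (wabs a) (wabs b) K.
Proof.
move=> C0 h1 h2 j'.
have [B [j [B0 h]]] := @kernel_poly R unit T U a b (fun=> K) C c D d C0 (fun=> h1) (fun=> h2) j'.
by exists B, j; split=> // t; exact: h tt t.
Qed.

(** * Convolution algebras of semigroups with zero *)

Section PartialConvolution.
Context (R : realType) (S : tvsAlgebra R) (hS : is_lcalgebra S).
Context (T T' T'' : choiceType) (a : T -> nat) (a' : T' -> nat) (a'' : T'' -> nat).
Context (cT : countable [set: T]) (cT' : countable [set: T']) (cT'' : countable [set: T'']).
Context (m : T -> T' -> option T'').
Context (hm : forall t t' u, m t t' = Some u -> (a'' u <= a t + a' t')%N).

(** [None] plays the zero of the semigroup. Subadditive sizes make the weights submultiplicative,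
    which is all that continuity of the product takes from [m]. *)
Definition pconv : rapid S (wabs a) -> rapid S (wabs a') -> rapid S (wabs a'') :=
  bipush (fun t t' s s' =>
    if m t t' is Some u then single (wabs a'') u (tva_mul s s') else 0).

Let pb : bipushable (wabs a) (wabs a') (fun t t' (s s' : S) =>
    if m t t' is Some u then single (wabs a'') u (tva_mul s s') else 0).
Proof.
split.
- move=> t t' s s1 s'; case: m => [u|]; last by rewrite addr0.
  by rewrite (lca_mulDl hS) singleD.
- move=> t t' s s' s1; case: m => [u|]; last by rewrite addr0.
  by rewrite (lca_mulDr hS) singleD.
- move=> t t' c s s'; case: m => [u|]; last by rewrite scaler0.
  by rewrite (lca_mulZl hS) singleZ.
- move=> t t' c s s'; case: m => [u|]; last by rewrite scaler0.
  by rewrite (lca_mulZr hS) singleZ.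
move=> P; have [[k p] hP] := rapid_csn_dom (good_wabs a'' cT'') P.
have [q [q' hq]] := bilincont_bound (lcalgebra_bilincont hS) p.
exists (k, q), (k, q') => t t' s s' /=.
case E: m => [u|]; last by rewrite csn0 !mulr_ge0 ?csn_ge0.
apply: le_trans (hP _) _; apply: le_trans (rapid_norm_single _ _ _ _) _ => /=.
rewrite mulrACA; apply: ler_pM; rewrite ?csn_ge0//.
rewrite -natrM ler_nat /wabs -expnMn; apply: leq_exp_base.
have := hm E; nia.
Qed.

Lemma pconv_bilincont : bilincont pconv.
Proof.
apply: bipush_bilincont => //; try exact: good_wabs.
exact/rapid_complete/lcalgebra_complete/hS/good_wabs.
Qed.

Lemma pconv_single t t' s s' :
  pconv (single (wabs a) t s) (single (wabs a') t' s') =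
  if m t t' is Some u then single (wabs a'') u (tva_mul s s') else 0.
Proof.
rewrite /pconv bipush_single//; try exact: good_wabs.
exact/rapid_complete/lcalgebra_complete/hS/good_wabs.
Qed.

End PartialConvolution.

Section PartialSemigroupAlgebra.
Context (R : realType) (S : tvsAlgebra R) (hS : is_lcalgebra S).
Context (T : choiceType) (a : T -> nat) (cT : countable [set: T]) (m : T -> T -> option T).
Context (hm : forall t t' u, m t t' = Some u -> (a u <= a t + a t')%N).
Context (mA : forall x y z, olift m (m x y) (Some z) = olift m (Some x) (m y z)).
Local Notation conv := (@pconv R S T T T a a a m).

Lemma pconvA x y z : conv (conv x y) z = conv x (conv y z).
Proof.
have gw := good_wabs a cT.
have hT : hausdorff_space (rapid S (wabs a)).
  by apply: rapid_hausdorff => //; exact: lca_hausdorff.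
have bc : bilincont conv by exact: pconv_bilincont.
have l0 := fun y => lincont0 (bilincont_l bc y).
have r0 := fun x => lincont0 (bilincont_r bc x).
move: x y; apply: (biext gw gw hT).
- exact: bilincont_post bc (bilincont_l bc z).
- exact: (bilincont_pre bc (lincont_id _) (bilincont_l bc z)).
move=> t t' s s'; move: z; apply: (rapid_ext gw hT).
- exact: bilincont_r.
- exact: lincont_comp (bilincont_r bc _) (bilincont_r bc _).
move=> t'' s''; rewrite !pconv_single//.
have := mA t t' t''; case: (m t t') => [u|]; case: (m t' t'') => [v|] /=.
- by rewrite !pconv_single// => ->; rewrite (lca_mulA hS).
- by rewrite pconv_single// r0 => ->.
- by rewrite pconv_single// l0 => <-.
- by rewrite l0 r0.
Qed.

End PartialSemigroupAlgebra.

(** * Homotopies between endomorphisms of the stable bicyclic algebra *)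

Definition zcode (i : int) : nat := (2 * absz i + (i < 0)%R)%N.

Lemma zcode_inj : injective zcode.
Proof. by move=> i j; rewrite /zcode; case: i => i; case: j => j /= h; lia. Qed.

(* An injection of N x Z into Z of polynomial growth; level 0 goes to the even numbers by
   doubling, so that it can be reached from the identity by rotations. *)
Definition spread (k : nat) (i : int) : int :=
  if k is k'.+1 then Posz (((k + zcode i) ^ 2 + zcode i) * 2 + 1)%N else i + i.

(** Values are even on level 0 and odd elsewhere. On the other levels N^2 + x with x <= N lies below
    (N + 1)^2, so it determines N = k + [zcode i] and x = [zcode i]. *)
Lemma spread_inj k i l j : (spread k i == spread l j) = (k == l) && (i == j).
Proof.
apply/idP/andP => [/eqP|[/eqP-> /eqP->]//].
case: k => [|k]; case: l => [|l]; rewrite /spread.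
- by move=> h; split=> //; apply/eqP; lia.
- by set e := (_ ^ 2)%N => h; exfalso; lia.
- by set e := (_ ^ 2)%N => h; exfalso; lia.
move=> [] h.
have {h} : ((k.+1 + zcode i) ^ 2 + zcode i = (l.+1 + zcode j) ^ 2 + zcode j)%N by lia.
set x := zcode i; set y := zcode j; rewrite -!mulnn => h.
have e : (k.+1 + x = l.+1 + y)%N by nia.
have xy : x = y by nia.
by rewrite (zcode_inj xy) eqxx; split=> //; apply/eqP; lia.
Qed.

Lemma spread_abs k i : (absz (spread k i) <= 20 * (1 + (k + absz i)) ^ 2)%N.
Proof.
rewrite /spread -mulnn; case: k => [|k]; first by nia.
rewrite -mulnn /zcode; have : ((i < 0)%R <= 1)%N by case: (i < 0)%R.
move: (nat_of_bool _) => b; move: (absz i) => x /=; nia.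
Qed.

(* [idx0] indexes the elements v^n v*^m (x) E_ij, [idx1] the elements of [levels] tensored
   with E_ij. *)
Definition idx0 : choiceType := ((nat * nat) * (int * int))%type.
Definition idx1 : choiceType := (levels * (int * int))%type.

Lemma countable_idx0 : countable [set: idx0]. Proof. exact: countableP. Qed.
Lemma countable_idx1 : countable [set: idx1]. Proof. exact: countableP. Qed.

Definition abs0 (t : idx0) : nat := (t.1.1 + t.1.2 + (absz t.2.1 + absz t.2.2))%N.
Definition abs1 (t : idx1) : nat := (levels_abs t.1 + (absz t.2.1 + absz t.2.2))%N.

Definition mul0 (t u : idx0) : option idx0 :=
  if t.2.2 == u.2.1 then Some (bmul t.1 u.1, (t.2.1, u.2.2)) else None.
Definition mul1 (t u : idx1) : option idx1 :=
  if t.2.2 == u.2.1 then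
    if levels_mul t.1 u.1 is Some z then Some (z, (t.2.1, u.2.2)) else None
  else None.

Lemma mul0_abs t u v : mul0 t u = Some v -> (abs0 v <= abs0 t + abs0 u)%N.
Proof. by rewrite /mul0; case: ifP => // _ [<-]; rewrite /abs0 /bmul/=; lia. Qed.

Lemma mul1_abs t u v : mul1 t u = Some v -> (abs1 v <= abs1 t + abs1 u)%N.
Proof.
rewrite /mul1; case: ifP => // _; case E: levels_mul => [z|]// [<-].
by have := levels_mul_abs E; rewrite /abs1/=; lia.
Qed.

Lemma mul1A x y z : olift mul1 (mul1 x y) (Some z) = olift mul1 (Some x) (mul1 y z).
Proof.
case: x => x [i i']; case: y => y [j j']; case: z => z [k k'].
have := levels_mulA x y z; rewrite /mul1/=.
case E1: (i' == j); case E2: (j' == k); case: (levels_mul x y) => [u|];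
  case: (levels_mul y z) => [v|] //= h; rewrite ?E1 ?E2 ?h //.
by rewrite -h.
Qed.

(** * Rotation angles and the kernels of both homotopies *)

Section RotationFunctions.
Context (R : realType).

Definition clamp01 (y : R) : R := Num.max 0 (Num.min 1 y).
Definition rotc (y : R) : R := cos (pi / 2 * clamp01 y).
Definition rots (y : R) : R := sin (pi / 2 * clamp01 y).

Lemma rot_sq y : rotc y ^+ 2 + rots y ^+ 2 = 1. Proof. exact: cos2Dsin2. Qed.

Lemma clamp01_le0 y : y <= 0 -> clamp01 y = 0.
Proof.
move=> y0; rewrite /clamp01 min_r ?(le_trans y0)// max_l//.
Qed.

Lemma clamp01_ge1 y : 1 <= y -> clamp01 y = 1.
Proof. by move=> y1; rewrite /clamp01 min_l// max_r. Qed.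

Lemma rotc_le0 y : y <= 0 -> rotc y = 1.
Proof. by move=> /clamp01_le0 h; rewrite /rotc h mulr0 cos0. Qed.
Lemma rots_le0 y : y <= 0 -> rots y = 0.
Proof. by move=> /clamp01_le0 h; rewrite /rots h mulr0 sin0. Qed.
Lemma rotc_ge1 y : 1 <= y -> rotc y = 0.
Proof. by move=> /clamp01_ge1 h; rewrite /rotc h mulr1 cos_pihalf. Qed.
Lemma rots_ge1 y : 1 <= y -> rots y = 1.
Proof. by move=> /clamp01_ge1 h; rewrite /rots h mulr1 sin_pihalf. Qed.

Lemma continuous_clamp01 : continuous clamp01.
Proof.
move=> y; apply: continuous_max; first exact: cvg_cst.
by apply: continuous_min; [exact: cvg_cst|exact: cvg_id].
Qed.

Lemma continuous_angle : continuous (fun y => pi / 2 * clamp01 y).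
Proof. by move=> y; apply: cvgM; [exact: cvg_cst|exact: continuous_clamp01]. Qed.

Lemma continuous_rotc : continuous rotc.
Proof.
by move=> y; apply: (continuous_comp (@continuous_angle y)); exact: continuous_cos.
Qed.

Lemma continuous_rots : continuous rots.
Proof.
by move=> y; apply: (continuous_comp (@continuous_angle y)); exact: continuous_sin.
Qed.

End RotationFunctions.

Section Kernels.
Context (R : realType).

Definition psiK (t : idx0) : seq (R * idx1) := [:: (1, (inr t.1, t.2) : idx1)].
Definition rotK (c s : R) (t : idx0) : seq (R * idx1) :=
  [seq (v.1, (v.2, t.2) : idx1) | v <- rot_hom c s t.1].
(** Turns a matrix over levels into a single element by relabelling rows and columns with [spread].
    Elements [inr] stand for matrices that are not rapidly decreasing and are sent to 0. *)
Definition compK (t : idx1) : seq (R * idx0) :=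
  if t.1 is inl (b, (k, l)) then
    [:: (1, (b, (spread k t.2.1, spread l t.2.2)) : idx0)] else [::].
Definition epsK (t : idx0) : seq (R * idx0) := [:: (1, ((0%N, 0%N), t.2) : idx0)].
Definition dblK (t : idx0) : seq (R * idx0) :=
  [:: (1, (t.1, (spread 0 t.2.1, spread 0 t.2.2)) : idx0)].
Definition partK (b : bool) (t : idx1) : seq (R * idx1) :=
  if (if t.1 is inl _ then true else false) == b then [:: (1, t)] else [::].
(** The clamped angle starts e_i moving at y = 1/|i| and brings it to e_{2i} at y = 2/|i|. Near y =
    0 only large |i| move, and at y = 2 every rotation is complete; e_0 stays in place, which agrees
    with 2 * 0 = 0. *)
Definition rotv (y : R) (i : int) : seq (R * int) :=
  [:: (rotc ((absz i)%:R * y - 1), i); (rots ((absz i)%:R * y - 1), spread 0 i)].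
(** Conjugation by the isometry with columns [rotv y i], acting on both matrix indices. *)
Definition adK (y : R) (t : idx0) : seq (R * idx0) :=
  lbind (rotv y t.2.1) (fun i => [seq (v.1, (t.1, (i, v.2)) : idx0) | v <- rotv y t.2.2]).

Lemma psiK_bound : kernel_bound (wabs abs0) (wabs abs1) psiK.
Proof.
apply: (@kernel_bound_poly _ _ _ _ _ _ 1 0 1 1) => // -[[n m] [i j]].
  by rewrite big_seq1 normr1 mul1r expn0.
by move=> cu; rewrite inE => /eqP->; rewrite /abs1 /abs0/= expn1; lia.
Qed.

Lemma compK_bound : kernel_bound (wabs abs1) (wabs abs0) compK.
Proof.
apply: (@kernel_bound_poly _ _ _ _ _ _ 1 0 41 2) => // -[[[b [k l]]|z] [i j]].
- by rewrite big_seq1 normr1 mul1r expn0.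
- by rewrite big_nil mul1r expn0 ler01.
- move=> cu; rewrite inE => /eqP->; rewrite /abs1 /abs0/=; case: b => p q.
  have := spread_abs k i; have := spread_abs l j; rewrite /= -!mulnn.
  move: (absz (spread _ _)) (absz (spread _ _)) (absz i) (absz j) => u v x y; nia.
- by [].
Qed.

Lemma epsK_bound : kernel_bound (wabs abs0) (wabs abs0) epsK.
Proof.
apply: (@kernel_bound_poly _ _ _ _ _ _ 1 0 1 1) => // -[[n m] [i j]].
  by rewrite big_seq1 normr1 mul1r expn0.
by move=> cu; rewrite inE => /eqP->; rewrite /abs0/= expn1; lia.
Qed.

Lemma dblK_bound : kernel_bound (wabs abs0) (wabs abs0) dblK.
Proof.
apply: (@kernel_bound_poly _ _ _ _ _ _ 1 0 2 1) => // -[[n m] [i j]].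
  by rewrite big_seq1 normr1 mul1r expn0.
by move=> cu; rewrite inE => /eqP->; rewrite /abs0/= expn1; lia.
Qed.

Lemma partK_bound b : kernel_bound (wabs abs1) (wabs abs1) (partK b).
Proof.
apply: (@kernel_bound_poly _ _ _ _ _ _ 1 0 1 1) => // t; rewrite /partK.
  by case: ifP => _; rewrite ?big_nil ?big_seq1 ?normr1 mul1r expn0.
by case: ifP => // _ cu; rewrite inE => /eqP->; rewrite /=; lia.
Qed.

Lemma rotK_bounds j' : exists (C : R) j, 0 <= C /\ forall y t,
  \sum_(cu <- rotK (rotc y) (rots y) t) `|cu.1| * (wabs abs1 j' cu.2)%:R <= C * (wabs abs0 j t)%:R.
Proof.
apply: (@kernel_poly _ _ _ _ _ _ _ 6 2 2 1) => // y [x [i j]].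
  rewrite big_map /=; apply: le_trans (rot_hom_norm (rot_sq y) _) _.
  rewrite ler_wpM2l// ler_nat; apply: leq_exp_base; rewrite /abs0/=; lia.
move=> cu /mapP[v /rot_hom_mem h ->]; rewrite /abs1 /abs0/=; move: h; rewrite !expn1/=; lia.
Qed.

Lemma rotK_bound y : kernel_bound (wabs abs0) (wabs abs1) (rotK (rotc y) (rots y)).
Proof. by move=> j'; have [C [j [C0 h]]] := rotK_bounds j'; exists C, j. Qed.

Lemma adK_bounds j' : exists (C : R) j, 0 <= C /\ forall y t,
  \sum_(cu <- adK y t) `|cu.1| * (wabs abs0 j' cu.2)%:R <= C * (wabs abs0 j t)%:R.
Proof.
apply: (@kernel_poly _ _ _ _ _ _ _ 4 0 2 1) => // y [x [i j]].
  have b z : `|rotc z| <= 1 /\ `|rots z| <= 1 := norm_cos_le1 (rot_sq (z : R)).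
  rewrite expn0 mulr1 /adK /lbind/= !big_cons big_nil/= !normrM addr0.
  have [h1 h2] := b ((absz i)%:R * y - 1); have [h3 h4] := b ((absz j)%:R * y - 1).
  have h (u v : R) : `|u| <= 1 -> `|v| <= 1 -> `|u| * `|v| <= 1 :> R by move=> *; rewrite mulr_ile1.
  have := h _ _ h1 h3; have := h _ _ h1 h4; have := h _ _ h2 h3; have := h _ _ h2 h4; lra.
move=> cu; rewrite /adK /lbind/= !inE => /or4P[] /eqP->; rewrite /abs0/=; lia.
Qed.

Lemma adK_bound y : kernel_bound (wabs abs0) (wabs abs0) (adK y).
Proof. by move=> j'; have [C [j [C0 h]]] := adK_bounds j'; exists C, j. Qed.

Lemma lsum_adK (M : lmodType R) y t (g : idx0 -> M) : lsum (adK y t) g =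
  lsum (rotv y t.2.1) (fun i => lsum (rotv y t.2.2) (fun j => g (t.1, (i, j)))).
Proof. by rewrite lsum_bind; apply: eq_lsum => i; rewrite /lsum big_map. Qed.

Lemma lsum_rotK (M : lmodType R) c s t (g : idx1 -> M) : lsum (rotK c s t) g =
  lsum (rot_hom c s t.1) (fun v => g (v, t.2)).
Proof. by rewrite /rotK /lsum big_map. Qed.

(* The rotation of e_i into e_{2i} is completed before the one of e_{i/2} into e_i starts. *)
Lemma rotv_ortho (M : lmodType R) y (i j : int) (m : M) :
  lsum (rotv y i) (fun k => lsum (rotv y j) (fun l => if k == l then m else 0)) =
  if i == j then m else 0.
Proof.
rewrite /rotv !lsum_cons !lsum_nil !addr0 /=.
set a := (absz i)%:R * y - 1; set b := (absz j)%:R * y - 1.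
have small (k : int) : k = 0 -> (absz k)%:R * y - 1 <= 0 by move=> ->; rewrite mul0r sub0r oppr_le0.
have dbl (k : int) : (absz (k + k))%:R = 2 * (absz k)%:R :> R.
  by rewrite -natrM; congr (_%:R); lia.
have van (k : int) z : rots ((absz k)%:R * z - 1) * rotc ((absz (k + k))%:R * z - 1) = 0 :> R.
  have [h|h] := leP ((absz k)%:R * z - 1) 0; first by rewrite (rots_le0 h) mul0r.
  by rewrite rotc_ge1 ?mulr0// dbl; lra.
case: (eqVneq i j) => [ij|ij].
  (* The index 0 is its own double, so the two entries of its column coincide in position; the
     second has coefficient 0. *)
  rewrite /a /b -ij eqxx; have [i0|i0] := eqVneq i 0.
    by rewrite rotc_le0 ?small// rots_le0 ?small// i0 eqxx !scale1r !scale0r !addr0.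
  rewrite (_ : (i == i + i) = false); last by lia.
  rewrite (_ : (i + i == i) = false); last by lia.
  by rewrite !scaler0 addr0 add0r !scalerA -scalerDl -!expr2 rot_sq scale1r.
rewrite (_ : (i + i == j + j) = false); last by lia.
rewrite !scaler0 add0r addr0.
case: (eqVneq i (j + j)) => ijj.
  rewrite (_ : (i + i == j) = false); last by lia.
  by rewrite !scaler0 addr0 scalerA mulrC /a /b ijj van scale0r.
rewrite /= !scaler0 add0r; case: eqP => jii; last by rewrite !scaler0.
by rewrite scalerA /a /b -jii van scale0r.
Qed.

Lemma rotv0 (M : lmodType R) i (g : int -> M) : lsum (rotv 0 i) g = g i.
Proof.
rewrite !lsum_cons lsum_nil mulr0 sub0r rotc_le0 ?rots_le0 ?oppr_le0//.
by rewrite scale1r scale0r !addr0.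
Qed.

Lemma rotv2 (M : lmodType R) y i (g : int -> M) : 2 <= y ->
  lsum (rotv y i) g = g (spread 0 i).
Proof.
move=> y2; rewrite !lsum_cons lsum_nil addr0; have [->|i0] := eqVneq i 0.
  by rewrite mul0r sub0r rotc_le0 ?rots_le0 ?oppr_le0// scale1r scale0r addr0.
have : 1 <= (absz i)%:R :> R by rewrite ler1n; lia.
move=> h; have h1 : 1 <= (absz i)%:R * y - 1 by nra.
by rewrite rotc_ge1// rots_ge1// scale1r scale0r add0r.
Qed.

End Kernels.

(** * The algebra of the bicyclic monoid over matrices and its endomorphisms *)

Section BicyclicAlgebra.
Context (R : realType) (S : tvsAlgebra R) (hS : is_lcalgebra S).
Local Notation C := (rapid S (wabs abs0)).
Local Notation D := (rapid S (wabs abs1)).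
Local Notation sg0 := (single (wabs abs0)).
Local Notation sg1 := (single (wabs abs1)).

Definition conv0 : C -> C -> C := pconv abs0 mul0.
Definition conv1 : D -> D -> D := pconv abs1 mul1.
Definition psi : C -> D := kpush (wabs abs1) (psiK R).
Definition rotate (y : R) : C -> D := kpush (wabs abs1) (rotK (rotc y) (rots y)).
Definition compress : D -> C := kpush (wabs abs0) (compK R).
Definition augment : C -> C := kpush (wabs abs0) (epsK R).
Definition dbl : C -> C := kpush (wabs abs0) (dblK R).
Definition component (b : bool) : D -> D := kpush (wabs abs1) (partK R b).
Definition ad (y : R) : C -> C := kpush (wabs abs0) (adK y).

Let cS : complete_hausdorff S := lcalgebra_complete hS.
Let gw0 : good_weight (wabs abs0) := good_wabs abs0 countable_idx0.
Let gw1 : good_weight (wabs abs1) := good_wabs abs1 countable_idx1.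
Let hC : hausdorff_space C := rapid_hausdorff gw0 cS.1.
Let hD : hausdorff_space D := rapid_hausdorff gw1 cS.1.

Lemma conv0_bilin : bilincont conv0.
Proof. by apply: pconv_bilincont => //; [exact: countable_idx0..|exact: mul0_abs]. Qed.
Lemma conv1_bilin : bilincont conv1.
Proof. by apply: pconv_bilincont => //; [exact: countable_idx1..|exact: mul1_abs]. Qed.
Lemma conv0_single t u s s' : conv0 (sg0 t s) (sg0 u s') =
  if mul0 t u is Some z then sg0 z (tva_mul s s') else 0.
Proof. by apply: pconv_single => //; [exact: countable_idx0..|exact: mul0_abs]. Qed.
Lemma conv1_single t u s s' : conv1 (sg1 t s) (sg1 u s') =
  if mul1 t u is Some z then sg1 z (tva_mul s s') else 0.
Proof. by apply: pconv_single => //; [exact: countable_idx1..|exact: mul1_abs]. Qed.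
Lemma conv1A x y z : conv1 (conv1 x y) z = conv1 x (conv1 y z).
Proof. by apply: pconvA => //; [exact: countable_idx1|exact: mul1_abs|exact: mul1A]. Qed.

Lemma psi_lin : lincont psi. Proof. exact/kpush_lincont/psiK_bound. Qed.
Lemma rot_lin y : lincont (rotate y). Proof. exact/kpush_lincont/rotK_bound. Qed.
Lemma comp_lin : lincont compress. Proof. exact/kpush_lincont/compK_bound. Qed.
Lemma eps_lin : lincont augment. Proof. exact/kpush_lincont/epsK_bound. Qed.
Lemma dbl_lin : lincont dbl. Proof. exact/kpush_lincont/dblK_bound. Qed.
Lemma part_lin b : lincont (component b). Proof. exact/kpush_lincont/partK_bound. Qed.
Lemma ad_lin y : lincont (ad y). Proof. exact/kpush_lincont/adK_bound. Qed.

Lemma psi_single t s : psi (sg0 t s) = sg1 (inr t.1, t.2) s.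
Proof. by rewrite /psi kpush_single//; [rewrite lsum_seq1 scale1r|exact: psiK_bound]. Qed.
Lemma rot_single y t s : rotate y (sg0 t s) =
  lsum (rot_hom (rotc y) (rots y) t.1) (fun v => sg1 (v, t.2) s).
Proof. by rewrite /rotate kpush_single//; [rewrite lsum_rotK|exact: rotK_bound]. Qed.
Lemma comp_single t s : compress (sg1 t s) =
  if t.1 is inl (b, (k, l)) then sg0 (b, (spread k t.2.1, spread l t.2.2)) s else 0.
Proof.
rewrite /compress kpush_single//; last exact: compK_bound.
by rewrite /compK; case: t.1 => [[b [k l]]|z]; rewrite ?lsum_nil ?lsum_seq1 ?scale1r.
Qed.
Lemma eps_single t s : augment (sg0 t s) = sg0 ((0%N, 0%N), t.2) s.
Proof. by rewrite /augment kpush_single//; [rewrite lsum_seq1 scale1r|exact: epsK_bound]. Qed.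
Lemma dbl_single t s : dbl (sg0 t s) = sg0 (t.1, (spread 0 t.2.1, spread 0 t.2.2)) s.
Proof. by rewrite /dbl kpush_single//; [rewrite lsum_seq1 scale1r|exact: dblK_bound]. Qed.
Lemma part_single b t s : component b (sg1 t s) =
  if (if t.1 is inl _ then true else false) == b then sg1 t s else 0.
Proof.
rewrite /component kpush_single//; last exact: partK_bound.
by rewrite /partK; case: ifP => _; rewrite ?lsum_nil ?lsum_seq1 ?scale1r.
Qed.
Lemma ad_single y t s : ad y (sg0 t s) =
  lsum (rotv y t.2.1) (fun i => lsum (rotv y t.2.2) (fun j => sg0 (t.1, (i, j)) s)).
Proof. by rewrite /ad kpush_single//; [rewrite lsum_adK|exact: adK_bound]. Qed.

Local Notation c0l := (bilincont_l conv0_bilin).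
Local Notation c0r := (bilincont_r conv0_bilin).
Local Notation c1l := (bilincont_l conv1_bilin).
Local Notation c1r := (bilincont_r conv1_bilin).

Lemma rot_mul y x z : rotate y (conv0 x z) = conv1 (rotate y x) (rotate y z).
Proof.
move: x z; apply: (biext gw0 gw0 hD).
- exact: bilincont_post conv0_bilin (rot_lin y).
- exact: bilincont_pre conv1_bilin (rot_lin y) (rot_lin y).
move=> [x [i i']] [z [j j']] s s'; rewrite conv0_single !rot_single.
rewrite (bilincont_lsum _ _ _ _ conv1_bilin) /mul0 /=.
have e u v : conv1 (sg1 (u, (i, i')) s) (sg1 (v, (j, j')) s') = if i' == j then
    (if levels_mul u v is Some w then sg1 (w, (i, j')) (tva_mul s s') else 0) else 0.
  by rewrite conv1_single /mul1/=; case: ifP => //; case: levels_mul.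
under [RHS]eq_lsum do under eq_lsum do rewrite e.
under [RHS]eq_lsum do rewrite lsum_if.
rewrite lsum_if; case: ifP => _; last by rewrite (lincont0 (rot_lin y)).
by rewrite rot_single -rot_hom_mul ?rot_sq// lsum_levels_prod.
Qed.

Lemma psi_mul x z : psi (conv0 x z) = conv1 (psi x) (psi z).
Proof.
move: x z; apply: (biext gw0 gw0 hD).
- exact: bilincont_post conv0_bilin psi_lin.
- exact: bilincont_pre conv1_bilin psi_lin psi_lin.
move=> [[x1 x2] [i i']] [z [j j']] s s'; rewrite conv0_single !psi_single conv1_single.
rewrite /mul0 /mul1/=; case: ifP => _; first by rewrite psi_single.
exact: lincont0 psi_lin.
Qed.

(** [component false] is the projection along the ideal of [inl] elements onto the subalgebra
    spanned by [inr] elements. Modulo this ideal [rotate y] and [psi] agree, see [part_rot]. *)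
Lemma part_mul x z : component false (conv1 x z) = conv1 (component false x) (component false z).
Proof.
move: x z; apply: (biext gw1 gw1 hD).
- exact: bilincont_post conv1_bilin (part_lin _).
- exact: bilincont_pre conv1_bilin (part_lin _) (part_lin _).
have p0 := lincont0 (part_lin false).
move=> [x [i i']] [z [j j']] s s'; rewrite conv1_single !part_single /mul1/=.
case: x => [[b [k l]]|[n m]]; case: z => [[b' [k' l']]|[n' m']] /=.
- by rewrite (lincont0 (c1l _)); do ?[case: ifP => _ //]; rewrite part_single.
- by rewrite (lincont0 (c1l _)); do ?[case: ifP => _ //]; rewrite part_single.
- by rewrite (lincont0 (c1r _)); do ?[case: ifP => _ //]; rewrite part_single.
- by rewrite conv1_single /mul1/=; case: ifP => // _; rewrite part_single.
Qed.

Lemma part_rot y x : component false (rotate y x) = psi x.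
Proof.
move: x; apply: (rapid_ext gw0 hD); [exact: lincont_comp (part_lin _) (rot_lin _)|exact: psi_lin|].
move=> [x ij] s; rewrite rot_single (lincont_lsum _ _ (part_lin _)) lsum_rot_hom !part_single psi_single /=.
rewrite subr0 [X in X + _]lsum_0 ?add0r// => u; rewrite lsum_0// => v.
by rewrite part_single.
Qed.

Lemma part_psi x : component false (psi x) = psi x.
Proof.
move: x; apply: (rapid_ext gw0 hD); [exact: lincont_comp (part_lin _) psi_lin|exact: psi_lin|].
by move=> t s; rewrite psi_single part_single.
Qed.

Lemma part_sum x : component true x + component false x = x.
Proof.
move: x; apply: (rapid_ext gw1 hD); [exact/lincont_add/part_lin/part_lin|exact: lincont_id|].
by move=> [[a|a] ij] s; rewrite !part_single/= ?addr0 ?add0r.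
Qed.

(** Since [spread] is injective, the relabelled matrix units multiply as before. The restriction to
    [component true] matters: [compress] drops [inr] parts, whose products with the ideal need not
    vanish. *)
Lemma comp_mul x z : compress (conv1 (component true x) (component true z)) = conv0 (compress x) (compress z).
Proof.
move: x z; apply: (biext gw1 gw1 hC).
- exact: bilincont_post (bilincont_pre conv1_bilin (part_lin _) (part_lin _)) comp_lin.
- exact: bilincont_pre conv0_bilin comp_lin comp_lin.
have p0 := lincont0 comp_lin.
move=> [x [i i']] [z [j j']] s s'; rewrite !part_single !comp_single.
case: x => [[b [k l]]|n] /=; last by rewrite (lincont0 (c1l _)) (lincont0 (c0l _)).
case: z => [[b' [k' l']]|n] /=; last by rewrite (lincont0 (c1r _)) (lincont0 (c0r _)).
rewrite conv1_single conv0_single /mul1 /mul0 /= spread_inj.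
case: eqP => _; case: eqP => _ //=; first by rewrite comp_single.
Qed.

Lemma comp_psi x : compress (psi x) = 0.
Proof.
move: x; apply: (rapid_ext gw0 hC); [exact: lincont_comp comp_lin psi_lin|exact: lincont_zero|].
by move=> t s; rewrite psi_single comp_single.
Qed.

(** At the final angle V acts as v on level 0, where psi(v) is the identity. So [rotate y x] and
    [psi x] differ only in the corner, by [x] against its value at v = 1. *)
Lemma comp_rot01 x (y : R) : 1 <= y -> compress (rotate y x) = dbl (x - augment x).
Proof.
move=> y1; move: x; apply: (rapid_ext gw0 hC).
- exact: lincont_comp comp_lin (rot_lin y).
- exact/(lincont_comp dbl_lin)/(lincont_add (lincont_id _))/lincont_opp/eps_lin.
move=> [[n m] [i j]] s; rewrite rot_single (lincont_lsum _ _ comp_lin) lsum_rot_hom/=.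
rewrite rotc_ge1// rots_ge1// !lsum_emit01 !comp_single/= addr0.
by rewrite (lincontB dbl_lin) eps_single !dbl_single.
Qed.

Lemma rot10 x (y : R) : y <= 0 -> rotate y x = psi x.
Proof.
move=> y1; move: x; apply: (rapid_ext gw0 hD); [exact: rot_lin|exact: psi_lin|].
move=> [[n m] [i j]] s; rewrite rot_single lsum_rot_hom/= psi_single.
by rewrite rotc_le0// rots_le0// !lsum_emit10 subrr add0r.
Qed.

Lemma eps_comp_single t s : augment (compress (sg1 t s)) =
  if t.1 is inl (b, (k, l)) then
    sg0 ((0%N, 0%N), (spread k t.2.1, spread l t.2.2)) s else 0.
Proof.
rewrite comp_single; case: t.1 => [[b [k l]]|z]; first by rewrite eps_single.
exact: lincont0 eps_lin.
Qed.

Let ec_lin : lincont (fun x => augment (compress x)). Proof. exact: lincont_comp eps_lin comp_lin. Qed.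

(* Forgetting the inner coordinate turns the rotated isometry into an isometry independent of
   the angle. *)
Lemma lsum_rot_level (M : lmodType R) (y : R) x (g : levels -> M) (h : nat -> nat -> M) :
  (forall b k l, g (inl (b, (k, l))) = h k l) -> (forall z, g (inr z) = 0) ->
  lsum (rot_hom (rotc y) (rots y) x) g = 0.
Proof.
move=> gh g0; rewrite lsum_rot_hom g0 addr0 gh.
have -> : lsum (emit (rotc y) (rots y) x.1) (fun u => lsum (emit (rotc y) (rots y) x.2)
   (fun v => g (inl ((u.2, v.2), (u.1, v.1))))) =
   lsum (emit (rotc y) (rots y) x.1) (fun u => h u.1 0%N).
  apply: eq_lsum => u; rewrite -(lsum_emit_level (rot_sq y) x.2 (h u.1)).
  by apply: eq_lsum => v; rewrite gh.
by rewrite (lsum_emit_level (rot_sq y) x.1 (h^~ 0%N)) subrr.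
Qed.

Lemma eps_comp_rot y x : augment (compress (rotate y x)) = 0.
Proof.
move: x; apply: (rapid_ext gw0 hC); [exact: lincont_comp ec_lin (rot_lin y)|exact: lincont_zero|].
move=> [x [i j]] s; rewrite rot_single (lincont_lsum _ _ ec_lin).
apply: (@lsum_rot_level _ _ _ _ (fun k l => sg0 ((0%N, 0%N), (spread k i, spread l j)) s)) => [b k l|z].
  by rewrite eps_comp_single.
by rewrite eps_comp_single.
Qed.

(** [compress] is not multiplicative across [inr] elements, so this does not follow from
    [eps_comp_rot]. But multiplication by [psi z] changes levels only and leaves the inner element
    alone; hence forgetting the inner coordinate still leaves a function [h] of the levels, and
    [lsum_rot_level] applies. *)
Lemma eps_comp_rotpsi y x z : augment (compress (conv1 (rotate y x) (psi z))) = 0.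
Proof.
move: x z; apply: (biext gw0 gw0 hC).
- exact: bilincont_post (bilincont_pre conv1_bilin (rot_lin y) psi_lin) ec_lin.
- exact: bilincont_post conv0_bilin (lincont_zero _ _).
move=> [x [i i']] [[n m] [j j']] s s'; rewrite rot_single psi_single.
rewrite (lincont_lsum _ _ (c1l _)) (lincont_lsum _ _ ec_lin).
have e u : augment (compress (conv1 (sg1 (u, (i, i')) s) (sg1 (inr (n, m), (j, j')) s'))) =
  if i' == j then if levels_mul u (inr (n, m)) is Some (inl (b, (k, l))) then
    sg0 ((0%N, 0%N), (spread k i, spread l j')) (tva_mul s s') else 0 else 0.
  rewrite conv1_single /mul1/=; case: ifP => _; last exact: lincont0 ec_lin.
  by case: levels_mul => [a|]; [rewrite eps_comp_single|rewrite (lincont0 ec_lin)].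
under eq_lsum do rewrite e.
rewrite lsum_if; case: ifP => // _.
pose h k l := if (if l == 0%N then Some (k, 0%N) else
  if (n < l)%N then Some (k, (l - n + m)%N) else None) is Some (k, l) then
    sg0 ((0%N, 0%N), (spread k i, spread l j')) (tva_mul s s') else 0.
apply: (@lsum_rot_level _ _ _ _ (h)) => [[b1 b2] k l|[p q]]; last by [].
by rewrite /h /=; case: ifP => // _; case: ifP.
Qed.

Lemma eps_comp_psirot y x z : augment (compress (conv1 (psi x) (rotate y z))) = 0.
Proof.
move: x z; apply: (biext gw0 gw0 hC).
- exact: bilincont_post (bilincont_pre conv1_bilin psi_lin (rot_lin y)) ec_lin.
- exact: bilincont_post conv0_bilin (lincont_zero _ _).
move=> [[n m] [i i']] [x [j j']] s s'; rewrite rot_single psi_single.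
rewrite (lincont_lsum _ _ (c1r _)) (lincont_lsum _ _ ec_lin).
have e u : augment (compress (conv1 (sg1 (inr (n, m), (i, i')) s) (sg1 (u, (j, j')) s'))) =
  if i' == j then if levels_mul (inr (n, m)) u is Some (inl (b, (k, l))) then
    sg0 ((0%N, 0%N), (spread k i, spread l j')) (tva_mul s s') else 0 else 0.
  have e0 := lincont0 ec_lin; rewrite conv1_single /mul1/=.
  case: u => [[[b1 b2] [k l]]|[p q]] /=; do ?[case: ifP => _ //];
    by rewrite eps_comp_single.
under eq_lsum do rewrite e.
rewrite lsum_if; case: ifP => // _.
pose h k l := if (if k == 0%N then Some (0%N, l) else
  if (m < k)%N then Some ((k - m + n)%N, l) else None) is Some (k, l) then
    sg0 ((0%N, 0%N), (spread k i, spread l j')) (tva_mul s s') else 0.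
apply: (@lsum_rot_level _ _ _ _ (h)) => [[b1 b2] k l|[p q]]; last by [].
by rewrite /h /=; case: ifP => // _; case: ifP.
Qed.

(** At the final angle the [inl] part of [rotate y x] sits in the corner, and on level 0 [psi z]
    acts as its value at v = 1, which is 0 for the pairs of interest. *)
Lemma comp_rotpsi01 y x z : 1 <= y ->
  compress (conv1 (rotate y x) (psi z)) = dbl (conv0 (x - augment x) (augment z)).
Proof.
move=> y1; move: x z; apply: (biext gw0 gw0 hC).
- exact: bilincont_post (bilincont_pre conv1_bilin (rot_lin y) psi_lin) comp_lin.
- apply: bilincont_post dbl_lin; apply: bilincont_pre conv0_bilin _ eps_lin.
  exact/(lincont_add (lincont_id _))/lincont_opp/eps_lin.
move=> [[n m] [i i']] [[n' m'] [j j']] s s'; rewrite rot_single psi_single !eps_single/=.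
rewrite (lincont_lsum _ _ (c1l _)) (lincont_lsum _ _ comp_lin) lsum_rot_hom.
rewrite rotc_ge1// rots_ge1// !lsum_emit01 !conv1_single /mul1 (lincontB (c0l _)) !conv0_single /mul0/=.
rewrite (lincontB dbl_lin); case: ifP => _; last by rewrite !(lincont0 comp_lin) (lincont0 dbl_lin) addr0.
by rewrite !comp_single/= addr0 !dbl_single /bmul/= ?addn0 ?subn0 ?sub0n ?add0n.
Qed.

Lemma comp_psirot01 y x z : 1 <= y ->
  compress (conv1 (psi x) (rotate y z)) = dbl (conv0 (augment x) (z - augment z)).
Proof.
move=> y1; move: x z; apply: (biext gw0 gw0 hC).
- exact: bilincont_post (bilincont_pre conv1_bilin psi_lin (rot_lin y)) comp_lin.
- apply: bilincont_post dbl_lin; apply: bilincont_pre conv0_bilin eps_lin _.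
  exact/(lincont_add (lincont_id _))/lincont_opp/eps_lin.
move=> [[n m] [i i']] [[n' m'] [j j']] s s'; rewrite rot_single psi_single !eps_single/=.
rewrite (lincont_lsum _ _ (c1r _)) (lincont_lsum _ _ comp_lin) lsum_rot_hom.
rewrite rotc_ge1// rots_ge1// !lsum_emit01 !conv1_single /mul1 (lincontB (c0r _)) !conv0_single /mul0/=.
rewrite (lincontB dbl_lin); case: ifP => _; last by rewrite !(lincont0 comp_lin) (lincont0 dbl_lin) addr0.
by rewrite !comp_single/= addr0 !dbl_single /bmul/= ?addn0 ?subn0 ?sub0n ?add0n.
Qed.

(** The columns of the conjugating matrix are orthonormal: the Kronecker delta of the two inner
    indices is expanded, by [rotv_ortho] read backwards, into the inner product of the corresponding
    columns. *)
Lemma ad_mul y x z : ad y (conv0 x z) = conv0 (ad y x) (ad y z).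
Proof.
move: x z; apply: (biext gw0 gw0 hC).
- exact: bilincont_post conv0_bilin (ad_lin y).
- exact: bilincont_pre conv0_bilin (ad_lin y) (ad_lin y).
move=> [x [i i']] [z [j j']] s s'; rewrite conv0_single !ad_single/=.
have -> : (if mul0 (x, (i, i')) (z, (j, j')) is Some u then sg0 u (tva_mul s s') else 0)
  = if i' == j then sg0 (bmul x z, (i, j')) (tva_mul s s') else 0 :> C.
  by rewrite /mul0/=; case: ifP.
rewrite (bilincont_lsum _ _ _ _ conv0_bilin).
transitivity (lsum (rotv y i) (fun i1 => if i' == j then
   lsum (rotv y j') (fun j1 => sg0 (bmul x z, (i1, j1)) (tva_mul s s')) else 0)).
  rewrite lsum_if; case: ifP => _; last exact: lincont0 (ad_lin y).
  by rewrite ad_single.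
apply: eq_lsum => i1; rewrite eq_sym -(rotv_ortho y); apply: eq_lsum => k.
rewrite (lincont_lsum _ _ (c0l _)); apply: eq_lsum => l.
rewrite (lincont_lsum _ _ (c0r _)) -lsum_if; apply: eq_lsum => j1.
by rewrite conv0_single /mul0/= eq_sym; case: ifP.
Qed.

Lemma eps_ad y x : augment (ad y x) = ad y (augment x).
Proof.
move: x; apply: (rapid_ext gw0 hC).
- exact: lincont_comp eps_lin (ad_lin y).
- exact: lincont_comp (ad_lin y) eps_lin.
move=> [x [i i']] s; rewrite eps_single !ad_single/= (lincont_lsum _ _ eps_lin).
apply: eq_lsum => k; rewrite (lincont_lsum _ _ eps_lin); apply: eq_lsum => l.
by rewrite eps_single.
Qed.

Lemma ad0 x : ad 0 x = x.
Proof.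
move: x; apply: (rapid_ext gw0 hC); [exact: ad_lin|exact: lincont_id|].
by move=> [x [i i']] s; rewrite ad_single/= !rotv0.
Qed.

Lemma ad_ge2 y x : 2 <= y -> ad y x = dbl x.
Proof.
move=> y2; move: x; apply: (rapid_ext gw0 hC); [exact: ad_lin|exact: dbl_lin|].
by move=> [x [i i']] s; rewrite ad_single dbl_single/= !rotv2.
Qed.

(** * Units as pairs and the contraction formula *)

Definition cir0 (x z : C) : C := x + z + conv0 x z.
Definition cir1 (x z : D) : D := x + z + conv1 x z.

Lemma cir1A x y z : cir1 (cir1 x y) z = cir1 x (cir1 y z).
Proof.
rewrite /cir1 !(bilincontDl conv1_bilin) !(bilincontDr conv1_bilin) conv1A.
set xy := conv1 x y; set xz := conv1 x z; set yz := conv1 y z; rewrite !addrA.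
by rewrite (addrAC _ xy z) (addrAC _ xz yz) (addrAC _ xy yz).
Qed.

Lemma rot_cir y x z : rotate y (cir0 x z) = cir1 (rotate y x) (rotate y z).
Proof. by rewrite /cir0 !(lincontD (rot_lin y)) rot_mul. Qed.
Lemma psi_cir x z : psi (cir0 x z) = cir1 (psi x) (psi z).
Proof. by rewrite /cir0 !(lincontD psi_lin) psi_mul. Qed.
Lemma ad_cir y x z : ad y (cir0 x z) = cir0 (ad y x) (ad y z).
Proof. by rewrite /cir0 !(lincontD (ad_lin y)) ad_mul. Qed.
Lemma part_cir x z : component false (cir1 x z) = cir1 (component false x) (component false z).
Proof. by rewrite /cir1 !(lincontD (part_lin false)) part_mul. Qed.

Lemma comp_cir x z : component false x = 0 -> component false z = 0 ->
  compress (cir1 x z) = cir0 (compress x) (compress z).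
Proof.
move=> hx hz; rewrite /cir1 /cir0 !(lincontD comp_lin) -comp_mul.
have e u : component false u = 0 -> component true u = u.
  by move=> h; rewrite -[RHS]part_sum h addr0.
by rewrite !e.
Qed.

Definition invertible_pair (x z : C) : Prop :=
  [/\ augment x = 0, augment z = 0, cir0 x z = 0 & cir0 z x = 0].

(** For g = 1 + x with inverse 1 + z, this is the compression of Phi(g) psi(g)^-1 minus 1, and
    [right_shear] is that of the inverse psi(g) Phi(g)^-1. Both are explicit in the pair, so the
    topology of the unit group, which records the inverse, causes no extra work. *)
Definition left_shear y (x z : C) : C := compress (cir1 (rotate y x) (psi z)).
Definition right_shear y (x z : C) : C := compress (cir1 (psi x) (rotate y z)).

Section Pair.
Context (x z : C) (h : invertible_pair x z).

Lemma ad_pair y : invertible_pair (ad y x) (ad y z).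
Proof.
case: h => ex ez xz zx; have a0 := lincont0 (ad_lin y).
by split; rewrite ?eps_ad -?ad_cir ?ex ?ez ?xz ?zx.
Qed.

Lemma shear_pair y : invertible_pair (left_shear y x z) (right_shear y x z).
Proof.
case: h => ex ez xz zx; rewrite /left_shear /right_shear.
have p0 := lincont0 psi_lin; have r0 := lincont0 (rot_lin y).
have c0 := lincont0 comp_lin; have e0 := lincont0 eps_lin.
set l := cir1 (rotate y x) (psi z); set r := cir1 (psi x) (rotate y z).
(* Modulo the ideal [rotate y x] is [psi x], so the product reduces to the image of [cir0 x z = 0];
   lying in the ideal is what [comp_cir] asks for. *)
have pl : component false l = 0 by rewrite part_cir part_rot part_psi -psi_cir xz p0.
have pr : component false r = 0 by rewrite part_cir part_rot part_psi -psi_cir xz p0.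
split.
- rewrite /l /cir1 !(lincontD comp_lin) !(lincontD eps_lin) eps_comp_rot comp_psi e0.
  by rewrite eps_comp_rotpsi !addr0.
- rewrite /r /cir1 !(lincontD comp_lin) !(lincontD eps_lin) eps_comp_rot comp_psi e0.
  by rewrite eps_comp_psirot !addr0.
(* The product is Phi(g) psi(g)^-1 psi(g) Phi(g)^-1: the middle factors cancel first, then the outer
   ones; the next case is the same in the other order. *)
- rewrite -comp_cir// /l /r cir1A -[cir1 (psi z) _]cir1A -psi_cir zx p0.
  by rewrite [cir1 0 _](_ : _ = rotate y z) -?rot_cir ?xz ?r0// /cir1 (lincont0 (c1l _)) add0r addr0.
- rewrite -comp_cir// /l /r cir1A -[cir1 (rotate y z) _]cir1A -rot_cir zx r0.
  by rewrite [cir1 0 _](_ : _ = psi z) -?psi_cir ?xz ?p0// /cir1 (lincont0 (c1l _)) add0r addr0.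
Qed.

Lemma left_shear_ge1 y : 1 <= y -> left_shear y x z = dbl x.
Proof.
case: h => ex ez xz zx y1; rewrite /left_shear /cir1 !(lincontD comp_lin) comp_psi.
by rewrite comp_rot01// comp_rotpsi01// ex ez subr0 (lincont0 (c0r _)) (lincont0 dbl_lin) !addr0.
Qed.

Lemma right_shear_ge1 y : 1 <= y -> right_shear y x z = dbl z.
Proof.
case: h => ex ez xz zx y1; rewrite /right_shear /cir1 !(lincontD comp_lin) comp_psi.
by rewrite comp_rot01// comp_psirot01// ex ez subr0 (lincont0 (c0l _)) (lincont0 dbl_lin) addr0 add0r.
Qed.

Lemma left_shear_le0 y : y <= 0 -> left_shear y x z = 0.
Proof.
case: h => ex ez xz zx y0; rewrite /left_shear rot10// -psi_cir xz.
by rewrite (lincont0 psi_lin) (lincont0 comp_lin).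
Qed.

Lemma right_shear_le0 y : y <= 0 -> right_shear y x z = 0.
Proof.
case: h => ex ez xz zx y0; rewrite /right_shear rot10// -psi_cir xz.
by rewrite (lincont0 psi_lin) (lincont0 comp_lin).
Qed.

End Pair.

(* On each half of the interval one of the two homotopies equals the constant [dbl]. *)
Definition contr_l (y : R) (x z : C) : C :=
  ad (4 * y) x + left_shear (2 - 2 * y) x z - dbl x.
Definition contr_r (y : R) (x z : C) : C :=
  ad (4 * y) z + right_shear (2 - 2 * y) x z - dbl z.

Lemma contr_pair y x z : invertible_pair x z ->
  invertible_pair (contr_l y x z) (contr_r y x z).
Proof.
move=> h; rewrite /contr_l /contr_r; have [y1|y1] := leP y (2^-1).
  have y2 : 1 <= 2 - 2 * y by lra.
  by rewrite left_shear_ge1// right_shear_ge1// !addrK; exact: ad_pair.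
rewrite !ad_ge2; [|lra|lra]; rewrite ![dbl _ + _]addrC !addrK; exact: shear_pair.
Qed.

Lemma contr0 x z : invertible_pair x z -> contr_l 0 x z = x /\ contr_r 0 x z = z.
Proof.
move=> h; rewrite /contr_l /contr_r !mulr0 subr0 !ad0.
by rewrite left_shear_ge1 ?right_shear_ge1 ?addrK ?ler1n.
Qed.

Lemma contr1 x z : invertible_pair x z -> contr_l 1 x z = 0 /\ contr_r 1 x z = 0.
Proof.
move=> h; rewrite /contr_l /contr_r !mulr1 subrr !ad_ge2 ?ler_nat//.
by rewrite left_shear_le0 ?right_shear_le0// addr0 subrr addr0 subrr.
Qed.

Lemma continuous_ad (Y : topologicalType) (a : Y -> R) (x : Y -> C) :
  continuous a -> continuous x -> continuous (fun t => ad (a t) (x t)).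
Proof.
move=> ca cx; apply: (kpush_continuous cS gw0 gw0 (K := fun t => adK (a t))) => //.
- by move=> j'; have [B [j [B0 h]]] := adK_bounds R j'; exists B, j; split.
move=> t s; under [X in continuous X]eq_fun do rewrite lsum_adK.
have cr i : continuous (fun u => (absz i)%:R * a u - 1).
  move=> u; apply: cvgB; last exact: cvg_cst.
  by apply: cvgM; [exact: cvg_cst|exact: ca].
have cl (V : tvsType R) (g : Y -> int -> V) i : (forall k, continuous (g^~ k)) ->
    continuous (fun u => lsum (rotv (a u) i) (g u)).
  move=> cg; rewrite [X in continuous X](_ : _ = fun u =>
      rotc ((absz i)%:R * a u - 1) *: g u i + rots ((absz i)%:R * a u - 1) *: g u (spread 0 i)).
    apply: continuousD_tvs; (apply: continuousZ_tvs; last exact: cg) => u.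
      by apply: (continuous_comp (cr i u)); exact: continuous_rotc.
    by apply: (continuous_comp (cr i u)); exact: continuous_rots.
  by apply/funext => u; rewrite !lsum_cons lsum_nil addr0.
by apply: (cl C) => k; apply: (cl C) => l u; exact: cvg_cst.
Qed.

Lemma continuous_rot (Y : topologicalType) (a : Y -> R) (x : Y -> C) :
  continuous a -> continuous x -> continuous (fun t => rotate (a t) (x t)).
Proof.
move=> ca cx.
apply: (kpush_continuous cS gw0 gw1 (K := fun t => rotK (rotc (a t)) (rots (a t)))) => //.
- by move=> j'; have [B [j [B0 h]]] := rotK_bounds R j'; exists B, j; split.
move=> t s; under [X in continuous X]eq_fun do rewrite lsum_rotK.
apply: continuous_rot_hom => u.
  by apply: (continuous_comp (ca u)); exact: continuous_rotc.
by apply: (continuous_comp (ca u)); exact: continuous_rots.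
Qed.

Lemma continuous_contr (Y : topologicalType) (a : Y -> R) (x z : Y -> C) :
  continuous a -> continuous x -> continuous z ->
  continuous (fun t => contr_l (a t) (x t) (z t)) /\
  continuous (fun t => contr_r (a t) (x t) (z t)).
Proof.
move=> ca cx cz.
have c4 : continuous (fun t => 4 * a t).
  by move=> u; apply: cvgM; [exact: cvg_cst|exact: ca].
have c2 : continuous (fun t => 2 - 2 * a t).
  move=> u; apply: cvgB; first exact: cvg_cst.
  by apply: cvgM; [exact: cvg_cst|exact: ca].
have cl (V W : tvsType R) (f : V -> W) (g : Y -> V) :
    lincont f -> continuous g -> continuous (fun t => f (g t)).
  by move=> hf cg u; apply: (continuous_comp (cg u)); exact: lincont_continuous.
have cd (g : Y -> C) : continuous g -> continuous (fun t => - dbl (g t)).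
  by move=> cg; apply: continuousN_tvs; exact: (cl _ _ _ _ dbl_lin).
have cp (g : Y -> C) := cl _ _ _ g psi_lin.
have cr (g : Y -> C) := @continuous_rot Y _ g c2.
split; apply: continuousD_tvs (cd _ _); rewrite //;
  (apply: continuousD_tvs; first exact: continuous_ad);
  apply: (cl _ _ _ _ comp_lin); apply: continuousD_tvs.
- exact: continuousD_tvs (cr _ cx) (cp _ cz).
- exact: (bilincont_continuous conv1_bilin (cr _ cx) (cp _ cz)).
- exact: continuousD_tvs (cp _ cx) (cr _ cz).
- exact: (bilincont_continuous conv1_bilin (cp _ cx) (cr _ cz)).
Qed.

End BicyclicAlgebra.

(** * Matrix weights and infinite sums of bilinear maps *)

Lemma good_matrix_weight (T : choiceType) (a : T -> nat) : countable [set: T] ->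
  good_weight (fun (kl : nat * nat) (nm : T * T) =>
    (1 + a nm.1) ^ kl.1 * (1 + a nm.2) ^ kl.2)%N.
Proof.
move=> cT; split.
- by move=> kl nm; rewrite muln_gt0 !expn_gt0.
- move=> [k l] [k' l']; exists (maxn k k', maxn l l') => nm.
  by split; apply: leq_mul; apply: leq_pexp2l; rewrite ?leq_maxl ?leq_maxr.
- exact: inhabits (0%N, 0%N).
- by rewrite -setXTT; exact: countableX.
Qed.

Lemma sum_one_le (R : realType) (K : choiceType) (F : {fset K}) (k0 : K) (g : K -> R) (c : R) :
  0 <= c -> (forall k, g k <= if k == k0 then c else 0) -> \sum_(k <- F) g k <= c.
Proof.
move=> c0 hg; apply: le_trans (ler_sum _ (fun k _ => hg k)) _.
apply: (@le_trans _ _ (\sum_(k <- (F `|` [fset k0])%fset) if k == k0 then c else 0)).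
  by apply: ler_sum_fsub => [k|]; [case: ifP|exact: fsubsetUl].
rewrite (big_fsetD_sum _ (fsubsetUr F [fset k0]%fset)) big_seq_fset1 eqxx big1_seq ?addr0//.
by move=> k /=; rewrite !inE => /andP[/negbTE->].
Qed.

Lemma csn_bigsumP (R : realType) (V : tvsType R) I (s : seq I) (P : I -> csn V) :
  exists Q : csn V, forall x, Q x = \sum_(i <- s) P i x.
Proof.
elim: s => [|i s [Q h]].
  by have [Q h] := csn0P V; exists Q => x; rewrite big_nil.
by have [Q' h'] := csn_addP (P i) Q; exists Q' => x; rewrite h' big_cons h.
Qed.

Lemma continuous_pair (X Y Z : topologicalType) (f : X -> Y) (g : X -> Z) :
  continuous f -> continuous g -> continuous (fun x => (f x, g x)).
Proof.
move=> cf cg x.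
by apply: (@cvg_pair _ _ _ _ (nbhs (f x)) (nbhs (g x))); [exact: cf|exact: cg].
Qed.

Section BilinearSums.
Context (R : realType) (V V' W : tvsType R) (cW : complete_hausdorff W).
Context (T T' K : choiceType) (J J' : Type) (w : J -> T -> nat) (w' : J' -> T' -> nat).
Context (gw : good_weight w) (gw' : good_weight w') (cK : countable [set: K]).
Context (f : K -> rapid V w -> rapid V' w' -> W) (hf : forall k, bilincont (f k)).
Context (hb : forall P : csn W, exists (Q : csn (rapid V w)) (Q' : csn (rapid V' w')),
  forall x y (F : {fset K}), \sum_(k <- F) P (f k x y) <= Q x * Q' y).

Let h x y := tsum (fun k => f k x y).

Let hs x y : sums_to (fun k => f k x y) (h x y).
Proof.
apply: summable_sums_to => // P; have [Q [Q' hQ]] := hb P.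
by exists (Q x * Q' y) => F.
Qed.

Let h_bilin : bilincont h.
Proof.
have u l l' g : sums_to g l -> sums_to g l' -> l = l' :> W.
  by move=> /(sums_to_tsum cW.1) <- /(sums_to_tsum cW.1).
split.
- move=> x x' y; apply: u (hs _ _) _; have := sums_toD (hs x y) (hs x' y).
  by under [X in sums_to X _ -> _]eq_fun do rewrite -(bilincontDl (hf _)).
- move=> x y y'; apply: u (hs _ _) _; have := sums_toD (hs x y) (hs x y').
  by under [X in sums_to X _ -> _]eq_fun do rewrite -(bilincontDr (hf _)).
- move=> c x y; apply: u (hs _ _) _.
  have := sums_to_lincont (lincont_scale c (lincont_id W)) (hs x y).
  by under [X in sums_to X _ -> _]eq_fun do rewrite -(bilincontZl (hf _)).
- move=> c x y; apply: u (hs _ _) _.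
  have := sums_to_lincont (lincont_scale c (lincont_id W)) (hs x y).
  by under [X in sums_to X _ -> _]eq_fun do rewrite -(bilincontZr (hf _)).
- move=> P; have [Q [Q' hQ]] := hb P; exists Q, Q' => x y.
  exact: sums_to_csn (hs x y) (hQ x y).
Qed.

(** Identifies an infinite sum, such as an entry of a matrix product, with a bilinear map known on
    basis elements: by [hb] the sum is itself a bounded bilinear map, and [biext] compares the
    two. *)
Lemma bilinear_sums (g : rapid V w -> rapid V' w' -> W) : bilincont g ->
  (forall t t' s s', sums_to (fun k => f k (single w t s) (single w' t' s'))
     (g (single w t s) (single w' t' s'))) ->
  forall x y, sums_to (fun k => f k x y) (g x y).
Proof.
move=> hg e x y; rewrite -(_ : h x y = g x y); first exact: hs.
move: x y; apply: (biext gw gw' cW.1) => // t t' s s'.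
by apply: (sums_to_tsum cW.1); exact: e.
Qed.

End BilinearSums.

(** * Coordinates on the Toeplitz algebra *)

Section Stable.
Context (R : realType) (S : tvsAlgebra R) (hS : is_lcalgebra S).
Local Notation C := (rapid S (wabs abs0)).
Local Notation sg0 := (single (wabs abs0)).
Local Notation wA := (fun (kl : nat * nat) (nm : int * int) =>
    (1 + absz nm.1) ^ kl.1 * (1 + absz nm.2) ^ kl.2)%N.
Local Notation wN := (fun (kl : nat * nat) (nm : nat * nat) =>
    (1 + id nm.1) ^ kl.1 * (1 + id nm.2) ^ kl.2)%N.
Local Notation wL := (fun (k : nat) (n : int) => (1 + absz n) ^ k)%N.
Local Notation A := (rapid_matrix absz S).
Local Notation Aalg := (rapid_matrix_algebra absz S).
Local Notation L := (laurent A).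
Local Notation K := (rapid_matrix (id : nat -> nat) A).
Local Notation sgA := (single wA : int * int -> S -> A).
Local Notation sgL := (single wL : int -> A -> L).
Local Notation sgK := (single wN : nat * nat -> A -> K).

Let cS : complete_hausdorff S := lcalgebra_complete hS.
Let gw0 : good_weight (wabs abs0) := good_wabs abs0 countable_idx0.
Let hC : complete_hausdorff C := rapid_complete gw0 cS.
Let gwA : good_weight wA := @good_matrix_weight int absz (countableP _).
Let gwN : good_weight wN := @good_matrix_weight nat id (countableP _).
Let gwL : good_weight wL := @good_wabs int absz (countableP _).
Let hA : complete_hausdorff A := rapid_complete gwA cS.
Let hL : complete_hausdorff L := rapid_complete gwL hA.
Let hK : complete_hausdorff K := rapid_complete gwN hA.

Definition convA_fun (t u : int * int) (s s' : S) : A :=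
  if t.2 == u.1 then sgA (t.1, u.2) (tva_mul s s') else 0.

Definition convA : A -> A -> A := bipush convA_fun.

Lemma convA_bipushable : bipushable wA wA convA_fun.
Proof.
rewrite /convA_fun; split.
- move=> t u s s1 s'; case: ifP => _; last by rewrite addr0.
  by rewrite (lca_mulDl hS) singleD.
- move=> t u s s' s1; case: ifP => _; last by rewrite addr0.
  by rewrite (lca_mulDr hS) singleD.
- move=> t u c s s'; case: ifP => _; last by rewrite scaler0.
  by rewrite (lca_mulZl hS) singleZ.
- move=> t u c s s'; case: ifP => _; last by rewrite scaler0.
  by rewrite (lca_mulZr hS) singleZ.
move=> P; have [[[k l] p] hP] := rapid_csn_dom gwA P.
have [q [q' hq]] := bilincont_bound (lcalgebra_bilincont hS) p.
(* The row weight of a product is charged to the left factor and the column weight to the right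
   one. *)
exists ((k, 0%N), q), ((0%N, l), q') => t u s s' /=.
case: ifP => _; last by rewrite csn0 !mulr_ge0 ?csn_ge0.
apply: le_trans (hP _) _; apply: le_trans (rapid_norm_single _ _ _ _) _ => /=.
rewrite mulrACA; apply: ler_pM; rewrite ?csn_ge0//.
by rewrite -natrM ler_nat expn0 muln1 expn0 mul1n.
Qed.

Lemma convA_bilin : bilincont convA.
Proof. by apply: bipush_bilincont => //; exact: convA_bipushable. Qed.

Lemma convA_single t u s s' : convA (sgA t s) (sgA u s') = convA_fun t u s s'.
Proof. by apply: bipush_single => //; exact: convA_bipushable. Qed.

Lemma convA_sums (x y : A) n m :
  sums_to (fun k => tva_mul (x (n, k)) (y (k, m))) (convA x y (n, m)).
Proof.
have bm := lcalgebra_bilincont hS.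
move: x y; apply: (bilinear_sums cS gwA gwA (countableP _)
   (f := fun k x y => tva_mul (x (n, k)) (y (k, m)))).
- by move=> k; exact: bilincont_pre bm (lincont_eval S gwA (n, k)) (lincont_eval S gwA (k, m)).
- move=> P; have [q [q' hq]] := bilincont_bound bm P.
  exists (rapid_csn wA ((0%N, 0%N), q)), (rapid_csn wA ((0%N, 0%N), q')) => x y F /=.
  apply: (@le_trans _ _ (\sum_(k <- F) q (x (n, k)) * rapid_norm ((0%N, 0%N), q') y)).
    apply: ler_sum => k _; apply: le_trans (hq _ _) _.
    by rewrite ler_wpM2l ?csn_ge0//; exact: (eval_bound gwA ((0%N, 0%N), q')).
  rewrite -mulr_suml ler_wpM2r ?rapid_norm_ge0//.
  have := rapid_norm_sum ((0%N, 0%N), q) x [fset (n, k) | k in F]%fset.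
  apply: le_trans; rewrite big_imfset/=; last by move=> ? ? _ _ [].
  by apply: ler_sum => k _; rewrite /rterm/= !expn0 muln1 mul1r.
- exact: bilincont_post convA_bilin (lincont_eval S gwA (n, m)).
move=> [i j] [i' j'] s s'; rewrite convA_single /convA_fun/=.
have l0 := lincont0 (bilincont_l bm _); have r0 := lincont0 (bilincont_r bm _).
have -> : (if j == i' then sgA (i, j') (tva_mul s s') else 0) (n, m) =
    tva_mul (sgA (i, j) s (n, j)) (sgA (i', j') s' (j, m)).
  rewrite !singleE !xpair_eqE eqxx andbT; case: (j == i'); last by rewrite r0.
  rewrite singleE xpair_eqE; case: (n == i); last by rewrite l0.
  by case: (m == j'); rewrite ?r0.
apply: (@sums_to_single _ _ _ (fun k => tva_mul (sgA (i, j) s (n, k)) (sgA (i', j') s' (k, m))) j) => k /negbTE kj.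
by rewrite singleE xpair_eqE kj andbF l0.
Qed.

(** The rapidly decreasing matrix [convA x y] has the required entries, so the default value of
    [xget] does not occur. *)
Lemma mulAE (x y : Aalg) : tva_mul x y = convA x y.
Proof.
rewrite /=; apply: xget_unique.
  apply/funext => -[n m]; apply/esym; rewrite /matrix_mul.
  exact: sums_to_tsum cS.1 _ _ (convA_sums x y n m).
move=> z hz; apply: rapidP => -[n m]; rewrite hz /matrix_mul.
exact: sums_to_tsum cS.1 _ _ (convA_sums x y n m).
Qed.


Lemma single_csn (P : csn A) : exists k l (p : csn S), forall ij s,
  P (sgA ij s) <= (wA (k, l) ij)%:R * p s.
Proof.
have [[[k l] p] hP] := rapid_csn_dom gwA P; exists k, l, p => ij s.
by apply: le_trans (hP _) _; exact: (rapid_norm_single wA ((k, l), p)).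
Qed.

Lemma nested_csn (T : choiceType) (J : Type) (w : J -> T -> nat) (gw : good_weight w)
    (P : csn (rapid A w)) : exists j k l (p : csn S), forall t ij s,
  P (single w t (sgA ij s)) <= (w j t)%:R * ((wA (k, l) ij)%:R * p s).
Proof.
have [[j Q] hP] := rapid_csn_dom gw P; have [k [l [p h]]] := single_csn Q.
exists j, k, l, p => t ij s; apply: le_trans (hP _) _.
apply: le_trans (rapid_norm_single w (j, Q) t _) _.
by rewrite ler_wpM2l.
Qed.

Definition incl (b : nat * nat) : A -> C := push (fun ij (s : S) => sg0 (b, ij) s).

Lemma incl_csn (P : csn C) : exists k (p : csn S), forall b ij s,
  P (sg0 (b, ij) s) <= ((1 + (b.1 + b.2)) ^ k)%:R * ((wA (k, k) ij)%:R * p s).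
Proof.
have [[k p] hP] := rapid_csn_dom gw0 P; exists k, p => b ij s.
apply: le_trans (hP _) _; apply: le_trans (rapid_norm_single _ _ _ _) _ => /=.
rewrite mulrA -natrM ler_wpM2r ?csn_ge0// ler_nat /wabs -!expnMn.
by apply: leq_exp_base; rewrite /abs0/=; nia.
Qed.

Lemma incl_pushable b : pushable wA (fun ij (s : S) => sg0 (b, ij) s).
Proof.
split=> [ij s s'|ij c s|P]; [exact: singleD|exact: singleZ|].
have [k [p h]] := incl_csn P; have [q hq] := csn_scaleP p (ler0n R ((1 + (b.1 + b.2)) ^ k)).
by exists ((k, k), q) => ij s; apply: le_trans (h _ _ _) _; rewrite /= hq mulrCA.
Qed.

Lemma incl_lin b : lincont (incl b).
Proof. by apply: push_lincont => //; exact: incl_pushable. Qed.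

Lemma incl_single b ij s : incl b (sgA ij s) = sg0 (b, ij) s.
Proof. by apply: push_single => //; exact: incl_pushable. Qed.

Lemma incl_bound (P : csn C) : exists k (Q : csn A), forall b x,
  P (incl b x) <= ((1 + (b.1 + b.2)) ^ k)%:R * Q x.
Proof.
have [k [p h]] := incl_csn P; exists k, (rapid_csn wA ((k, k), p)) => b x.
by apply: push_bound => //; exact: incl_pushable.
Qed.

(* The Toeplitz algebra in coordinates v^n v*^m: W(z^n) is v^n or v*^(-n), and e_nm = v^n
   v*^m - v^(n+1) v*^(m+1). *)
Definition diag_index (n : int) : nat * nat :=
  if n is Posz k then (k, 0%N) else (0%N, absz n).

Definition th_laurent : L -> C := push (fun n (x : A) => incl (diag_index n) x).
Definition th_compact : K -> C :=
  push (fun nm (x : A) => incl nm x - incl (nm.1.+1, nm.2.+1) x).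
Definition to_laurent : C -> L :=
  push (fun t (s : S) => sgL (Posz t.1.1 - Posz t.1.2) (sgA t.2 s)).
(** The matrix of v^n v*^m is a diagonal of ones that starts at entry (n, m). The Toeplitz matrix of
    its symbol fills the whole diagonal, and the subtracted units e_{n-r-1,m-r-1} are the min(n, m)
    entries before the start. *)
Definition to_compact : C -> K :=
  push (fun t (s : S) => - \sum_(r < minn t.1.1 t.1.2)
    sgK ((t.1.1 - r.+1)%N, (t.1.2 - r.+1)%N) (sgA t.2 s)).
(** The condition for entry (n, m) of the 0-1 matrix of v^p v*^q, with [b] = (p, q), to be 1: it
    lies on the diagonal through (p, q), not before that point. *)
Definition ent_cond (n m : nat) (b : nat * nat) : bool :=
  [&& (b.1 <= n)%N, (b.2 <= m)%N & (n - b.1 == m - b.2)%N].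
Definition entry (n m : nat) : C -> A :=
  push (fun t (s : S) => if ent_cond n m t.1 then sgA t.2 s else 0).
Definition augmentA : C -> A := push (fun t (s : S) => sgA t.2 s).

Lemma th_laurent_pushable : pushable wL (fun n (x : A) => incl (diag_index n) x).
Proof.
split=> [n x x'|n c x|P]; [exact: lincontD (incl_lin _) _ _|exact: lincontZ (incl_lin _) _ _|].
have [k [Q h]] := incl_bound P; exists (k, Q) => n x; apply: le_trans (h _ _) _.
by case: n => n; rewrite /= ?addn0 ?add0n.
Qed.

Lemma th_compact_pushable :
  pushable wN (fun nm (x : A) => incl nm x - incl (nm.1.+1, nm.2.+1) x).
Proof.
split=> [n x x'|n c x|P].
- by rewrite !(lincontD (incl_lin _)) opprD addrACA.
- by rewrite !(lincontZ (incl_lin _)) scalerBr.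
have [k [Q h]] := incl_bound P.
have [Q' hQ] := csn_scaleP Q (ler0n R (2 * 3 ^ k)).
exists ((k, k), Q') => -[n m] x /=; apply: le_trans (csnD _ _ _) _; rewrite csnN hQ.
apply: (@le_trans _ _ ((3 ^ k * ((1 + n) ^ k * (1 + m) ^ k))%:R * Q x +
    (3 ^ k * ((1 + n) ^ k * (1 + m) ^ k))%:R * Q x)).
  by apply: lerD; apply: le_trans (h _ _) _; rewrite ler_wpM2r ?csn_ge0// ler_nat -!expnMn;
    apply: leq_exp_base => /=; nia.
rewrite !natrM; move: (3 ^ k)%N%:R ((1 + n) ^ k)%N%:R ((1 + m) ^ k)%N%:R => u v z.
by rewrite le_eqVlt; apply/orP; left; apply/eqP; ring.
Qed.

Lemma to_laurent_pushable : pushable (wabs abs0)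
  (fun t (s : S) => sgL (Posz t.1.1 - Posz t.1.2) (sgA t.2 s)).
Proof.
split=> [t s s'|t c s|P]; first by rewrite !singleD.
  by rewrite !singleZ.
have [j [k [l [p h]]]] := nested_csn gwL P.
exists ((j + k + l)%N, p) => -[[n m] [i i']] s; apply: le_trans (h _ _ _) _ => /=.
rewrite mulrA -natrM ler_wpM2r ?csn_ge0// ler_nat /wabs !expnD -mulnA.
by apply: leq_mul; [|apply: leq_mul]; apply: leq_exp_base; rewrite /abs0/=; lia.
Qed.

Lemma to_compact_pushable : pushable (wabs abs0)
  (fun t (s : S) => - \sum_(r < minn t.1.1 t.1.2)
    sgK ((t.1.1 - r.+1)%N, (t.1.2 - r.+1)%N) (sgA t.2 s)).
Proof.
split=> [t s s'|t c s|P].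
- by rewrite -opprD -big_split; congr (- _); apply: eq_bigr => r _; rewrite !singleD.
- by rewrite scalerN scaler_sumr; congr (- _); apply: eq_bigr => r _; rewrite !singleZ.
have [[j j'] [k [l [p h]]]] := nested_csn gwN P.
(* The extra power of the weight pays for the number [minn n m] of summands. *)
exists ((1 + j + j' + k + l)%N, p) => -[[n m] [i i']] s /=; rewrite csnN.
apply: le_trans (csn_sum _ _ _) _.
set B := (wabs abs0 (j + j' + k + l) ((n, m), (i, i')))%:R * p s.
apply: (@le_trans _ _ (\sum_(r < minn n m) B)).
  apply: ler_sum => r _; apply: le_trans (h _ _ _) _ => /=.
  rewrite mulrA -natrM ler_wpM2r ?csn_ge0// ler_nat /wabs !expnD -[leqRHS]mulnA.
  by apply: leq_mul; apply: leq_mul; apply: leq_exp_base; rewrite /abs0/=; lia.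
rewrite sumr_const card_ord -[leLHS]mulr_natl /B mulrA -natrM ler_wpM2r ?csn_ge0// ler_nat.
rewrite /wabs -!addnA expnS; apply: leq_mul => //; rewrite /abs0/=; lia.
Qed.

Lemma entry_csn (P : csn A) : exists k (p : csn S), forall t s,
  P (sgA t.2 s) <= (wabs abs0 k t)%:R * p s.
Proof.
have [k [l [p h]]] := single_csn P; exists (k + l)%N, p => -[b [i j]] s.
apply: le_trans (h _ _) _; rewrite ler_wpM2r ?csn_ge0// ler_nat /wabs expnD.
by apply: leq_mul; apply: leq_exp_base; rewrite /abs0/=; lia.
Qed.

Lemma entry_pushable n m : pushable (wabs abs0)
  (fun t (s : S) => if ent_cond n m t.1 then sgA t.2 s else 0).
Proof.
split=> [t s s'|t c s|P].
- by case: ifP => _; rewrite ?singleD ?addr0.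
- by case: ifP => _; rewrite ?singleZ ?scaler0.
have [k [p h]] := entry_csn P; exists (k, p) => t s.
by case: ifP => _ //; rewrite csn0 mulr_ge0 ?csn_ge0.
Qed.

Lemma eps0_pushable : pushable (wabs abs0) (fun t (s : S) => sgA t.2 s).
Proof.
split=> [t s s'|t c s|P]; [exact: singleD|exact: singleZ|].
by have [k [p h]] := entry_csn P; exists (k, p).
Qed.

Lemma th_laurent_lin : lincont th_laurent.
Proof. by apply: push_lincont => //; exact: th_laurent_pushable. Qed.
Lemma th_compact_lin : lincont th_compact.
Proof. by apply: push_lincont => //; exact: th_compact_pushable. Qed.
Lemma to_laurent_lin : lincont to_laurent.
Proof. by apply: push_lincont => //; exact: to_laurent_pushable. Qed.
Lemma to_compact_lin : lincont to_compact.
Proof. by apply: push_lincont => //; exact: to_compact_pushable. Qed.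
Lemma entry_lin n m : lincont (entry n m).
Proof. by apply: push_lincont => //; exact: entry_pushable. Qed.
Lemma eps0_lin : lincont augmentA.
Proof. by apply: push_lincont => //; exact: eps0_pushable. Qed.

Lemma th_laurent_single n x : th_laurent (sgL n x) = incl (diag_index n) x.
Proof. by apply: push_single => //; exact: th_laurent_pushable. Qed.
Lemma th_compact_single nm x :
  th_compact (sgK nm x) = incl nm x - incl (nm.1.+1, nm.2.+1) x.
Proof. by apply: push_single => //; exact: th_compact_pushable. Qed.
Lemma to_laurent_single t s :
  to_laurent (sg0 t s) = sgL (Posz t.1.1 - Posz t.1.2) (sgA t.2 s).
Proof. by rewrite /to_laurent push_single//; exact: to_laurent_pushable. Qed.
Lemma to_compact_single t s : to_compact (sg0 t s) = - \sum_(r < minn t.1.1 t.1.2)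
    sgK ((t.1.1 - r.+1)%N, (t.1.2 - r.+1)%N) (sgA t.2 s).
Proof. by rewrite /to_compact push_single//; exact: to_compact_pushable. Qed.
Lemma entry_single n m t s :
  entry n m (sg0 t s) = if ent_cond n m t.1 then sgA t.2 s else 0.
Proof. by rewrite /entry push_single//; exact: entry_pushable. Qed.
Lemma eps0_single t s : augmentA (sg0 t s) = sgA t.2 s.
Proof. by rewrite /augmentA push_single//; exact: eps0_pushable. Qed.

Lemma entry_incl n m b x : entry n m (incl b x) = if ent_cond n m b then x else 0.
Proof.
move: x; apply: (rapid_ext gwA hA.1).
- exact: lincont_comp (entry_lin n m) (incl_lin b).
- by case: (ent_cond n m b); [exact: lincont_id|exact: lincont_zero].
by move=> ij s; rewrite incl_single entry_single.
Qed.

Lemma eps0_incl b x : augmentA (incl b x) = x.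
Proof.
move: x; apply: (rapid_ext gwA hA.1).
- exact: lincont_comp eps0_lin (incl_lin b).
- exact: lincont_id.
by move=> ij s; rewrite incl_single eps0_single.
Qed.

Lemma incl_eps0 x : incl (0%N, 0%N) (augmentA x) = augment x.
Proof.
move: x; apply: (rapid_ext gw0 hC.1).
- exact: lincont_comp (incl_lin _) eps0_lin.
- exact: eps_lin hS.
by move=> t s; rewrite (eps_single hS) eps0_single incl_single.
Qed.

Lemma to_laurent_th_laurent a : to_laurent (th_laurent a) = a.
Proof.
move: a; apply: (rapid_ext gwL hL.1).
- exact: lincont_comp to_laurent_lin th_laurent_lin.
- exact: lincont_id.
move=> n x; rewrite th_laurent_single; move: x; apply: (rapid_ext gwA hL.1).
- exact: lincont_comp to_laurent_lin (incl_lin _).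
- exact: (lincont_single _ gwL n).
move=> ij s; rewrite incl_single to_laurent_single; congr (sgL _ _).
by case: n => n /=; lia.
Qed.

Lemma to_compact_th_laurent a : to_compact (th_laurent a) = 0.
Proof.
move: a; apply: (rapid_ext gwL hK.1).
- exact: lincont_comp to_compact_lin th_laurent_lin.
- exact: lincont_zero.
move=> n x; rewrite th_laurent_single; move: x; apply: (rapid_ext gwA hK.1).
- exact: lincont_comp to_compact_lin (incl_lin _).
- exact: lincont_zero.
move=> ij s; rewrite incl_single to_compact_single.
have -> : minn ((diag_index n, ij).1.1) ((diag_index n, ij).1.2) = 0%N by case: n => n /=; lia.
by rewrite big_ord0 oppr0.
Qed.

Lemma to_laurent_th_compact p : to_laurent (th_compact p) = 0.
Proof.
move: p; apply: (rapid_ext gwN hL.1).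
- exact: lincont_comp to_laurent_lin th_compact_lin.
- exact: lincont_zero.
move=> [n m] x; rewrite th_compact_single (lincontB to_laurent_lin).
move: x; apply: (rapid_ext gwA hL.1).
- exact: lincont_add (lincont_comp to_laurent_lin (incl_lin _))
    (lincont_opp (lincont_comp to_laurent_lin (incl_lin _))).
- exact: lincont_zero.
move=> ij s; rewrite !incl_single !to_laurent_single /=.
by have -> : Posz n.+1 - Posz m.+1 = Posz n - Posz m; [lia|rewrite subrr].
Qed.

Lemma to_compact_th_compact p : to_compact (th_compact p) = p.
Proof.
move: p; apply: (rapid_ext gwN hK.1).
- exact: lincont_comp to_compact_lin th_compact_lin.
- exact: lincont_id.
move=> [n m] x; rewrite th_compact_single (lincontB to_compact_lin).
move: x; apply: (rapid_ext gwA hK.1).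
- exact: lincont_add (lincont_comp to_compact_lin (incl_lin _))
    (lincont_opp (lincont_comp to_compact_lin (incl_lin _))).
- exact: (lincont_single _ gwN (n, m)).
move=> ij s; rewrite !incl_single !to_compact_single /= opprK minnSS big_ord_recl /=.
rewrite !subn1/= addrC -addrA [X in _ + X](_ : _ = 0) ?addr0//.
by apply/eqP; rewrite subr_eq0; apply/eqP; apply: eq_bigr => r _; rewrite !subSS.
Qed.

Lemma th_to x : th_laurent (to_laurent x) + th_compact (to_compact x) = x.
Proof.
move: x; apply: (rapid_ext gw0 hC.1).
- exact: lincont_add (lincont_comp th_laurent_lin to_laurent_lin)
    (lincont_comp th_compact_lin to_compact_lin).
- exact: lincont_id.
move=> [[n m] ij] s; rewrite to_laurent_single th_laurent_single incl_single /=.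
rewrite to_compact_single /= (lincontN th_compact_lin) (lincont_sum th_compact_lin).
have -> : diag_index (Posz n - Posz m) = (n - minn n m, m - minn n m)%N.
  case: (leqP m n) => h.
    have -> : Posz n - Posz m = Posz (n - m)%N by lia.
    by rewrite /diag_index subnn.
  have -> : Posz n - Posz m = Negz (m - n).-1 by lia.
  by rewrite /diag_index subnn /=; congr pair; lia.
(* The images of the subtracted matrix units telescope; the induction runs on how many of them are
   summed. *)
have : (minn n m <= n)%N /\ (minn n m <= m)%N by rewrite geq_minl geq_minr.
elim: (minn n m) => [|k IH] [kn km]; first by rewrite big_ord0 oppr0 addr0 !subn0.
rewrite big_ord_recr/= opprD th_compact_single !incl_single/=.
rewrite -[RHS]IH; last by split; exact: ltnW.
have -> : (n - k.+1).+1 = (n - k)%N by lia.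
have -> : (m - k.+1).+1 = (m - k)%N by lia.
by rewrite opprB addrCA [X in _ + X]addrC subrK addrC.
Qed.


Lemma entry_th_laurent n m (a : L) : entry n m (th_laurent a) = a (Posz n - Posz m).
Proof.
move: a; apply: (rapid_ext gwL hA.1).
- exact: lincont_comp (entry_lin n m) th_laurent_lin.
- exact: (lincont_eval A gwL).
move=> k x; rewrite th_laurent_single entry_incl singleE.
have -> // : ent_cond n m (diag_index k) = (Posz n - Posz m == k).
by rewrite /ent_cond; case: k => k /=; lia.
Qed.

Lemma entry_th_compact n m (p : K) : entry n m (th_compact p) = p (n, m).
Proof.
move: p; apply: (rapid_ext gwN hA.1).
- exact: lincont_comp (entry_lin n m) th_compact_lin.
- exact: (lincont_eval A gwN).
move=> [k l] x; rewrite th_compact_single (lincontB (entry_lin n m)) !entry_incl singleE.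
rewrite xpair_eqE /ent_cond/=.
have [kl|kl] := boolP ((n == k) && (m == l)).
  rewrite ifT; last by lia.
  by rewrite ifF ?subr0//; lia.
case: ifP => h; first by rewrite ifT ?subrr//; lia.
by rewrite ifF ?subr0//; lia.
Qed.

(** The same differencing along the diagonal as in [coef_inl]. It shows that the matrix determines
    the coordinates, hence also symbol and compact part. *)
Lemma entry_coef n m ij (X : C) : X ((n, m), ij) = entry n m X ij -
  (if n is n'.+1 then if m is m'.+1 then entry n' m' X ij else 0 else 0).
Proof.
move: X; apply: (rapid_ext gw0 cS.1).
- exact: (lincont_eval S gw0).
- have h n' m' : lincont (fun X => entry n' m' X ij).
    exact: lincont_comp (lincont_eval S gwA ij) (entry_lin n' m').
  apply: lincont_add; first exact: h.
  apply: lincont_opp; case: n => [|n]; first exact: lincont_zero.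
  by case: m => [|m]; [exact: lincont_zero|exact: h].
move=> [[p q] ij'] s; rewrite singleE xpair_eqE xpair_eqE.
have e n' m' : entry n' m' (sg0 ((p, q), ij') s) ij =
    if ent_cond n' m' (p, q) then if ij == ij' then s else 0 else 0.
  by rewrite entry_single/=; case: ifP => // _; rewrite singleE.
case: n => [|n]; case: m => [|m]; rewrite !e; case: (ij == ij'); rewrite ?andbF ?andbT ?if_same ?subr0//.
all: rewrite /ent_cond/=.
- by congr (if _ then _ else _); lia.
- by congr (if _ then _ else _); lia.
- by congr (if _ then _ else _); lia.
have [kl|kl] := boolP ((n.+1 == p) && (m.+1 == q)).
  rewrite ifT; last by lia.
  by rewrite ifF ?subr0//; lia.
case: ifP => h; first by rewrite ifT ?subrr//; lia.
by rewrite ifF ?subr0//; lia.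
Qed.

(** Row [n] of v^a v*^b has at most one nonzero entry, in column n - a + b, so sums along a row are
    controlled on basis elements by a single weight; [entry_col_le] is the transpose. *)
Lemma entry_row_le (Q : csn A) n : exists Q' : csn C, forall X (F : {fset nat}),
  \sum_(k <- F) Q (entry n k X) <= Q' X.
Proof.
have [k [p h]] := entry_csn Q; exists (rapid_csn (wabs abs0) (k, p)) => X F /=.
have [Qs hQs] := csn_bigsumP F (fun i => projT1 (cid (lincont_csn (entry_lin n i) Q))).
have e Y : Qs Y = \sum_(i <- F) Q (entry n i Y).
  by rewrite hQs; apply: eq_bigr => i _; case: cid => /=.
rewrite -e -[leRHS]mul1r; apply: (rapid_csn_le gw0) => // -[[a b] ij] s; rewrite mul1r e /=.
apply: (@sum_one_le _ _ _ (n - a + b)%N); first by rewrite mulr_ge0 ?csn_ge0.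
move=> i; rewrite entry_single /ent_cond/=; case: ifP => [c|_].
  by rewrite ifT; [exact: (h ((a, b), ij))|lia].
by rewrite csn0; case: ifP => // _; rewrite mulr_ge0 ?csn_ge0.
Qed.

Lemma entry_col_le (Q : csn A) m : exists Q' : csn C, forall X (F : {fset nat}),
  \sum_(k <- F) Q (entry k m X) <= Q' X.
Proof.
have [k [p h]] := entry_csn Q; exists (rapid_csn (wabs abs0) (k, p)) => X F /=.
have [Qs hQs] := csn_bigsumP F (fun i => projT1 (cid (lincont_csn (entry_lin i m) Q))).
have e Y : Qs Y = \sum_(i <- F) Q (entry i m Y).
  by rewrite hQs; apply: eq_bigr => i _; case: cid => /=.
rewrite -e -[leRHS]mul1r; apply: (rapid_csn_le gw0) => // -[[a b] ij] s; rewrite mul1r e /=.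
apply: (@sum_one_le _ _ _ (m - b + a)%N); first by rewrite mulr_ge0 ?csn_ge0.
move=> i; rewrite entry_single /ent_cond/=; case: ifP => [c|_].
  by rewrite ifT; [exact: (h ((a, b), ij))|lia].
by rewrite csn0; case: ifP => // _; rewrite mulr_ge0 ?csn_ge0.
Qed.

(** A sum of products is at most the product of the row sum and the column sum, which is the
    estimate that [bilinear_sums] needs. For basis elements only the inner index [k0] contributes,
    being the column of the one nonzero entry in row [n] of the left factor. *)
Lemma entry_conv_sums n m X Y :
  sums_to (fun k => convA (entry n k X) (entry k m Y)) (entry n m (conv0 X Y)).
Proof.
have bA := convA_bilin; have b0 := conv0_bilin hS.
move: X Y; apply: (bilinear_sums hA gw0 gw0 (countableP _)
   (f := fun k X Y => convA (entry n k X) (entry k m Y))).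
- by move=> k; exact: bilincont_pre bA (entry_lin n k) (entry_lin k m).
- move=> P; have [q [q' hq]] := bilincont_bound bA P.
  have [Q hQ] := entry_row_le q n; have [Q' hQ'] := entry_col_le q' m.
  exists Q, Q' => X Y F.
  apply: le_trans (ler_pM _ _ (hQ X F) (hQ' Y F)); last 2 first.
  + by apply: sumr_ge0 => i _; exact: csn_ge0.
  + by apply: sumr_ge0 => i _; exact: csn_ge0.
  rewrite mulr_suml; rewrite !big_seq; apply: ler_sum => k kF.
  apply: le_trans (hq _ _) _; apply: ler_wpM2l; first exact: csn_ge0.
  rewrite -big_seq (big_fsetD_sum _ (_ : [fset k] `<=` F)%fset) ?fsub1set//.
  by rewrite big_seq_fset1 lerDl; apply: sumr_ge0 => i _; exact: csn_ge0.
- exact: bilincont_post b0 (entry_lin n m).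
move=> [[p q] [i j]] [[p' q'] [i' j']] s s'.
have l0 := lincont0 (bilincont_l bA _); have r0 := lincont0 (bilincont_r bA _).
have e0 := lincont0 (entry_lin n m).
pose k0 := (n - p + q)%N.
set X0 := sg0 _ s; set Y0 := sg0 _ s'.
have E : convA (entry n k0 X0) (entry k0 m Y0) = entry n m (conv0 X0 Y0).
  have -> : conv0 X0 Y0 =
      if j == i' then sg0 (bmul (p, q) (p', q'), (i, j')) (tva_mul s s') else 0.
    by rewrite (conv0_single hS) /mul0/=; case: ifP.
  rewrite !entry_single /=; have [c1|c1] := boolP (ent_cond n k0 (p, q)); last first.
    rewrite l0; case: (j == i') => //; rewrite entry_single ifF//.
    by move: c1; rewrite /ent_cond /bmul /k0/=; lia.
  have [c2|c2] := boolP (ent_cond k0 m (p', q')); last first.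
    rewrite r0; case: (j == i') => //; rewrite entry_single ifF//.
    by move: c1 c2; rewrite /ent_cond /bmul /k0/=; lia.
  rewrite convA_single /convA_fun/=; case: (j == i') => //; rewrite entry_single ifT//.
  by move: c1 c2; rewrite /ent_cond /bmul /k0/=; lia.
rewrite -E; apply: (@sums_to_single _ _ _ (fun k => convA (entry n k X0) (entry k m Y0)) k0).
move=> k /eqP kk; rewrite !entry_single /= ifF ?l0//.
by apply/negP; rewrite /ent_cond/=; move: kk; rewrite /k0; lia.
Qed.

(** * Transport of the contraction to the Toeplitz algebra *)

Local Notation B := (toeplitz A).
Local Notation Balg := (toeplitz_algebra Aalg).

Definition theta (x : B) : C := th_laurent x.1 + th_compact x.2.
Definition theta_inv (X : C) : B := (to_laurent X, to_compact X).

Lemma thetaK x : theta_inv (theta x) = x.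
Proof.
case: x => a p; rewrite /theta /theta_inv/=; congr pair.
  by rewrite (lincontD to_laurent_lin) to_laurent_th_laurent to_laurent_th_compact addr0.
by rewrite (lincontD to_compact_lin) to_compact_th_laurent to_compact_th_compact add0r.
Qed.

Lemma theta_invK X : theta (theta_inv X) = X.
Proof. exact: th_to. Qed.

Lemma matrix_of_toeplitzE (x : B) n m : matrix_of_toeplitz x (n, m) = entry n m (theta x).
Proof.
by rewrite /theta (lincontD (entry_lin n m)) entry_th_laurent entry_th_compact.
Qed.

Lemma matrix_of_toeplitz_inj (x y : B) :
  matrix_of_toeplitz x = matrix_of_toeplitz y -> x = y.
Proof.
move=> h; rewrite -[x]thetaK -[y]thetaK; congr theta_inv; apply: rapidP => -[[n m] ij].
have e n' m' : entry n' m' (theta x) = entry n' m' (theta y).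
  by rewrite -!matrix_of_toeplitzE h.
by rewrite !entry_coef e; case: n => [|n]; case: m => [|m]; rewrite ?e.
Qed.

(** The convolution product has the entries of the matrix product, and [matrix_of_toeplitz_inj]
    makes it the only choice for [xget]. *)
Lemma mulBE (x y : Balg) : tva_mul x y = theta_inv (conv0 (theta x) (theta y)).
Proof.
set z := theta_inv _.
have zE : matrix_of_toeplitz z = @matrix_mul R Aalg nat (matrix_of_toeplitz x) (matrix_of_toeplitz y).
  apply/funext => -[n m]; rewrite matrix_of_toeplitzE theta_invK; apply/esym.
  rewrite /matrix_mul; apply: (sums_to_tsum hA.1).
  rewrite [X in sums_to X _](_ : _ = fun k => convA (entry n k (theta x)) (entry k m (theta y))).
    exact: entry_conv_sums.
  by apply/funext => k; rewrite mulAE !matrix_of_toeplitzE.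
rewrite [LHS]/=; apply: xget_unique => // u hu.
by apply: matrix_of_toeplitz_inj; rewrite zE hu.
Qed.

(** The value of the symbol at 1 is the sum of its coefficients, which is what v |-> 1 gives on the
    Toeplitz part. The compact part contributes 0, each e_nm being a difference of two elements with
    the same value. *)
Lemma eps_theta (x : B) : pointed_toeplitz Aalg x <-> augment (theta x) = 0.
Proof.
have e : laurent_at1 x.1 = augmentA (theta x).
  apply: (sums_to_tsum hA.1); rewrite /theta (lincontD eps0_lin).
  have -> : augmentA (th_compact x.2) = 0.
    move: x.2; apply: (rapid_ext gwN hA.1).
    - exact: lincont_comp eps0_lin th_compact_lin.
    - exact: lincont_zero.
    by move=> nm a; rewrite th_compact_single (lincontB eps0_lin) !eps0_incl subrr.
  rewrite addr0; have := sums_to_lincont (lincont_comp eps0_lin th_laurent_lin) (rapid_sums gwL x.1).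
  by under [X in sums_to X _ -> _]eq_fun do rewrite th_laurent_single eps0_incl.
rewrite /pointed_toeplitz/= e -incl_eps0; split=> [->|h].
  exact: lincont0 (incl_lin _).
by rewrite -(eps0_incl (0%N, 0%N) (augmentA _)) h (lincont0 eps0_lin).
Qed.

Lemma theta_circ (x y : Balg) : theta (circ x y) = cir0 (theta x) (theta y).
Proof.
have tD (u v : B) : theta (u + v) = theta u + theta v.
  by rewrite /theta (lincontD th_laurent_lin) (lincontD th_compact_lin) addrACA.
by rewrite /circ mulBE !tD theta_invK.
Qed.

Lemma theta0 : theta 0 = 0.
Proof. by rewrite /theta (lincont0 th_laurent_lin) (lincont0 th_compact_lin) addr0. Qed.

Lemma unit_group_pairP (x y : Balg) :
  [/\ pointed_toeplitz Aalg x, pointed_toeplitz Aalg y, circ x y = 0 & circ y x = 0] <->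
  invertible_pair (theta x) (theta y).
Proof.
have e (u : Balg) : u = 0 <-> theta u = 0.
  split=> [->|h]; first exact: theta0.
  by rewrite -[u]thetaK h -[RHS]thetaK theta0.
by rewrite /invertible_pair -!theta_circ; split=> -[/eps_theta ? /eps_theta ? /e ? /e ?].
Qed.

Lemma continuous_theta (Y : topologicalType) (f : Y -> B) :
  continuous f -> continuous (fun y => theta (f y)).
Proof.
move=> cf; apply: continuousD_tvs => y.
  apply: (@continuous_comp _ _ _ (fun y => (f y).1) th_laurent).
    by apply: (continuous_comp (cf y)); exact: cvg_fst.
  exact: lincont_continuous th_laurent_lin _.
apply: (@continuous_comp _ _ _ (fun y => (f y).2) th_compact).
  by apply: (continuous_comp (cf y)); exact: cvg_snd.
exact: lincont_continuous th_compact_lin _.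
Qed.

Lemma continuous_theta_inv (Y : topologicalType) (f : Y -> C) :
  continuous f -> continuous (fun y => theta_inv (f y)).
Proof.
move=> cf y.
apply: (@cvg_pair _ _ _ _ (nbhs (to_laurent (f y))) (nbhs (to_compact (f y))));
  apply: (continuous_comp (cf y)).
  exact: lincont_continuous to_laurent_lin _.
exact: lincont_continuous to_compact_lin _.
Qed.

Local Notation U := (unit_group (pointed_toeplitz Aalg)).

Lemma U_pair (x : U) : invertible_pair (theta (\val x).1) (theta (\val x).2).
Proof. by apply/unit_group_pairP; exact: set_mem (valP x). Qed.


Definition to_unit (x z : C) (h : invertible_pair x z) : U :=
  exist _ (theta_inv x, theta_inv z) (mem_set ((unit_group_pairP (theta_inv x) (theta_inv z)).2
    (eq_ind_r (fun u => invertible_pair u _) (eq_ind_r (invertible_pair x) h (theta_invK z))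
      (theta_invK x)))).

(** Defined for every real parameter, since [contr_pair] holds without restriction on it; continuity
    over the unit interval is then a restriction. *)
Definition contraction (tx : R * U) : U :=
  to_unit (contr_pair hS tx.1 (U_pair tx.2)).

Lemma to_unit_eq (x z : C) (h : invertible_pair x z) (u : U) :
  x = theta (\val u).1 -> z = theta (\val u).2 -> to_unit h = u.
Proof.
move=> hx hz; apply: val_inj => /=; rewrite hx hz !thetaK.
exact: esym (surjective_pairing _).
Qed.

Lemma continuous_contraction : continuous contraction.
Proof.
apply: continuous_comp_initial.
have c1 : continuous (fst : R * U -> R) by move=> y; exact: cvg_fst.
have cv : continuous (fun tx : R * U => \val tx.2).
  move=> y; apply: (@continuous_comp _ _ _ snd (\val : U -> _)); first exact: cvg_snd.
  exact: initial_continuous.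
have c2 : continuous (fun tx : R * U => theta (\val tx.2).1).
  by apply: continuous_theta => y; apply: (continuous_comp (cv y)); exact: cvg_fst.
have c3 : continuous (fun tx : R * U => theta (\val tx.2).2).
  by apply: continuous_theta => y; apply: (continuous_comp (cv y)); exact: cvg_snd.
have [cl cr] := continuous_contr hS c1 c2 c3.
exact: continuous_pair (continuous_theta_inv cl) (continuous_theta_inv cr).
Qed.

Lemma unit_group_contractible : contractible R U.
Proof.
have h00 : invertible_pair (0 : C) 0.
  have b0 := conv0_bilin hS.
  by split; rewrite ?(lincont0 (eps_lin hS))// /cir0 (lincont0 (bilincont_l b0 _)) !addr0.
exists (to_unit h00), contraction; split.
- exact: continuous_subspaceT continuous_contraction.
- move=> u; have [hl hr] := contr0 hS (U_pair u).
  by apply: to_unit_eq; [exact: hl|exact: hr].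
- move=> u; have [hl hr] := contr1 hS (U_pair u).
  apply: to_unit_eq => /=; rewrite theta_invK; [exact: hl|exact: hr].
Qed.

End Stable.

Theorem mainTheorem3 (R : realType) (S : tvsAlgebra R) (hS : is_lcalgebra S) :
  contractible R
    (unit_group (pointed_toeplitz (rapid_matrix_algebra absz S))).
Proof. exact: unit_group_contractible. Qed.
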